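(* There exists $\beta_0>0$, depending on $\Lambda$ and $J^{neum}$, such that for any $0\le\beta<\beta_0$, any $G\in C^2_0([-1,1])$ and any $\delta>0$, $$\lim_{N\to\infty}\mu_N^{stat}\Big[\big|\langle\pi^N,G\rangle-\langle\bar\rho,G\rangle\big|\ge\delta\Big]=0,$$ where $\bar\rho$ is the unique weak solution of the boundary value problem $$\begin{cases}\Delta\rho(u)-\beta\,\nabla\cdot\big\{\rho(u)(1-\rho(u))\nabla(J^{neum}\star\rho)(u)\big\}=0,\quad u\in\Lambda,\\ \rho(\mp1)=\rho_\mp.\end{cases}$$
   Context: Parameters and kernel. $\beta\ge0$, $\rho_-,\rho_+\in(0,1)$, $\Lambda=(-1,1)$. $J:\mathbb R\times\mathbb R\to[0,\infty)$ is a smooth, symmetric, translation invariant probability kernel of range 1: $J(u,v)=J(0,v-u)$, $J(0,u)=0$ for $|u|>1$, $\int J(u,v)\,dv=1$. Set $J^{neum}(u,v)=J(u,v)+J(u,2-v)+J(u,-2-v)$ and $(J^{neum}\star m)(u)=\int_\Lambda J^{neum}(u,v)m(v)\,dv$. Particle system. $\Lambda_N=\{-N,\dots,N\}$, $\mathcal S_N=\{0,1\}^{\Lambda_N}$. $\eta^{x,y}$ is obtained from $\eta$ by exchanging $\eta(x),\eta(y)$, and $\sigma^x\eta$ by replacing $\eta(x)$ by $1-\eta(x)$. $H_N(\eta)=-\frac12\sum_{x,y\in\Lambda_N}N^{-1}J^{neum}(\frac xN,\frac yN)\eta(x)\eta(y)$, $C_N^\beta(x,y;\eta)=\exp\{-\frac\beta2[H_N(\eta^{x,y})-H_N(\eta)]\}$,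 and $$(\mathcal L_Nf)(\eta)=\sum_{x=-N}^{N-1}C_N^\beta(x,x+1;\eta)[f(\eta^{x,x+1})-f(\eta)]+c_-(\eta(-N))[f(\sigma^{-N}\eta)-f(\eta)]+c_+(\eta(N))[f(\sigma^N\eta)-f(\eta)],$$ with $c_\pm(\zeta)=\rho_\pm(1-\zeta)+(1-\rho_\pm)\zeta$. The Markov process on $\mathcal S_N$ with generator $\mathcal L_N$ is irreducible; $\mu_N^{stat}=\mu_N^{stat}(\beta,\rho_-,\rho_+)$ is its unique invariant probability measure. Other notation. $\pi^N=\pi^N(\eta)$ is the empirical density $\pi^N(\eta)(u)=\sum_{x=-N+1}^{N-1}\eta(x)\mathbf 1\{u\in[\frac xN-\frac1{2N},\frac xN+\frac1{2N})\}$; $\langle f,g\rangle=\int_\Lambda fg\,du$; $\nabla,\Delta$ are derivatives in $u$; $\sigma(\rho)=2\rho(1-\rho)$; $C_0^2([-1,1])$ is the set of $C^2$ functions on $[-1,1]$ (up to the boundary) vanishing at $\pm1$. A weak solution of the stationary problem is a function $\rho\in H^1(\Lambda)$ with $0\le\rho\le1$ such that for every $G\in C_0^2([-1,1])$ $$-\langle\rho,\Delta G\rangle+\rho_+\nabla G(1)-\rho_-\nabla G(-1)-\frac\beta2\langle\sigma(\rho),\nabla G\cdot\nabla(J^{neum}\star\rho)\rangle=0.$$ *)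

(* Defs.v *)
From HB Require Import structures.
From mathcomp Require Import all_boot all_order all_algebra.
From mathcomp Require Import perm.
From mathcomp Require Import all_classical all_reals all_analysis.

Set Implicit Arguments.
Unset Strict Implicit.
Unset Printing Implicit Defensive.

Import Order.TTheory GRing.Theory Num.Theory.
Import numFieldNormedType.Exports.

Local Open Scope classical_set_scope.
Local Open Scope ring_scope.

Definition Lambda (R : realType) : set R := `]-1, 1[%classic.
Arguments Lambda : clear implicits.

Definition inner (R : realType) (f g : R -> R) : R :=
  (\int[lebesgue_measure]_(u in Lambda R) (f u * g u))%R.

(* Iterated partial derivatives; [true] differentiates in the second
   variable, [false] in the first. *)
Fixpoint partials (R : realType) (w : seq bool) (f : R -> R -> R) : R -> R -> R :=
  if w is b :: w' then
    let g := partials w' f in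
    if b then fun u v => derive1 (g u) v else fun u v => derive1 (g ^~ v) u
  else f.

Definition smooth2 (R : realType) (f : R -> R -> R) : Prop :=
  forall (w : seq bool) (p : R * R),
    differentiable (fun q : R * R => partials w f q.1 q.2) p.

Record is_kernel (R : realType) (J : R -> R -> R) : Prop := IsKernel {
  kernel_smooth : smooth2 J;
  kernel_ge0 : forall u v, 0 <= J u v;
  kernel_sym : forall u v, J u v = J v u;
  kernel_transl : forall u v, J u v = J 0 (v - u);
  kernel_range : forall u, 1 < `|u| -> J 0 u = 0;
  kernel_mass : forall u,
    (\int[lebesgue_measure]_(v in [set: R]) (J u v)%:E = 1)%E
}.

Definition Jneum (R : realType) (J : R -> R -> R) (u v : R) : R :=
  J u v + J u (2 - v) + J u (- 2 - v).

Definition Jconv (R : realType) (J : R -> R -> R) (m : R -> R) (u : R) : R :=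
  (\int[lebesgue_measure]_(v in Lambda R) (Jneum J u v * m v))%R.

(* The index i : site N stands for the lattice point x = i - N of
   {-N, ..., N}: [ord0] is -N and [ord_max] is N. *)
Definition site (N : nat) := 'I_(N.*2.+1).
Definition config (N : nat) := {ffun site N -> bool}.

Definition macro (R : realType) (N : nat) (i : site N) : R :=
  (i%:R - N%:R) / N%:R.
Arguments macro R {N} i.

Definition exchange (N : nat) (x y : site N) (eta : config N) : config N :=
  [ffun z => eta (tperm x y z)].

Definition flip (N : nat) (x : site N) (eta : config N) : config N :=
  [ffun z => if z == x then ~~ eta z else eta z].

Definition hamiltonian (R : realType) (J : R -> R -> R) (N : nat)
    (eta : config N) : R :=
  - 2^-1 * \sum_(x : site N) \sum_(y : site N)
     N%:R^-1 * Jneum J (macro R x) (macro R y) * (eta x)%:R * (eta y)%:R.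

Definition exchange_rate (R : realType) (J : R -> R -> R) (beta : R) (N : nat)
    (x y : site N) (eta : config N) : R :=
  expR (- (beta / 2) *
        (hamiltonian J (exchange x y eta) - hamiltonian J eta)).

Definition boundary_rate (R : realType) (r : R) (zeta : bool) : R :=
  r * (1 - zeta%:R) + (1 - r) * zeta%:R.

Definition bond_l (N : nat) (i : 'I_(N.*2)) : site N := widen_ord (leqnSn _) i.
Definition bond_r (N : nat) (i : 'I_(N.*2)) : site N := lift ord0 i.

Definition generator (R : realType) (J : R -> R -> R) (beta rhom rhop : R)
    (N : nat) (f : config N -> R) (eta : config N) : R :=
  \sum_(i < N.*2) exchange_rate J beta (bond_l i) (bond_r i) eta *
      (f (exchange (bond_l i) (bond_r i) eta) - f eta)
  + boundary_rate rhom (eta ord0) * (f (flip ord0 eta) - f eta)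
  + boundary_rate rhop (eta ord_max) * (f (flip ord_max eta) - f eta).

(* The transition semigroup exp (t L) of the Markov process with generator L
   on a finite state space. *)
Definition semigroup (R : realType) (S : finType)
    (L : (S -> R) -> S -> R) (t : R) (f : S -> R) (s : S) : R :=
  limn (series (fun k : nat => t ^+ k / k`!%:R * iter k L f s)).

Definition is_prob (R : realType) (S : finType) (mu : S -> R) : Prop :=
  (forall s, 0 <= mu s) /\ \sum_s mu s = 1.

Definition invariant_prob (R : realType) (S : finType)
    (L : (S -> R) -> S -> R) (mu : S -> R) : Prop :=
  is_prob mu /\
  forall (t : R) (f : S -> R), 0 <= t ->
    \sum_s mu s * semigroup L t f s = \sum_s mu s * f s.

Definition prob_of (R : realType) (S : finType) (mu : S -> R) (A : pred S) : R :=
  \sum_(s | A s) mu s.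

(* The sum runs over the interior points -N+1, ..., N-1 only. *)
Definition empirical (R : realType) (N : nat) (eta : config N) (u : R) : R :=
  \sum_(x : site N | (0 < x < N.*2)%N)
     (eta x)%:R * \1_`[macro R x - (2 * N%:R)^-1,
                       macro R x + (2 * N%:R)^-1[%classic u.

Definition mobility (R : realType) (r : R) : R := 2 * r * (1 - r).

(* G belongs to C^2_0([-1,1]), with first and second derivatives dG and d2G
   extended by continuity to the closed interval.  Values outside [-1,1] are
   irrelevant. *)
Record C2_0_with (R : realType) (G dG d2G : R -> R) : Prop := C2_0With {
  C2_cont : {within `[-1, 1], continuous G};
  C2_contd : {within `[-1, 1], continuous dG};
  C2_contd2 : {within `[-1, 1], continuous d2G};
  C2_deriv : forall u : R, -1 < u < 1 -> is_derive u 1 G (dG u);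
  C2_deriv2 : forall u : R, -1 < u < 1 -> is_derive u 1 dG (d2G u);
  C2_left : G (-1) = 0;
  C2_right : G 1 = 0
}.

Definition C2_0 (R : realType) (G : R -> R) : Prop :=
  exists dG d2G : R -> R, C2_0_with G dG d2G.

Definition L2 (R : realType) (f : R -> R) : Prop :=
  measurable_fun (Lambda R) f /\
  lebesgue_measure.-integrable (Lambda R) (fun u => (f u ^+ 2)%:E).

(* C^oo functions with compact support in (-1, 1). *)
Definition test_function (R : realType) (phi : R -> R) : Prop :=
  (forall (n : nat) (u : R), derivable (derive1n n phi) u 1) /\
  (exists2 r : R, r < 1 & forall u, r < `|u| -> phi u = 0).

Definition weak_derivative (R : realType) (f g : R -> R) : Prop :=
  forall phi, test_function phi -> inner f (derive1 phi) = - inner g phi.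

Definition H1 (R : realType) (f : R -> R) : Prop :=
  L2 f /\ exists2 g : R -> R, L2 g & weak_derivative f g.

Record weak_solution (R : realType) (J : R -> R -> R) (beta rhom rhop : R)
    (rho : R -> R) : Prop := WeakSolution {
  weak_H1 : H1 rho;
  weak_range : {ae lebesgue_measure, forall u, Lambda R u -> 0 <= rho u <= 1};
  weak_eq : forall G dG d2G : R -> R, C2_0_with G dG d2G ->
    - inner rho d2G + rhop * dG 1 - rhom * dG (-1)
    - beta / 2 * inner (fun u => mobility (rho u))
                       (fun u => dG u * derive1 (Jconv J rho) u) = 0
}.

(* Main.v *)
(* Let om be the difference between the occupation numbers and the stationary
   profile at the lattice points, and let F be the discrete H^{-1} norm of om,
   i.e. half the sum of squares of the centred partial sums of om.  Applying
   the generator to F and using stationarity bounds the expectation of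
   sum_i om_i om_{i+1} by beta times terms that are quadratic in om, up to
   errors that are small with respect to N.  The entropy production of the
   stationary measure relative to a product measure whose chemical potential
   interpolates linearly between the reservoirs shows that its Dirichlet form
   is O(1/N).  In one dimension this allows one to move an occupation variable
   by l sites at cost O(l/N), hence to replace products om_i om_{i+1} by squares
   of averages of om over blocks of length l.  For small beta the resulting
   inequality closes, and the mean square of the block averages is
   O(l/N + 1/l).

   The profile is the fixed point of the integral form of the boundary value
   problem, which is a contraction for small beta.  The mobility is cut off
   outside [0,1]; where a fixed point leaves [0,1] it is therefore affine, which
   is impossible.  Every weak solution is almost everywhere a fixed point,
   which gives uniqueness. *)

Require Import Defs.
From mathcomp Require Import all_boot all_order all_algebra.
From mathcomp Require Import all_classical all_reals all_analysis.
From mathcomp Require Import measurable_realfun perm ring lra zify.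
Import Order.TTheory GRing.Theory Num.Theory.
Import numFieldNormedType.Exports.
Local Open Scope classical_set_scope.
Local Open Scope ring_scope.

(** The invariant measure has no closed form, and the exchange rates produce a term quadratic in the
    occupation numbers, so the mean density obeys no closed equation. The discrete H^{-1} norm is
    chosen because diffusion dissipates exactly the sum of om_i^2, while the second-order part of
    the generator returns half the sum of squared jumps; the two cancel except for the correlations
    om_i om_{i+1}. These have no sign and become a positive quadratic form only after block
    averaging. In the interaction terms a fluctuation is multiplied by the rescaled centred height,
    which is itself of the size of the block averages; this makes them quadratic again, apart from
    weighted neighbour correlations whose weight is merely bounded. With [B] the common bound for
    the kernel, the first kind costs 21 beta B and the second 18 beta B times the block energy. The
    condition beta * 90 B <= 1 keeps the sum 39 beta B below 1/2; the contraction factor 10 beta B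
    of the fixed point is then below 1/2 as well. The block length l is fixed before N tends to
    infinity, so no compactness argument enters. *)

Set Implicit Arguments.
Unset Strict Implicit.
Unset Printing Implicit Defensive.

(** * Invariant measures of finite Markov processes *)

Section Semigroup.
Context {R : realType} {S : finType}.
Variable L : (S -> R) -> S -> R.
Variables (M : R).
Hypothesis M0 : 0 <= M.
Hypothesis LM : forall (f : S -> R) (c : R),
  (forall s, `|f s| <= c) -> forall s, `|L f s| <= M * c.

Lemma iter_bound (f : S -> R) (c : R) : (forall s, `|f s| <= c) ->
  forall k s, `|iter k L f s| <= M ^+ k * c.
Proof.
move=> fc; elim=> [|k IH] s; first by rewrite expr0 mul1r.
by rewrite iterS exprS -mulrA; exact: LM.
Qed.

(** The terms of the exponential series from k = 2 on share the factor t^2 because t <= 1, and what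
    remains is dominated by the series of exp M. *)
Lemma semigroup_expansion (f : S -> R) (c t : R) : (forall s, `|f s| <= c) ->
  0 <= t <= 1 -> forall s,
  `|semigroup L t f s - (f s + t * L f s)| <= t ^+ 2 * (expR M * c).
Proof.
move=> fc /andP[t0 t1] s; rewrite /semigroup.
set u := (fun k : nat => _).
have c0 : 0 <= c by exact: le_trans (fc s).
have uM k : `|u k| <= t ^+ k * (exp_coeff M k * c).
  rewrite /u normrM ger0_norm ?divr_ge0 ?exprn_ge0// /exp_coeff/=.
  rewrite -(mulrA (t ^+ k)) ler_wpM2l ?exprn_ge0// mulrAC mulrC ler_wpM2r ?invr_ge0//.
  exact: iter_bound.
have e0 k : 0 <= exp_coeff M k by rewrite /exp_coeff/= divr_ge0// exprn_ge0.
have cvu : cvgn (series u).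
  apply: normed_cvg; apply: (@series_le_cvg _ _ (fun k => c * exp_coeff M k)).
  - by move=> k /=; exact: normr_ge0.
  - by move=> k; apply: mulr_ge0; [exact: c0|exact: e0].
  - move=> k; apply: (le_trans (uM k)); rewrite [leRHS]mulrC.
    apply: ler_piMl; first by apply: mulr_ge0; [exact: e0|exact: c0].
    by rewrite exprn_ile1.
  - by apply: is_cvg_seriesZ; exact: is_cvg_series_exp_coeff.
have Hn : \forall n \near \oo, `|series u n - (f s + t * L f s)| <= t ^+ 2 * (expR M * c).
  near=> n.
  have n2 : (2 <= n)%N by near: n; exact: nbhs_infty_ge.
  rewrite /series/= (big_cat_nat _ (n := 2)) //= big_nat_recl// big_nat1 {1 2}/u/=.
  rewrite expr0 expr1 fact0 (_ : 1`! = 1%N)// !divr1 mul1r.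
  rewrite [X in `|X - _|]addrC addrK.
  apply: (le_trans (ler_norm_sum _ _ _)).
  apply: (@le_trans _ _ (\sum_(2 <= k < n) t ^+ 2 * (exp_coeff M k * c))).
    rewrite !big_nat; apply: ler_sum => k /andP[k2 _].
    apply: (le_trans (uM k)); apply: ler_wpM2r; first by apply: mulr_ge0.
    by rewrite -(subnK k2) exprD; apply: ler_piMl; rewrite ?exprn_ge0 ?exprn_ile1.
  rewrite -mulr_sumr -mulr_suml ler_wpM2l ?exprn_ge0// ler_wpM2r//.
  apply: (@le_trans _ _ (series (exp_coeff M) n)).
    by rewrite /series/= [leRHS](big_cat_nat _ (n := 2)) //= lerDr sumr_ge0.
  apply: nondecreasing_cvgn_le; last exact: is_cvg_series_exp_coeff.
  by apply/nondecreasing_seqP => k; rewrite /series/= big_nat_recr//= lerDl.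
have cv : (fun n => `|series u n - (f s + t * L f s)|) @ \oo -->
    `|limn (series u) - (f s + t * L f s)|.
  by apply: cvg_norm; apply: cvgB => //; exact: cvg_cst.
rewrite -(cvg_lim _ cv)//; apply: limr_le => //.
by apply/cvg_ex; eexists; exact: cv.
Unshelve. all: by end_near.
Qed.

(** Differentiation of the invariance identity at t = 0: the mean of the semigroup increment
    vanishes, so t times the mean of [L f] is O(t^2). Dividing by t and choosing t small gives the
    claim. *)
Lemma invariant_prob_generator (mu : S -> R) (f : S -> R) :
  invariant_prob L mu -> \sum_s mu s * L f s = 0.
Proof.
move=> [[mu0 mu1] inv].
pose c := \sum_s `|f s|.
have fc s : `|f s| <= c by rewrite /c (bigD1 s)//= lerDl sumr_ge0.
pose K := expR M * c.
have K0 : 0 <= K by rewrite mulr_ge0 ?expR_ge0// sumr_ge0.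
have H t : 0 < t -> t <= 1 -> `|\sum_s mu s * L f s| <= t * K.
  move=> t0 t1; rewrite -(ler_pM2l t0) mulrA -expr2 -{1}(gtr0_norm t0) -normrM.
  have -> : t * \sum_s mu s * L f s =
      - \sum_s mu s * (semigroup L t f s - (f s + t * L f s)).
    have -> : \sum_s mu s * (semigroup L t f s - (f s + t * L f s)) =
        \sum_s mu s * semigroup L t f s - \sum_s mu s * f s - t * \sum_s mu s * L f s.
      rewrite mulr_sumr -!sumrB; apply: eq_bigr => s _; ring.
    by rewrite inv ?(ltW t0)// subrr sub0r opprK.
  rewrite normrN; apply: (le_trans (ler_norm_sum _ _ _)).
  rewrite -[leRHS]mul1r -mu1 mulr_suml; apply: ler_sum => s _.
  rewrite normrM ger0_norm// ler_wpM2l//; apply: semigroup_expansion => //.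
  by rewrite (ltW t0).
apply/eqP; rewrite -normr_le0; apply/ler_addgt0Pr => e e0; rewrite add0r.
have K1 : 0 < K + 1 by lra.
pose t := Num.min 1 (e / (K + 1)).
have t0 : 0 < t by rewrite lt_min ltr01 divr_gt0.
apply: (le_trans (H t t0 _)); first by rewrite ge_min lexx.
apply: (@le_trans _ _ (e / (K + 1) * K)).
  by rewrite ler_wpM2r// ge_min lexx orbT.
by rewrite mulrAC ler_pdivrMr// ler_wpM2l ?(ltW e0)//; lra.
Qed.

End Semigroup.

(** * Block averages and the quadratic energy *)

Lemma sum_delta (R : nzSemiRingType) (m j : nat) (g : nat -> R) :
  \sum_(k < m) g k * (k == j :> nat)%:R = if (j < m)%N then g j else 0.
Proof.
case: ltnP => jm.
  rewrite (bigD1 (Ordinal jm))//= eqxx mulr1 big1 ?addr0// => k kj.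
  by rewrite (_ : (k == j :> nat) = false) ?mulr0//; apply: contra_neqF kj => /eqP e; exact: val_inj.
rewrite big1// => k _; rewrite (_ : (k == j :> nat) = false) ?mulr0//.
by apply: ltn_eqF; exact: leq_trans (ltn_ord k) jm.
Qed.

Lemma leq_sites (N : nat) : (0 < N)%N -> (N.*2.+1 <= 3 * N)%N.
Proof. lia. Qed.

Lemma ratio_le3 (R : realFieldType) (N : nat) : (0 < N)%N ->
  (N.*2.+1)%:R / N%:R <= 3 :> R.
Proof. by move=> N0; rewrite ler_pdivrMr ?ltr0n// -natrM ler_nat leq_sites. Qed.

Section BlockAverages.
Context {R : realType}.
Variable N : nat.
Hypothesis N0 : (0 < N)%N.

Let NR0 : 0 < N%:R :> R. Proof. by rewrite ltr0n. Qed.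

(** Summation by parts. A shift by one site costs one boundary term c at the left end and 2N
    increments of g, each at most c/N, hence 3c in total. On the right nothing is lost because h
    vanishes beyond the lattice. *)
Lemma sum_shift_le (g h : nat -> R) (c : R) :
  (forall k, (k <= N.*2)%N -> `|g k| <= c) ->
  (forall k, (k < N.*2)%N -> `|g k.+1 - g k| <= c / N%:R) ->
  (forall k, `|h k| <= 1) -> (forall k, (N.*2 < k)%N -> h k = 0) ->
  forall j, `|\sum_(i < N.*2.+1) g i * h (i + j)%N - \sum_(i < N.*2.+1) g i * h i|
    <= 3 * c * j%:R.
Proof.
move=> gc gl h1 h0.
have c0 : 0 <= c by apply: le_trans (gc 0 isT).
have one (f : nat -> R) : (forall k, `|f k| <= 1) -> (forall k, (N.*2 < k)%N -> f k = 0) ->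
    `|\sum_(i < N.*2.+1) g i * f i.+1 - \sum_(i < N.*2.+1) g i * f i| <= 3 * c.
  move=> f1 f0; rewrite big_ord_recr/= f0// mulr0 addr0 big_ord_recl/=.
  rewrite opprD addrCA -sumrB; apply: (le_trans (ler_normD _ _)).
  have -> : 3 * c = c + 2 * c by ring.
  apply: lerD.
    by rewrite normrN normrM -[c]mulr1 ler_pM// gc.
  apply: (le_trans (ler_norm_sum _ _ _)).
  apply: (@le_trans _ _ (\sum_(i < N.*2) c / N%:R)).
    apply: ler_sum => i _; rewrite /bump/= !add1n -mulrBl normrM -[leRHS]mulr1 ler_pM//.
    by rewrite distrC gl.
  rewrite sumr_const card_ord -[leLHS]mulr_natl -mul2n natrM.
  by rewrite le_eqVlt; apply/orP; left; apply/eqP; field; rewrite ?gt_eqF//.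
elim=> [|j IH].
  under eq_bigr do rewrite addn0.
  by rewrite subrr normr0 mulr0.
have := one (fun k => h (k + j)%N); rewrite /=.
set s2 := \sum_(i < _) g i * h (i + j)%N => H.
have {}H : `|\sum_(i < N.*2.+1) g i * h (i + j.+1)%N - s2| <= 3 * c.
  rewrite (eq_bigr (fun i : 'I_(N.*2.+1) => g i * h (i.+1 + j)%N)); last first.
    by move=> i _; rewrite addnS addSn.
  apply: H => [k|k kN]; first exact: h1.
  by apply: h0; lia.
have -> : 3 * c * j.+1%:R = 3 * c + 3 * c * j%:R by rewrite -[j.+1]addn1 natrD; ring.
rewrite -(subrK s2 (\sum_(i < _) _)) -addrA.
by apply: (le_trans (ler_normD _ _)); apply: lerD.
Qed.

Variable l : nat.
Hypothesis l0 : (0 < l)%N.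

Definition block_avg (h : nat -> R) (i : nat) : R := l%:R^-1 * \sum_(j < l) h (i + j)%N.

Let lR0 : 0 < l%:R :> R. Proof. by rewrite ltr0n. Qed.

(** The average of [sum_shift_le] over the shifts j < l: against a slowly varying weight a sequence
    may be replaced by its block averages. *)
Lemma sum_block_avg_le (g h : nat -> R) (c : R) :
  (forall k, (k <= N.*2)%N -> `|g k| <= c) ->
  (forall k, (k < N.*2)%N -> `|g k.+1 - g k| <= c / N%:R) ->
  (forall k, `|h k| <= 1) -> (forall k, (N.*2 < k)%N -> h k = 0) ->
  `|\sum_(i < N.*2.+1) g i * h i - \sum_(i < N.*2.+1) g i * block_avg h i| <= 3 * c * l%:R.
Proof.
move=> gc gl h1 h0.
have c0 : 0 <= c by apply: le_trans (gc 0 isT).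
set s := \sum_(i < _) g i * h i.
have -> : s - \sum_(i < N.*2.+1) g i * block_avg h i =
   l%:R^-1 * \sum_(j < l) (s - \sum_(i < N.*2.+1) g i * h (i + j)%N).
  rewrite sumrB sumr_const card_ord -[s *+ l]mulr_natl mulrBr mulKf ?gt_eqF//.
  congr (_ - _); rewrite exchange_big/= mulr_sumr; apply: eq_bigr => i _.
  by rewrite /block_avg -mulr_sumr mulrCA.
rewrite normrM gtr0_norm ?invr_gt0// mulrC ler_pdivrMr//.
apply: (le_trans (ler_norm_sum _ _ _)).
apply: (@le_trans _ _ (\sum_(j < l) 3 * c * l%:R)); last first.
  by rewrite sumr_const card_ord -[leLHS]mulr_natr.
apply: ler_sum => j _; rewrite distrC.
apply: (le_trans (sum_shift_le gc gl h1 h0 j)).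
by apply: ler_wpM2l; [rewrite mulr_ge0|rewrite ler_nat ltnW].
Qed.

(** Shifting the summation window by j exchanges j terms at each end, at a cost of at most 2j. The
    bound later makes heights, which are partial sums, as small as the block averages. *)
Lemma partial_sum_le (h : nat -> R) (b : nat) : (forall k, `|h k| <= 1) ->
  (b <= N.*2.+1)%N ->
  `|\sum_(k < b) h k| <= \sum_(i < N.*2.+1) `|block_avg h i| + 2 * l%:R.
Proof.
move=> h1 bN.
have sh j : `|\sum_(k < b) h k - \sum_(k < b) h (k + j)%N| <= 2 * j%:R.
  elim: j => [|j IH].
    by under [X in _ - X]eq_bigr do rewrite addn0; rewrite subrr normr0 mulr0.
  have -> : \sum_(k < b) h (k + j.+1)%N = \sum_(k < b) h (k + j)%N + h (b + j)%N - h j.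
    have : \sum_(k < b.+1) h (k + j)%N = \sum_(k < b) h (k + j)%N + h (b + j)%N.
      by rewrite big_ord_recr.
    rewrite big_ord_recl/= add0n => <-; rewrite addrC addKr.
    by apply: eq_bigr => k _; rewrite /bump/= add1n addnS addSn.
  rewrite !opprD opprK !addrA -[j.+1]addn1 natrD mulrDr mulr1.
  have := h1 (b + j)%N; have := h1 j.
  move: IH; rewrite !ler_norml; lra.
have E : \sum_(k < b) block_avg h k = l%:R^-1 * \sum_(j < l) \sum_(k < b) h (k + j)%N.
  by rewrite exchange_big/= mulr_sumr.
have D : `|\sum_(k < b) h k - \sum_(k < b) block_avg h k| <= 2 * l%:R.
  have -> : \sum_(k < b) h k - \sum_(k < b) block_avg h k =
     l%:R^-1 * \sum_(j < l) (\sum_(k < b) h k - \sum_(k < b) h (k + j)%N).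
    set s := \sum_(k < b) h k; rewrite E sumrB sumr_const card_ord -[s *+ l]mulr_natl mulrBr mulKf ?gt_eqF//.
  rewrite normrM gtr0_norm ?invr_gt0// mulrC ler_pdivrMr//.
  apply: (le_trans (ler_norm_sum _ _ _)).
  apply: (@le_trans _ _ (\sum_(j < l) 2 * l%:R)); last first.
    by rewrite sumr_const card_ord -[leLHS]mulr_natr.
  apply: ler_sum => j _; apply: (le_trans (sh j)).
  by rewrite ler_wpM2l// ler_nat ltnW.
rewrite -[X in `|X|](subrK (\sum_(k < b) block_avg h k)) addrC.
apply: (le_trans (ler_normD _ _)); apply: lerD => //.
apply: (le_trans (ler_norm_sum _ _ _)).
rewrite (big_ord_widen N.*2.+1 (fun k : nat => `|block_avg h k|))//.
by rewrite big_mkcond/=; apply: ler_sum => i _; case: ifP.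
Qed.

Lemma sqr_sum_le (m : nat) (a : 'I_m -> R) :
  (\sum_(i < m) a i) ^+ 2 <= m%:R * \sum_(i < m) a i ^+ 2.
Proof.
case: m a => [|m] a; first by rewrite !big_ord0 expr0n mulr0.
set s := \sum_i a i; set M : R := m.+1%:R.
have M0 : 0 < M by rewrite ltr0n.
have : 0 <= \sum_i (M * a i - s) ^+ 2 by apply: sumr_ge0 => i _; exact: sqr_ge0.
have -> : \sum_i (M * a i - s) ^+ 2 = M * (M * \sum_i a i ^+ 2 - s ^+ 2).
  transitivity (\sum_i (M ^+ 2 * a i ^+ 2 - 2 * M * s * a i + s ^+ 2)).
    by apply: eq_bigr => i _; ring.
  rewrite big_split/= sumrB -!mulr_sumr -/s sumr_const card_ord -[s *+ _]mulr_natl -/M.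
  by ring.
by rewrite pmulr_rge0// subr_ge0.
Qed.

Lemma block_avg_le1 (h : nat -> R) i : (forall k, `|h k| <= 1) -> `|block_avg h i| <= 1.
Proof.
move=> h1; rewrite normrM gtr0_norm ?invr_gt0// mulrC ler_pdivrMr// mul1r.
apply: (le_trans (ler_norm_sum _ _ _)).
by rewrite -[l in leRHS]card_ord -sumr_const; apply: ler_sum.
Qed.

End BlockAverages.

Section Energy.
Context {R : realType}.
Variable M : nat.
Hypothesis M0 : (0 < M)%N.

Definition mean (p : nat -> R) : R := (\sum_(b < M) p b) / M%:R.

(** Centring makes the value invariant under adding a constant to p. Applied to the partial sums of
    a sequence, it is half its squared discrete H^{-1} norm. *)
Definition energy (p : nat -> R) : R := 2^-1 * \sum_(b < M) (mean p - p b) ^+ 2.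

Lemma meanK (p : nat -> R) : \sum_(b < M) (mean p - p b) = 0.
Proof.
rewrite sumrB sumr_const card_ord -[mean p *+ _]mulr_natl /mean mulrC divfK ?subrr//.
by rewrite pnatr_eq0 -lt0n.
Qed.

Lemma mean_update (p q : nat -> R) (d c : R) (b0 : nat) : (b0 < M)%N ->
  (forall b, (b < M)%N -> q b = p b + d * (b == b0)%:R + c) ->
  mean q = mean p + d / M%:R + c.
Proof.
move=> b0M qp.
have MR : M%:R != 0 :> R by rewrite pnatr_eq0 -lt0n.
rewrite /mean (eq_bigr (fun b : 'I_M => p b + d * (b == b0 :> nat)%:R + c)); last first.
  by move=> b _; exact: qp.
rewrite !big_split/= sumr_const card_ord -mulr_sumr.
have -> : \sum_(b < M) (b == b0 :> nat)%:R = 1 :> R.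
  have := sum_delta M b0 (fun=> 1 : R); rewrite b0M; apply: etrans.
  by apply: eq_bigr => k _; rewrite mul1r.
by rewrite -mulr_natl; field.
Qed.

(** Every move of the dynamics changes the heights in this way: by d at a single cut and by a common
    constant c, which the centring cancels. *)
Lemma energy_update (p q : nat -> R) (d c : R) (b0 : nat) : (b0 < M)%N ->
  (forall b, (b < M)%N -> q b = p b + d * (b == b0)%:R + c) ->
  energy q - energy p = - d * (mean p - p b0) + d ^+ 2 / 2 * (1 - M%:R^-1).
Proof.
move=> b0M qp.
have MR : M%:R != 0 :> R by rewrite pnatr_eq0 -lt0n.
rewrite /energy (mean_update b0M qp).
set m := mean p.
rewrite (eq_bigr (fun b : 'I_M => (m - p b) ^+ 2 + 2 * (d / M%:R) * (m - p b) + (d / M%:R) ^+ 2 +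
   (- (2 * d * (m - p b)) - 2 * d ^+ 2 / M%:R + d ^+ 2) * (b == b0 :> nat)%:R)); last first.
  move=> b _; rewrite qp//; case: (_ == _); rewrite ?mulr1n ?mulr0n; ring.
rewrite !big_split/= -!mulr_sumr meanK sumr_const card_ord.
rewrite (sum_delta M b0 (fun b => - (2 * d * (m - p b)) - 2 * d ^+ 2 / M%:R + d ^+ 2)) b0M.
by rewrite -[_^-1 *+ M]mulr_natl; field.
Qed.

Lemma abel_sum (w V : nat -> R) (n : nat) :
  \sum_(i < n) (w i - w i.+1) * V i.+1 =
  w 0 * V 0 - w n * V n.+1 + \sum_(k < n.+1) w k * (V k.+1 - V k).
Proof.
elim: n => [|n IH]; first by rewrite big_ord0 big_ord1; ring.
by rewrite big_ord_recr/= IH [in RHS]big_ord_recr/=; ring.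
Qed.

End Energy.

(** * Stationary measures of the particle system *)

Definition swap (N : nat) (i : 'I_(N.*2)) (eta : config N) : config N :=
  exchange (bond_l i) (bond_r i) eta.

(** Real-valued and indexed by all of [nat], with value 0 past the last site, so that shifted
    indices need no ordinals. *)
Definition occ (R : realType) (N : nat) (eta : config N) (k : nat) : R :=
  if (k <= N.*2)%N then (eta (inord k))%:R else 0.

Section Moves.
Context {R : realType} {N : nat}.
Implicit Types (eta : config N) (i : 'I_(N.*2)).

Lemma swapK i : involutive (swap i).
Proof. by move=> eta; apply/ffunP => z; rewrite !ffunE tpermK. Qed.

Lemma flipK (x : site N) : involutive (flip x).
Proof.
by move=> eta; apply/ffunP => z; rewrite !ffunE; case: eqP => // ->; rewrite negbK.
Qed.

Lemma occ01 eta k : occ R eta k = 0 \/ occ R eta k = 1.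
Proof.
rewrite /occ; case: leqP => _; last by left.
by case: (eta _); [right|left].
Qed.

Lemma occ_ge0 eta k : 0 <= occ R eta k.
Proof. by case: (occ01 eta k) => ->. Qed.

Lemma occ_le1 eta k : occ R eta k <= 1.
Proof. by case: (occ01 eta k) => ->. Qed.

Lemma occE (eta : config N) (x : site N) : (eta x)%:R = occ R eta x.
Proof. by rewrite /occ -ltnS ltn_ord inord_val. Qed.

(** The additive form lets every linear functional of the occupation numbers change by an explicit
    two-site correction, as in [sum_occ_swap]. *)
Lemma occ_swap i eta k : occ R (swap i eta) k =
  occ R eta k + (occ R eta i.+1 - occ R eta i) * ((k == i)%:R - (k == i.+1)%:R).
Proof.
have iN := ltn_ord i.
have li : bond_l i = inord i by apply: val_inj; rewrite /= inordK// ltnS ltnW.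
have ri : bond_r i = inord i.+1 by apply: val_inj; rewrite /= inordK.
rewrite /occ /swap /exchange (ltnW iN) iN.
case: (leqP k N.*2) => kN; last first.
  have -> : (k == i) = false by apply/eqP => ki; rewrite ki ltnNge ltnW in kN.
  have -> : (k == i.+1) = false by apply/eqP => ki; rewrite ki ltnNge iN in kN.
  by rewrite subrr mulr0 addr0.
rewrite ffunE; case: tpermP => [kl|kr|/eqP kl /eqP kr].
- have -> : k = i by rewrite -[k](@inordK N.*2) ?ltnS// kl.
  rewrite eqxx (ltn_eqF (ltnSn i)) subr0 mulr1 ?ri ?li; lra.
- have -> : k = i.+1 by rewrite -[k](@inordK N.*2) ?ltnS// kr.
  rewrite eqxx (gtn_eqF (ltnSn i)) sub0r mulr1n ?li ?ri; lra.
- have -> : (k == i) = false by apply: contra_neqF kl => /eqP ->.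
  have -> : (k == i.+1) = false by apply: contra_neqF kr => /eqP ->.
  by rewrite subrr mulr0 addr0.
Qed.

Lemma occ_flip (x : site N) eta k : occ R (flip x eta) k =
  occ R eta k + (1 - 2 * occ R eta x) * (k == x)%:R.
Proof.
rewrite /occ -(ltnS x) ltn_ord inord_val.
case: (leqP k N.*2) => kN; last first.
  have -> : (k == x) = false by apply/eqP => kx; rewrite kx ltnNge -ltnS ltn_ord in kN.
  by rewrite mulr0 addr0.
rewrite ffunE -val_eqE/= inordK ?ltnS//; case: eqP => [kx|_]; last by rewrite mulr0 addr0.
have -> : inord k = x by apply: val_inj; rewrite /= inordK.
by case: (eta x); rewrite /= ?mulr1n ?mulr0n; lra.
Qed.

Lemma sum_occ_swap (m : nat) (g : nat -> R) i eta :
  \sum_(k < m) g k * occ R (swap i eta) k = \sum_(k < m) g k * occ R eta k +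
  (occ R eta i.+1 - occ R eta i) *
    ((if (i < m)%N then g i else 0) - (if (i.+1 < m)%N then g i.+1 else 0)).
Proof.
rewrite -!sum_delta mulrBr !mulr_sumr -sumrB -big_split/=.
by apply: eq_bigr => k _; rewrite occ_swap; ring.
Qed.

Lemma sum_occ_flip (m : nat) (g : nat -> R) (x : site N) eta :
  \sum_(k < m) g k * occ R (flip x eta) k = \sum_(k < m) g k * occ R eta k +
  (1 - 2 * occ R eta x) * (if (x < m)%N then g x else 0).
Proof.
rewrite -!sum_delta !mulr_sumr -big_split/=.
by apply: eq_bigr => k _; rewrite occ_flip; ring.
Qed.

Lemma sum_swap i (F : config N -> R) : \sum_eta F (swap i eta) = \sum_eta F eta.
Proof. by rewrite [RHS](reindex_inj (can_inj (swapK i))). Qed.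

Lemma sum_flip x (F : config N -> R) : \sum_eta F (flip x eta) = \sum_eta F eta.
Proof. by rewrite [RHS](reindex_inj (can_inj (flipK x))). Qed.

End Moves.

Section Stationary.
Context {R : realType}.
Variables (J : R -> R -> R) (beta rhom rhop : R) (N : nat).
Hypothesis rhom01 : 0 < rhom < 1.
Hypothesis rhop01 : 0 < rhop < 1.
Variable mu : config N -> R.
Hypothesis muinv : invariant_prob (@generator R J beta rhom rhop N) mu.

Implicit Types (eta s : config N) (i : 'I_(N.*2)).
Notation rate i eta := (exchange_rate J beta (bond_l i) (bond_r i) eta).

Lemma boundary_rate_gt0 (r : R) b : 0 < r < 1 -> 0 < boundary_rate r b.
Proof. by move=> /andP[r0 r1]; rewrite /boundary_rate; case: b; rewrite /= ?mulr1n ?mulr0n; lra. Qed.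

Lemma boundary_rate_le1 (r : R) b : 0 < r < 1 -> boundary_rate r b <= 1.
Proof. by move=> /andP[r0 r1]; rewrite /boundary_rate; case: b; rewrite /= ?mulr1n ?mulr0n; lra. Qed.

Lemma rate_gt0 i eta : 0 < rate i eta.
Proof. exact: expR_gt0. Qed.

Lemma generatorE (f : config N -> R) eta :
  generator J beta rhom rhop f eta =
  \sum_(i < N.*2) rate i eta * (f (swap i eta) - f eta)
  + boundary_rate rhom (eta ord0) * (f (flip ord0 eta) - f eta)
  + boundary_rate rhop (eta ord_max) * (f (flip ord_max eta) - f eta).
Proof. by []. Qed.

Lemma stationarity (f : config N -> R) :
  \sum_eta mu eta * generator J beta rhom rhop f eta = 0.
Proof.
(* Twice the total jump rate out of [eta]; its sum over all configurations bounds the generator as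
   an operator in the supremum norm. *)
pose M0 eta : R := \sum_(i < N.*2) rate i eta * 2 + boundary_rate rhom (eta ord0) * 2
   + boundary_rate rhop (eta ord_max) * 2.
have M00 eta : 0 <= M0 eta.
  rewrite !addr_ge0//; last 2 first.
  - by rewrite mulr_ge0// ltW// boundary_rate_gt0.
  - by rewrite mulr_ge0// ltW// boundary_rate_gt0.
  by apply: sumr_ge0 => i _; rewrite mulr_ge0// ltW// rate_gt0.
apply: (@invariant_prob_generator _ _ _ (\sum_eta M0 eta)) muinv.
  by apply: sumr_ge0.
move=> g c gc eta; apply: (@le_trans _ _ (M0 eta * c)); last first.
  apply: ler_wpM2r; first exact: le_trans (gc eta).
  by rewrite (bigD1 eta)//= lerDl sumr_ge0.
have gc2 a b : `|g a - g b| <= 2 * c.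
  by apply: (le_trans (ler_normB _ _)); move: (gc a) (gc b); lra.
have -> : M0 eta * c = \sum_(i < N.*2) rate i eta * (2 * c)
   + boundary_rate rhom (eta ord0) * (2 * c) + boundary_rate rhop (eta ord_max) * (2 * c).
  by rewrite /M0 -!mulr_suml; ring.
rewrite generatorE.
apply: (le_trans (ler_normD _ _)); apply: lerD; last first.
  rewrite normrM gtr0_norm ?boundary_rate_gt0//.
  by apply: ler_wpM2l; rewrite ?gc2// ltW// boundary_rate_gt0.
apply: (le_trans (ler_normD _ _)); apply: lerD; last first.
  rewrite normrM gtr0_norm ?boundary_rate_gt0//.
  by apply: ler_wpM2l; rewrite ?gc2// ltW// boundary_rate_gt0.
apply: (le_trans (ler_norm_sum _ _ _)).
apply: ler_sum => i _.
rewrite normrM gtr0_norm ?rate_gt0//.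
by apply: ler_wpM2l; rewrite ?gc2// ltW// rate_gt0.
Qed.

Let mu_ge0 eta : 0 <= mu eta. Proof. by case: muinv => -[]. Qed.
Let mu_sum : \sum_eta mu eta = 1. Proof. by case: muinv => -[]. Qed.

(** The generator applied to the indicator of s is nonnegative off s, and s carries no mass, so
    stationarity makes every summand vanish. Hence configurations that can jump to s have no mass;
    the moves being involutions, these are the images of s. *)
Lemma mu_zero_moves s : mu s = 0 ->
  [/\ forall i, mu (swap i s) = 0, mu (flip ord0 s) = 0 & mu (flip ord_max s) = 0].
Proof.
move=> mus0.
pose g (eta : config N) : R := (eta == s)%:R.
have g0 a : 0 <= g a by rewrite /g ler0n.
have gs eta : eta != s -> g eta = 0 by rewrite /g => /negbTE ->.
have Lg eta : 0 <= mu eta * generator J beta rhom rhop g eta.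
  have [->|es] := eqVneq eta s; first by rewrite mus0 mul0r.
  apply: mulr_ge0 => //; rewrite generatorE gs// !addr_ge0//; last 2 first.
  - by rewrite mulr_ge0// ?subr0// ltW// boundary_rate_gt0.
  - by rewrite mulr_ge0// ?subr0// ltW// boundary_rate_gt0.
  by apply: sumr_ge0 => i _; rewrite mulr_ge0 ?subr0// ltW// rate_gt0.
have H eta : mu eta * generator J beta rhom rhop g eta = 0.
  have := stationarity g; rewrite (bigD1 eta)//= => /eqP.
  by rewrite paddr_eq0 ?sumr_ge0// => /andP[/eqP].
have gss : g s = 1 by rewrite /g eqxx.
split=> [i||].
- have [->//|es] := eqVneq (swap i s) s.
  have /eqP := H (swap i s); rewrite mulf_eq0 => /orP[/eqP//|/eqP e].
  suff : 0 < generator J beta rhom rhop g (swap i s) by rewrite e ltxx.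
  rewrite generatorE gs// -addrA ltr_wpDr//.
    by rewrite !subr0 addr_ge0// mulr_ge0// ltW// boundary_rate_gt0.
  rewrite (bigD1 i)//= swapK gss !subr0 mulr1 ltr_wpDr ?rate_gt0//.
  by apply: sumr_ge0 => j _; rewrite mulr_ge0 ?subr0// ltW// rate_gt0.
- have [->//|es] := eqVneq (flip ord0 s) s.
  have /eqP := H (flip ord0 s); rewrite mulf_eq0 => /orP[/eqP//|/eqP e].
  suff : 0 < generator J beta rhom rhop g (flip ord0 s) by rewrite e ltxx.
  rewrite generatorE gs// ltr_wpDr//.
    by rewrite !subr0 mulr_ge0// ltW// boundary_rate_gt0.
  rewrite flipK gss !subr0 mulr1 ltr_wpDl ?boundary_rate_gt0//.
  by apply: sumr_ge0 => j _; rewrite mulr_ge0 ?subr0// ltW// rate_gt0.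
- have [->//|es] := eqVneq (flip ord_max s) s.
  have /eqP := H (flip ord_max s); rewrite mulf_eq0 => /orP[/eqP//|/eqP e].
  suff : 0 < generator J beta rhom rhop g (flip ord_max s) by rewrite e ltxx.
  rewrite generatorE gs// flipK gss !subr0 mulr1 ltr_wpDl ?boundary_rate_gt0// addr_ge0//.
    by apply: sumr_ge0 => j _; rewrite mulr_ge0 ?subr0// ltW// rate_gt0.
  by rewrite mulr_ge0// ltW// boundary_rate_gt0.
Qed.

(** The flip at k+1 is the flip at k conjugated by the exchange of k and k+1, so the reservoir at
    the left end generates the flips at all sites. *)
Lemma mu_zero_flip (k : nat) : (k <= N.*2)%N ->
  forall s, mu s = 0 -> mu (flip (inord k) s) = 0.
Proof.
elim: k => [|k IH] kN s s0.
  have -> : inord 0 = ord0 :> site N by apply: val_inj; rewrite /= inordK.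
  by case: (mu_zero_moves s0).
pose i := Ordinal kN.
have -> : flip (inord k.+1) s = swap i (flip (inord k) (swap i s)).
  apply/ffunP => z; rewrite !ffunE.
  have -> : inord k = bond_l i by apply: val_inj; rewrite /= inordK// ltnS ltnW.
  have -> : inord k.+1 = bond_r i by apply: val_inj; rewrite /= inordK.
  rewrite tpermK; congr (if _ then _ else _).
  by rewrite -{2}(tpermR (bond_l i) (bond_r i)) (inj_eq perm_inj).
have [H _ _] := mu_zero_moves s0.
have [H' _ _] := mu_zero_moves (IH (ltnW kN) _ (H i)).
exact: H'.
Qed.

(** A zero of [mu] would propagate through flips to every configuration, contradicting total mass 1.
    Positivity is what makes ln mu an admissible test function for the entropy production. *)
Lemma stationary_gt0 eta : 0 < mu eta.
Proof.
rewrite lt_neqAle mu_ge0 andbT eq_sym; apply/eqP => s0.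
suff H zeta : mu zeta = 0.
  by move: mu_sum; rewrite big1// => /eqP; rewrite eq_sym oner_eq0.
(* An interpolation from [eta] to [zeta] in which each step changes at most one site. *)
pose e (k : nat) : config N := [ffun z : site N => if (z < k)%N then zeta z else eta z].
have -> : zeta = e N.*2.+1 by apply/ffunP => z; rewrite ffunE ltn_ord.
have : (N.*2.+1 <= N.*2.+1)%N by [].
elim: {-2}(N.*2.+1) => [_|k IH kN].
  by rewrite (_ : e 0 = eta)//; apply/ffunP => z; rewrite ffunE ltn0.
have ek := IH (ltnW kN).
have [E|E] := eqVneq (zeta (inord k)) (eta (inord k)).
  rewrite (_ : e k.+1 = e k)//; apply/ffunP => z; rewrite !ffunE ltnS leq_eqVlt.
  case: eqP => //= zk; have -> : z = inord k by apply: val_inj; rewrite /= inordK.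
  by rewrite inordK// ltnn.
rewrite (_ : e k.+1 = flip (inord k) (e k)); first exact: mu_zero_flip.
apply/ffunP => z; rewrite !ffunE ltnS leq_eqVlt -val_eqE /= inordK//.
case: eqP => //= zk; have -> : z = inord k by apply: val_inj; rewrite /= inordK.
by rewrite inordK// ltnn; move: E; case: (zeta _); case: (eta _).
Qed.

End Stationary.

(** * Dirichlet form of the stationary measure *)

Section ExpLn.
Context {R : realType}.

Lemma expRB1_le (x : R) : expR x - 1 <= x * expR x.
Proof.
have : expR x * (1 - x) <= expR x * expR (- x).
  by rewrite ler_wpM2l ?expR_ge0// expR_ge1Dx.
by rewrite expRN divff ?gt_eqF ?expR_gt0//; lra.
Qed.

Lemma norm_expRB1_le (x : R) : `|expR x - 1| <= `|x| * expR `|x|.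
Proof.
have h1 := expRB1_le x; have h2 := expR_ge1Dx x.
have [x0|x0] := lerP 0 x.
  by rewrite !ger0_norm//; lra.
rewrite ler0_norm; last by rewrite subr_le0 ltW// expR_lt1.
rewrite ltr0_norm//; apply: (@le_trans _ _ (- x)); first lra.
by rewrite ler_peMr ?oppr_ge0 1?ltW// expR_gt1 oppr_gt0.
Qed.

Lemma norm_expRB1D_le (x : R) : `|expR x - 1 - x| <= x ^+ 2 * expR `|x|.
Proof.
have h1 := expRB1_le x; have h2 := expR_ge1Dx x.
rewrite ger0_norm; last by lra.
apply: (@le_trans _ _ (x * (expR x - 1))); first lra.
apply: (le_trans (ler_norm _)); rewrite normrM -real_normK ?num_real// expr2 -mulrA.
by rewrite ler_wpM2l// norm_expRB1_le.
Qed.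

Lemma sqr_le_norm (x y : R) : `|x| <= y -> x ^+ 2 <= y ^+ 2.
Proof.
move=> h; rewrite -(real_normK (num_real x)) lerXn2r// nnegrE//.
exact: le_trans h.
Qed.

Lemma ln_le_subr1 (x : R) : 0 < x -> ln x <= x - 1.
Proof. by move=> x0; have := expR_ge1Dx (ln x); rewrite lnK//; lra. Qed.

End ExpLn.

Section Dirichlet.
Context {R : realType}.
Variables (J : R -> R -> R) (beta rhom rhop : R) (N : nat).
Hypothesis rhom01 : 0 < rhom < 1.
Hypothesis rhop01 : 0 < rhop < 1.
Hypothesis N0 : (0 < N)%N.
Variable mu : config N -> R.
Hypothesis muinv : invariant_prob (@generator R J beta rhom rhop N) mu.
Implicit Types (eta s : config N) (i : 'I_(N.*2)).
Notation rate i eta := (exchange_rate J beta (bond_l i) (bond_r i) eta).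
Variable K : R.
Hypothesis K0 : 0 <= K.
Hypothesis rateK : forall i eta, `|rate i eta - 1| <= K / N%:R.

(** The Dirichlet form of the square root of [mu] across bond i for exchange rate 1; each pair of
    configurations is counted twice. *)
Definition dirichlet i : R :=
  \sum_eta (Num.sqrt (mu (swap i eta)) - Num.sqrt (mu eta)) ^+ 2.

(** The chemical potential of density r: the weights exp(logit r * zeta) on {0,1} satisfy detailed
    balance with [boundary_rate r]. *)
Definition logit (r : R) : R := ln (r / (1 - r)).
Let theta : R := `|logit rhop - logit rhom|.
Let lam (k : nat) := logit rhom + (logit rhop - logit rhom) * (k%:R / (N.*2)%:R).
Let logw eta := \sum_(k < N.*2.+1) lam k * occ R eta k.
Let tau i eta := (occ R eta i - occ R eta i.+1) * ((logit rhop - logit rhom) / (N.*2)%:R).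

Let n0 : 0 < (N.*2)%:R :> R.
Proof. by rewrite ltr0n double_gt0. Qed.

Let NR0 : 0 < N%:R :> R. Proof. by rewrite ltr0n. Qed.

Let logw_swap i eta : logw (swap i eta) = logw eta + tau i eta.
Proof.
rewrite /logw sum_occ_swap ltnS ltnW// ltnS ltn_ord /tau /lam.
rewrite -[i.+1]addn1 natrD addn1; field; rewrite ?gt_eqF//.
Qed.

Let tau_swap i eta : tau i (swap i eta) = - tau i eta.
Proof.
rewrite /tau !occ_swap !eqxx (ltn_eqF (ltnSn i)) (gtn_eqF (ltnSn i)) /= !mulr1n !mulr0n; ring.
Qed.

Let tauN i eta : `|tau i eta / 2| <= theta / N%:R.
Proof.
have -> : theta / N%:R = 2 * (theta / (N.*2)%:R).
  by rewrite -mul2n natrM; field; rewrite pnatr_eq0 -lt0n.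
have t0 : 0 <= theta / (N.*2)%:R by apply: divr_ge0; [exact: normr_ge0|exact: ltW].
have d1 : `|occ R eta i - occ R eta i.+1| <= 1.
  by case: (occ01 (R := R) eta i) => ->; case: (occ01 (R := R) eta i.+1) => ->; rewrite ler_norml; lra.
rewrite /tau !normrM !normfV (gtr0_norm n0) (ger0_norm (ler0n R 2)) -/theta.
apply: (@le_trans _ _ (1 * (theta / (N.*2)%:R) / 2)); last lra.
by rewrite ler_wpM2r ?invr_ge0// ler_wpM2r.
Qed.

(* Up to a constant, the log-density of mu relative to the product measure with
   chemical potential lam; at each end its boundary dynamics is reversible. *)
Let logf eta := ln (mu eta) - logw eta.

Let mu_gt0 eta : 0 < mu eta := stationary_gt0 rhom01 rhop01 muinv eta.
Let mu_sum : \sum_eta mu eta = 1. Proof. by case: muinv => -[]. Qed.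

Let KK := K ^+ 2 + 2 * (K + theta) * theta * expR theta + K * theta.

(** Let a and b be the square roots of [mu] at [eta] and at [swap i eta]. The inequality ln x <= x -
    1 at x = (b/a) exp(-tau/2) bounds the entropy production by 2(ab - a^2), which sums to minus the
    Dirichlet form, plus corrections. The first-order correction tau * ab cancels, being
    antisymmetric under the swap. The deviation of the rate from 1 is split by Young's inequality:
    it costs half of the Dirichlet form and an error of order 1/N^2. *)
Let bond_term i :
  \sum_eta mu eta * (rate i eta * (logf (swap i eta) - logf eta)) <=
  - (dirichlet i / 2) + 2 * KK / N%:R ^+ 2.
Proof.
pose a eta := Num.sqrt (mu eta); pose b eta := Num.sqrt (mu (swap i eta)).
have a0 eta : 0 < a eta by rewrite sqrtr_gt0.
have b0 eta : 0 < b eta by rewrite sqrtr_gt0.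
have a2 eta : a eta ^+ 2 = mu eta by rewrite sqr_sqrtr// ltW.
have b2 eta : b eta ^+ 2 = mu (swap i eta) by rewrite sqr_sqrtr// ltW.
have theta0 : 0 <= theta by exact: normr_ge0.
pose q := N%:R^-1 : R.
have q0 : 0 < q by rewrite invr_gt0.
have q1 : q <= 1 by rewrite invf_le1// ler1n.
have term eta : mu eta * (rate i eta * (logf (swap i eta) - logf eta)) <=
    2 * (a eta * b eta - a eta ^+ 2) - tau i eta * (a eta * b eta)
    + (b eta - a eta) ^+ 2 / 2 + 2 * (K * q) ^+ 2 * a eta ^+ 2
    + 2 * ((K + theta) * theta * expR theta * q ^+ 2) * (a eta * b eta).
  rewrite /logf logw_swap -a2 -b2 !lnXn//.
  set x := a eta; set y := b eta; set t := tau i eta; set C := rate i eta.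
  have x0 : 0 < x := a0 _; have y0 : 0 < y := b0 _.
  have C0 : 0 < C by exact: expR_gt0.
  have CK : `|C - 1| <= K * q := rateK i eta.
  have tq : `|- (t / 2)| <= theta * q by rewrite normrN; exact: tauN.
  have L : ln y - ln x - t / 2 <= y / x * expR (- (t / 2)) - 1.
    have -> : ln y - ln x - t / 2 = ln (y / x * expR (- (t / 2))).
      by rewrite lnM ?posrE ?expR_gt0 ?divr_gt0// ln_div ?posrE// expRK.
    by apply: ln_le_subr1; rewrite mulr_gt0 ?expR_gt0// divr_gt0.
  set E := expR (- (t / 2)).
  have step1 : x ^+ 2 * (C * (ln y *+ 2 - (logw eta + t) - (ln x *+ 2 - logw eta))) <=
      2 * C * (x * y * E - x ^+ 2).
    have -> : x * y * E - x ^+ 2 = x ^+ 2 * (y / x * E - 1) by field; rewrite ?gt_eqF//.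
    have -> : ln y *+ 2 - (logw eta + t) - (ln x *+ 2 - logw eta) = 2 * (ln y - ln x - t / 2).
      by rewrite !mulr2n; field.
    have -> : x ^+ 2 * (C * (2 * (ln y - ln x - t / 2))) =
      2 * C * (x ^+ 2 * (ln y - ln x - t / 2)) by ring.
    apply: ler_wpM2l; first by apply: mulr_ge0 => //; exact: ltW.
    by apply: ler_wpM2l => //; exact: sqr_ge0.
  apply: (le_trans step1).
  have ethq : expR (theta * q) <= expR theta by rewrite ler_expR ler_piMr.
  have expb : expR `|- (t / 2)| <= expR theta.
    by apply: le_trans ethq; rewrite ler_expR.
  have E1 : `|E - 1| <= theta * q * expR theta.
    by apply: (le_trans (norm_expRB1_le _)); apply: ler_pM; rewrite ?expR_ge0.
  have E2 : `|E - 1 - - (t / 2)| <= (theta * q) ^+ 2 * expR theta.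
    apply: (le_trans (norm_expRB1D_le _)); apply: ler_pM; rewrite ?expR_ge0 ?sqr_ge0//.
    exact: sqr_le_norm.
  have CE : `|(C - 1) * (E - 1)| <= K * q * (theta * q * expR theta).
    by rewrite normrM ler_pM.
  have CE' : C * (E - 1) + t / 2 <= (K + theta) * theta * expR theta * q ^+ 2.
    have -> : C * (E - 1) + t / 2 = (C - 1) * (E - 1) + (E - 1 - - (t / 2)) by ring.
    apply: (@le_trans _ _ (K * q * (theta * q * expR theta) + (theta * q) ^+ 2 * expR theta)).
      by apply: lerD; [exact: le_trans (ler_norm _) CE|exact: le_trans (ler_norm _) E2].
    by rewrite le_eqVlt; apply/orP; left; apply/eqP; ring.
  have P1 : x * y * (C * (E - 1) + t / 2) <= x * y * ((K + theta) * theta * expR theta * q ^+ 2).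
    by apply: ler_wpM2l => //; apply: mulr_ge0; exact: ltW.
  have P2 : (C - 1) * x * (y - x) <= (y - x) ^+ 2 / 4 + (K * q) ^+ 2 * x ^+ 2.
    have h : (C - 1) ^+ 2 * x ^+ 2 <= (K * q) ^+ 2 * x ^+ 2.
      by apply: ler_wpM2r; [exact: sqr_ge0|exact: sqr_le_norm].
    have h' := sqr_ge0 ((y - x) / 2 - (C - 1) * x); lra.
  have -> : 2 * C * (x * y * E - x ^+ 2) = 2 * (x * y - x ^+ 2) - t * (x * y) +
     2 * ((C - 1) * x * (y - x)) + 2 * (x * y * (C * (E - 1) + t / 2)) by field.
  lra.
apply: (le_trans (ler_sum _ (fun eta _ => term eta))).
have Sa : \sum_eta a eta ^+ 2 = 1 by rewrite -mu_sum; apply: eq_bigr => eta _; rewrite a2.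
have Sb : \sum_eta b eta ^+ 2 = 1.
  by rewrite -Sa -[RHS](sum_swap i); apply: eq_bigr => eta _.
have ba eta : b (swap i eta) = a eta by rewrite /b swapK.
have ab eta : a (swap i eta) = b eta by [].
have Stau : \sum_eta tau i eta * (a eta * b eta) = 0.
  have H : \sum_eta tau i eta * (a eta * b eta) = - \sum_eta tau i eta * (a eta * b eta).
    rewrite -[LHS](sum_swap i) -sumrN; apply: eq_bigr => eta _.
    by rewrite tau_swap ba ab; ring.
  lra.
have Sd : dirichlet i = \sum_eta (b eta - a eta) ^+ 2 by [].
have Sab : \sum_eta a eta * b eta <= 1.
  apply: (@le_trans _ _ (\sum_eta (a eta ^+ 2 / 2 + b eta ^+ 2 / 2))).
    by apply: ler_sum => eta _; have := sqr_ge0 (a eta - b eta); lra.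
  by rewrite big_split/= -!mulr_suml Sa Sb; lra.
have Sd' : \sum_eta (a eta * b eta - a eta ^+ 2) = - (dirichlet i / 2).
  rewrite Sd (_ : \sum_eta (b eta - a eta) ^+ 2 =
    \sum_eta (b eta ^+ 2 + a eta ^+ 2 - 2 * (a eta * b eta))); last first.
    by apply: eq_bigr => eta _; ring.
  by rewrite !(sumrB, big_split)/= -!mulr_sumr Sa Sb; lra.
rewrite !(sumrB, big_split)/= -!mulr_sumr -mulr_suml Sd' Stau -Sd Sa /KK.
have Z0 : 0 <= (K + theta) * theta * expR theta.
  by rewrite !mulr_ge0 ?addr_ge0 ?expR_ge0.
set Z := (K + theta) * theta * expR theta in Z0 *.
have -> : 2 * (K ^+ 2 + 2 * (K + theta) * theta * expR theta + K * theta) / N%:R ^+ 2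
   = 2 * (K * q) ^+ 2 + 4 * (Z * q ^+ 2) + 2 * (K * theta * q ^+ 2).
  by rewrite /Z /q; field; rewrite ?gt_eqF//.
have h1 : Z * q ^+ 2 * \sum_eta a eta * b eta <= Z * q ^+ 2.
  by rewrite ler_piMr// mulr_ge0// sqr_ge0.
have h2 : 0 <= K * theta * q ^+ 2 by rewrite !mulr_ge0// ltW.
have h3 : 0 <= Z * q ^+ 2 by rewrite mulr_ge0// sqr_ge0.
lra.
Qed.

(** Detailed balance at the reservoir turns the increment of [logf] into that of ln m, where m is
    [mu] times the flip rate. Symmetrising over the flip leaves products of m - m' with ln m' - ln
    m, which have opposite signs. *)
Let boundary_term (x : site N) (r : R) : 0 < r < 1 ->
  (forall eta, logw (flip x eta) = logw eta + (1 - 2 * occ R eta x) * logit r) ->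
  \sum_eta mu eta * (boundary_rate r (eta x) * (logf (flip x eta) - logf eta)) <= 0.
Proof.
move=> /andP[r0 r1] Hw.
pose c eta := boundary_rate r (eta x).
have c0 eta : 0 < c eta by rewrite boundary_rate_gt0// r0.
pose m eta := mu eta * c eta.
have m0 eta : 0 < m eta by rewrite mulr_gt0.
have r1' : 0 < 1 - r by lra.
have E eta : logf (flip x eta) - logf eta = ln (m (flip x eta)) - ln (m eta).
  rewrite /logf Hw /m !lnM ?posrE// /logit ln_div ?posrE// -occE /c /boundary_rate.
  rewrite ffunE eqxx; case: (eta x);
  by rewrite /= ?mulr1n ?mulr0n ?subr0 ?subrr !mulr0 !mulr1 ?addr0 ?add0r; ring.
pose A := \sum_eta m eta * (ln (m (flip x eta)) - ln (m eta)).
have -> : \sum_eta mu eta * (boundary_rate r (eta x) * (logf (flip x eta) - logf eta)) = A.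
  by apply: eq_bigr => eta _; rewrite E mulrA.
have A2 : A + A = \sum_eta (m eta - m (flip x eta)) * (ln (m (flip x eta)) - ln (m eta)).
  rewrite {2}/A -(sum_flip x) -big_split/=; apply: eq_bigr => eta _.
  by rewrite flipK; ring.
have : A + A <= 0; last lra.
rewrite A2; apply: sumr_le0 => eta _.
have [h|h] := lerP (m eta) (m (flip x eta)).
  by rewrite mulr_le0_ge0// ?subr_le0// subr_ge0 ler_ln ?posrE.
by rewrite mulr_ge0_le0// ?subr_ge0 ?subr_le0 ?ler_ln ?posrE// ltW.
Qed.

(** Stationarity tested on [logf]. The potential [lam] equals the reservoir potentials at the two
    ends, so both boundary contributions are nonpositive; its slope of order 1/N leaves an error of
    order 1/N^2 at each of the 2N bonds. *)
Lemma dirichlet_bound : \sum_(i < N.*2) dirichlet i <= 8 * KK / N%:R.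
Proof.
have := stationarity rhom01 rhop01 muinv logf.
rewrite (_ : \sum_eta _ =
  \sum_(i < N.*2) \sum_eta mu eta * (rate i eta * (logf (swap i eta) - logf eta)) +
  \sum_eta mu eta * (boundary_rate rhom (eta ord0) * (logf (flip ord0 eta) - logf eta)) +
  \sum_eta mu eta * (boundary_rate rhop (eta ord_max) * (logf (flip ord_max eta) - logf eta)));
  last first.
  rewrite exchange_big/= -!big_split/=; apply: eq_bigr => eta _.
  by rewrite generatorE !mulrDr mulr_sumr.
have h1 := @boundary_term ord0 rhom rhom01; have h2 := @boundary_term ord_max rhop rhop01.
have {}h1 := h1 _; have {}h2 := h2 _.
have {h1} : \sum_eta mu eta * (boundary_rate rhom (eta ord0) * (logf (flip ord0 eta) - logf eta)) <= 0.
  by apply: h1 => eta; rewrite /logw sum_occ_flip /= /lam mul0r mulr0 addr0.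
have {h2} : \sum_eta mu eta * (boundary_rate rhop (eta ord_max) * (logf (flip ord_max eta) - logf eta)) <= 0.
  apply: h2 => eta; rewrite /logw sum_occ_flip /= ltnSn /lam divff ?gt_eqF// mulr1.
  by congr (_ + _ * _); ring.
set B1 := \sum_eta _; set B2 := \sum_eta _ => b2 b1 e.
have h3 : \sum_(i < N.*2) \sum_eta mu eta * (rate i eta * (logf (swap i eta) - logf eta)) <=
   \sum_(i < N.*2) (- (dirichlet i / 2) + 2 * KK / N%:R ^+ 2).
  by apply: ler_sum => i _; exact: bond_term.
have h4 : \sum_(i < N.*2) (- (dirichlet i / 2) + 2 * KK / N%:R ^+ 2) =
   - ((\sum_(i < N.*2) dirichlet i) / 2) + 4 * KK / N%:R.
  rewrite big_split/= sumrN -mulr_suml sumr_const card_ord -[X in _ + X]mulr_natl.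
  by congr (_ + _); rewrite -mul2n natrM; field; rewrite ?gt_eqF//.
have -> : 8 * KK / N%:R = 2 * (4 * KK / N%:R) by ring.
lra.
Qed.

End Dirichlet.

(** * The energy of the height function *)

Lemma mean_norm_le (R : realType) (M : nat) (p : nat -> R) (H : R) : (0 < M)%N ->
  (forall b, (b < M)%N -> `|p b| <= H) -> `|mean M p| <= H.
Proof.
move=> M0 pH; rewrite /mean normrM normfV [`|M%:R|]ger0_norm// ler_pdivrMr ?ltr0n//.
apply: (le_trans (ler_norm_sum _ _ _)).
apply: (@le_trans _ _ (\sum_(b < M) H)); first by apply: ler_sum => b _; exact: pH.
by rewrite sumr_const card_ord -[leLHS]mulr_natr.
Qed.

Section Fluctuations.
Context {R : realType} {N : nat}.
Variable r : nat -> R.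
Implicit Types (eta : config N) (i : 'I_(N.*2)).

(* Extended by zero beyond the lattice, so that block averages near the right
   end need no separate treatment. *)
Definition fluct eta (k : nat) : R := if (k <= N.*2)%N then occ R eta k - r k else 0.

Definition height eta (b : nat) : R := \sum_(k < b) fluct eta k.

(** Minus the centred height, that is, minus the derivative of the energy with respect to the height
    at cut b. The 2N+1 sites have 2N+2 cuts, the empty partial sum included. *)
Definition tilt eta (b : nat) : R := mean N.*2.+2 (height eta) - height eta b.

Definition xpos (k : nat) : R := (k%:R - N%:R) / N%:R.

Lemma fluct_out eta k : (N.*2 < k)%N -> fluct eta k = 0.
Proof. by rewrite /fluct ltnNge => /negbTE ->. Qed.

Lemma tilt_step eta b : tilt eta b.+1 - tilt eta b = - fluct eta b.
Proof. by rewrite /tilt /height big_ord_recr/=; ring. Qed.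

Lemma heightE eta b : (b <= N.*2.+1)%N ->
  height eta b = \sum_(k < b) 1 * occ R eta k - \sum_(k < b) r k.
Proof.
move=> bN; rewrite /height -sumrB; apply: eq_bigr => k _.
by rewrite /fluct mul1r -ltnS (leq_trans (ltn_ord k) bN).
Qed.

Lemma height_swap i eta b : (b <= N.*2.+1)%N ->
  height (swap i eta) b =
  height eta b + (occ R eta i.+1 - occ R eta i) * (b == i.+1)%:R.
Proof.
move=> bN; rewrite !heightE// (sum_occ_swap b (fun=> 1)) addrAC; congr (_ + _ * _).
have [->|bi] := eqVneq b i.+1; first by rewrite ltnSn ltnn subr0.
by case: ltnP => h1; case: ltnP => h2; rewrite ?subrr//; lia.
Qed.

(** A flip at the left end raises all heights except the empty one. Written as a common shift
    together with the opposite change at cut 0, it fits [energy_update]. *)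
Lemma height_flip0 eta b : (b <= N.*2.+1)%N ->
  height (flip ord0 eta) b = height eta b +
  - (1 - 2 * occ R eta 0) * (b == 0)%:R + (1 - 2 * occ R eta 0).
Proof.
move=> bN; rewrite !heightE// (sum_occ_flip b (fun=> 1)) (_ : (ord0 : site N) = 0%N :> nat)//.
by case: b bN => [|b] _; rewrite /= ?mulr1n ?mulr0n; ring.
Qed.

Lemma height_flip_max eta b : (b <= N.*2.+1)%N ->
  height (flip ord_max eta) b = height eta b +
  (1 - 2 * occ R eta N.*2) * (b == N.*2.+1)%:R + 0.
Proof.
move=> bN; rewrite addr0 !heightE// (sum_occ_flip b (fun=> 1)) addrAC /=; congr (_ + _ * _).
by rewrite eqn_leq bN/=; case: ltnP.
Qed.

Lemma tilt_swap i eta b : (b <= N.*2.+1)%N ->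
  `|tilt (swap i eta) b - tilt eta b| <= 1.
Proof.
move=> bN; have iN := ltn_ord i.
have Hb b' : (b' < N.*2.+2)%N -> height (swap i eta) b' =
    height eta b' + (occ R eta i.+1 - occ R eta i) * (b' == i.+1)%:R + 0.
  by move=> h; rewrite addr0 height_swap.
have L0 : (0 < N.*2.+2)%N by [].
rewrite /tilt (mean_update L0 (b0 := i.+1) _ Hb)//; last by rewrite ltnS ltnW.
rewrite height_swap//; set d := occ R eta i.+1 - occ R eta i.
have d1 : `|d| <= 1.
  by rewrite /d; case: (occ01 (R := R) eta i) => ->; case: (occ01 (R := R) eta i.+1) => ->;
     rewrite ler_norml; lra.
have -> : mean N.*2.+2 (height eta) + d / N.*2.+2%:R + 0 -
   (height eta b + d * (b == i.+1)%:R) - (mean N.*2.+2 (height eta) - height eta b)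
   = d * (N.*2.+2%:R^-1 - (b == i.+1)%:R) by ring.
rewrite normrM -[leRHS]mulr1 ler_pM//.
have q0 : 0 <= N.*2.+2%:R^-1 :> R by rewrite invr_ge0.
have q1 : N.*2.+2%:R^-1 <= 1 :> R by rewrite invf_le1 ?ltr0n// ler1n.
move: q0 q1; set q := (_^-1); case: (_ == _) => q0 q1; rewrite ler_norml /=; lra.
Qed.

Section Bounds.
Hypothesis N0 : (0 < N)%N.
Hypothesis r01 : forall k, 0 <= r k <= 1.

Lemma fluct_le1 eta k : `|fluct eta k| <= 1.
Proof.
rewrite /fluct; case: ifP => _; last by rewrite normr0.
have /andP[a b] := r01 k.
by case: (occ01 (R := R) eta k) => ->; rewrite ler_norml; lra.
Qed.

Lemma tilt_le (H : R) eta b : (forall b, (b <= N.*2.+1)%N -> `|height eta b| <= H) ->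
  (b <= N.*2.+1)%N -> `|tilt eta b| <= 2 * H.
Proof.
move=> hH bN; rewrite /tilt; apply: (le_trans (ler_normB _ _)).
have -> : 2 * H = H + H by ring.
by apply: lerD; [apply: mean_norm_le|exact: hH].
Qed.

Lemma tilt_le6 eta b : (b <= N.*2.+1)%N -> `|tilt eta b| <= 6 * N%:R.
Proof.
move=> bN; have -> : 6 * N%:R = 2 * (3 * N%:R) :> R by ring.
apply: tilt_le => // b' b'N; rewrite /height.
apply: (le_trans (ler_norm_sum _ _ _)).
apply: (@le_trans _ _ (\sum_(k < b') 1)); first by apply: ler_sum => k _; exact: fluct_le1.
by rewrite sumr_const card_ord -natrM ler_nat (leq_trans b'N)// leq_sites.
Qed.

End Bounds.

Section Generator.
Variables (J : R -> R -> R) (beta rhom rhop : R).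
Hypothesis r0 : r 0 = rhom.
Hypothesis rn : r N.*2 = rhop.
Notation rate i eta := (exchange_rate J beta (bond_l i) (bond_r i) eta).

Definition tilt_energy eta : R := energy N.*2.+2 (height eta).

Let kappa : R := 1 - N.*2.+2%:R^-1.

(** Summation by parts of the differences of [fluct] against [tilt] yields minus the sum of squares,
    since the increments of [tilt] are minus [fluct]. Its two boundary terms cancel the first-order
    reservoir contributions because r takes the reservoir densities at the ends. The [kappa] terms
    are the second-order part of the update. *)
Lemma generator_tilt_energy eta :
  generator J beta rhom rhop tilt_energy eta =
  - (\sum_(k < N.*2.+1) fluct eta k ^+ 2)
  + \sum_(i < N.*2) tilt eta i.+1 *
      ((rate i eta - 1) * (occ R eta i - occ R eta i.+1) - (r i.+1 - r i))
  + kappa / 2 * (\sum_(i < N.*2) rate i eta * (occ R eta i - occ R eta i.+1) ^+ 2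
      + boundary_rate rhom (eta ord0) + boundary_rate rhop (eta ord_max)).
Proof.
rewrite generatorE.
have L0 : (0 < N.*2.+2)%N by [].
have E1 i : tilt_energy (swap i eta) - tilt_energy eta =
    (occ R eta i - occ R eta i.+1) * tilt eta i.+1 +
    kappa / 2 * (occ R eta i - occ R eta i.+1) ^+ 2.
  rewrite /tilt_energy (energy_update L0 (p := height eta) (b0 := i.+1)
    (d := occ R eta i.+1 - occ R eta i) (c := 0)).
  - by rewrite -/(tilt eta i.+1) -/kappa; field.
  - by rewrite !ltnS ltnW// ltn_ord.
  - by move=> b bN; rewrite addr0 height_swap.
have E2 : tilt_energy (flip ord0 eta) - tilt_energy eta =
    (1 - 2 * occ R eta 0) * tilt eta 0 + kappa / 2.
  rewrite /tilt_energy (energy_update L0 (p := height eta) (b0 := 0)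
    (d := - (1 - 2 * occ R eta 0)) (c := 1 - 2 * occ R eta 0))//.
  - rewrite -/(tilt eta 0) -/kappa.
    by case: (occ01 (R := R) eta 0) => ->; field.
  - by move=> b bN; rewrite height_flip0.
have E3 : tilt_energy (flip ord_max eta) - tilt_energy eta =
    - (1 - 2 * occ R eta N.*2) * tilt eta N.*2.+1 + kappa / 2.
  rewrite /tilt_energy (energy_update L0 (p := height eta) (b0 := N.*2.+1)
    (d := 1 - 2 * occ R eta N.*2) (c := 0))//.
  - rewrite -/(tilt eta N.*2.+1) -/kappa.
    by case: (occ01 (R := R) eta N.*2) => ->; field.
  - by move=> b bN; rewrite height_flip_max.
rewrite E2 E3 (eq_bigr (fun i : 'I_(N.*2) =>
  (fluct eta i - fluct eta i.+1) * tilt eta i.+1 +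
  tilt eta i.+1 * ((rate i eta - 1) * (occ R eta i - occ R eta i.+1) - (r i.+1 - r i)) +
  kappa / 2 * (rate i eta * (occ R eta i - occ R eta i.+1) ^+ 2))); last first.
  by move=> i _; rewrite E1 /fluct ltnW// ltn_ord; ring.
rewrite !big_split/= -mulr_sumr abel_sum.
have -> : \sum_(k < N.*2.+1) fluct eta k * (tilt eta k.+1 - tilt eta k) =
   - \sum_(k < N.*2.+1) fluct eta k ^+ 2.
  by rewrite -sumrN; apply: eq_bigr => k _; rewrite tilt_step; ring.
have F0 : fluct eta 0 = occ R eta 0 - rhom by rewrite /fluct leq0n r0.
have Fn : fluct eta N.*2 = occ R eta N.*2 - rhop by rewrite /fluct leqnn rn.
have B0 : boundary_rate rhom (eta ord0) * (1 - 2 * occ R eta 0) = rhom - occ R eta 0.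
  rewrite -(@occE R _ eta ord0) /boundary_rate; case: (eta ord0); rewrite /= ?mulr1n ?mulr0n; ring.
have Bn : boundary_rate rhop (eta ord_max) * (1 - 2 * occ R eta N.*2) = rhop - occ R eta N.*2.
  rewrite -(@occE R _ eta ord_max) /boundary_rate; case: (eta ord_max);
  rewrite /= ?mulr1n ?mulr0n; ring.
have -> : boundary_rate rhom (eta ord0) * ((1 - 2 * occ R eta 0) * tilt eta 0 + kappa / 2) =
    (rhom - occ R eta 0) * tilt eta 0 + boundary_rate rhom (eta ord0) * (kappa / 2).
  by rewrite -B0; ring.
have -> : boundary_rate rhop (eta ord_max) *
      (- (1 - 2 * occ R eta N.*2) * tilt eta N.*2.+1 + kappa / 2) =
    - (rhop - occ R eta N.*2) * tilt eta N.*2.+1 + boundary_rate rhop (eta ord_max) * (kappa / 2).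
  by rewrite -Bn; ring.
by rewrite F0 Fn; ring.
Qed.

End Generator.

End Fluctuations.
Arguments xpos {R} N k.

(** * Replacement by block averages *)

Section Expectation.
Context {R : realType} {S : finType}.
Variable mu : S -> R.

Definition expect (f : S -> R) : R := \sum_s mu s * f s.

Lemma expectD f g : expect (fun s => f s + g s) = expect f + expect g.
Proof. by rewrite /expect -big_split/=; apply: eq_bigr => s _; rewrite mulrDr. Qed.

Lemma expectZ c f : expect (fun s => c * f s) = c * expect f.
Proof. by rewrite /expect mulr_sumr; apply: eq_bigr => s _; rewrite mulrCA. Qed.

Lemma expectB f g : expect (fun s => f s - g s) = expect f - expect g.
Proof. by rewrite /expect -sumrB; apply: eq_bigr => s _; rewrite mulrBr. Qed.

Lemma expect_sum (I : finType) (F : I -> S -> R) :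
  expect (fun s => \sum_i F i s) = \sum_i expect (F i).
Proof. by rewrite /expect exchange_big/=; apply: eq_bigr => s _; rewrite mulr_sumr. Qed.

Lemma eq_expect f g : f =1 g -> expect f = expect g.
Proof. by move=> fg; apply: eq_bigr => s _; rewrite fg. Qed.

Hypothesis muP : is_prob mu.

Lemma expect_cst c : expect (fun=> c) = c.
Proof. by rewrite /expect -mulr_suml muP.2 mul1r. Qed.

Lemma ler_expect f g : (forall s, f s <= g s) -> expect f <= expect g.
Proof. by move=> fg; apply: ler_sum => s _; apply: ler_wpM2l; rewrite ?muP.1. Qed.

Lemma norm_expect_le f c : (forall s, `|f s| <= c) -> `|expect f| <= c.
Proof.
move=> fc; rewrite -[leRHS]expect_cst ler_norml -[- expect _]mulN1r -expectZ.
by apply/andP; split; apply: ler_expect => s; have := fc s; rewrite ler_norml ?mulN1r => /andP[].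
Qed.

End Expectation.

Section Replacement.
Context {R : realType} {N : nat}.
Hypothesis N0 : (0 < N)%N.
Variable mu : config N -> R.
Hypothesis muP : is_prob mu.
Implicit Types (eta : config N) (i : 'I_(N.*2)).

Let NR0 : 0 < N%:R :> R. Proof. by rewrite ltr0n. Qed.

(** The occupation difference is antisymmetric under the swap. Averaging the expectation with its
    swapped form therefore produces the difference of [mu] across the bond, factored as (a - b)(a +
    b) with square roots, and an oscillation term for g. Young's inequality with weight N balances
    the two errors: summed over the bonds, N times the Dirichlet form and the terms 1/N are both of
    order one. *)
Lemma bond_antisym_le (g : config N -> R) (c o : R) i :
  (forall eta, `|g eta| <= c) -> (forall eta, `|g (swap i eta) - g eta| <= o) ->
  `|expect mu (fun eta => g eta * (occ R eta i - occ R eta i.+1))| <=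
  c * (N%:R * dirichlet mu i / 4 + N%:R^-1) + o / 2.
Proof.
move=> gc go.
pose eta0 : config N := [ffun=> false].
have c0 : 0 <= c by exact: le_trans (gc eta0).
set X := expect _ _; pose d eta := occ R eta i - occ R eta i.+1.
pose a eta := Num.sqrt (mu eta); pose b eta := Num.sqrt (mu (swap i eta)).
have a0 eta : 0 <= a eta by rewrite sqrtr_ge0.
have b0 eta : 0 <= b eta by rewrite sqrtr_ge0.
have a2 eta : a eta ^+ 2 = mu eta by rewrite sqr_sqrtr// muP.1.
have b2 eta : b eta ^+ 2 = mu (swap i eta) by rewrite sqr_sqrtr// muP.1.
have ds eta : d (swap i eta) = - d eta.
  rewrite /d !occ_swap !eqxx (ltn_eqF (ltnSn i)) (gtn_eqF (ltnSn i)) /= ?mulr1n ?mulr0n; ring.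
have d1 eta : `|d eta| <= 1.
  by rewrite /d; case: (occ01 (R := R) eta i) => ->; case: (occ01 (R := R) eta i.+1) => ->;
     rewrite ler_norml; lra.
have X2 : 2 * X = \sum_eta d eta *
   (g eta * (mu eta - mu (swap i eta)) + mu (swap i eta) * (g eta - g (swap i eta))).
  have X1 : X = \sum_eta mu eta * (g eta * d eta) by [].
  have X1' : X = \sum_eta mu (swap i eta) * (g (swap i eta) * d (swap i eta)).
    by rewrite X1 -[LHS](sum_swap i).
  have -> : 2 * X = X + X by ring.
  rewrite {1}X1 X1' -big_split/=; apply: eq_bigr => eta _.
  by rewrite ds; ring.
have term eta : `|d eta * (g eta * (mu eta - mu (swap i eta)) +
      mu (swap i eta) * (g eta - g (swap i eta)))| <=
    c * (N%:R * (b eta - a eta) ^+ 2 / 2 + (a eta ^+ 2 + b eta ^+ 2) / N%:R) + b eta ^+ 2 * o.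
  rewrite normrM -[leRHS]mul1r ler_pM//; apply: (le_trans (ler_normD _ _)).
  rewrite !normrM; apply: lerD; last first.
    by rewrite -b2 ger0_norm ?sqr_ge0// distrC ler_wpM2l ?sqr_ge0.
  apply: ler_pM => //; rewrite -a2 -b2.
  have -> : a eta ^+ 2 - b eta ^+ 2 = (a eta - b eta) * (a eta + b eta) by ring.
  rewrite normrM [`|a eta + b eta|]ger0_norm ?addr_ge0//.
  set q := N%:R^-1; have q0 : 0 < q by rewrite invr_gt0.
  have qN : q * N%:R = 1 by rewrite mulVf ?gt_eqF.
  set z := `|a eta - b eta|; have -> : (b eta - a eta) ^+ 2 = z ^+ 2.
    by rewrite real_normK ?num_real//; ring.
  set s := a eta + b eta.
  have s2 : s ^+ 2 <= 2 * (a eta ^+ 2 + b eta ^+ 2).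
    by rewrite /s; have := sqr_ge0 (a eta - b eta); lra.
  have h : 0 <= q * (N%:R * z - s) ^+ 2 by rewrite mulr_ge0 ?sqr_ge0 ?(ltW q0).
  have e : q * (N%:R * z - s) ^+ 2 = (q * N%:R) * (N%:R * z ^+ 2) -
     2 * (q * N%:R) * (z * s) + q * s ^+ 2 by ring.
  have := ler_wpM2l (ltW q0) s2.
  move: h; rewrite e qN; lra.
have Sa : \sum_eta a eta ^+ 2 = 1 by rewrite -muP.2; apply: eq_bigr => eta _.
have Sb : \sum_eta b eta ^+ 2 = 1.
  by rewrite -Sa -[RHS](sum_swap i); apply: eq_bigr.
have : `|2 * X| <= 2 * (c * (N%:R * dirichlet mu i / 4 + N%:R^-1) + o / 2).
  rewrite X2; apply: (le_trans (ler_norm_sum _ _ _)).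
  apply: (le_trans (ler_sum _ (fun eta _ => term eta))).
  rewrite big_split/= -mulr_sumr -mulr_suml Sb big_split/= -!mulr_suml -mulr_sumr.
  rewrite big_split/= Sa Sb -/(dirichlet mu i); lra.
by rewrite normrM ger0_norm// ler_pM2l.
Qed.

Variables (r : nat -> R) (K4 CD : R).
Hypothesis r01 : forall k, 0 <= r k <= 1.
Hypothesis rlip : forall k, (k < N.*2)%N -> `|r k.+1 - r k| <= K4 / N%:R.
Hypothesis dirCD : \sum_(i < N.*2) dirichlet mu i <= CD / N%:R.
Notation om := (fluct r).

Let dir_ge0 i : 0 <= dirichlet mu i.
Proof. by apply: sumr_ge0 => eta _; exact: sqr_ge0. Qed.

Let K40 : 0 <= K4.
Proof.
have n0 : (0 < N.*2)%N by rewrite double_gt0.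
have := le_trans (normr_ge0 _) (rlip n0).
by rewrite pmulr_lge0 ?invr_gt0.
Qed.

Let CD0 : 0 <= CD.
Proof.
have : 0 <= CD / N%:R by apply: le_trans dirCD; apply: sumr_ge0.
by rewrite pmulr_lge0 ?invr_gt0.
Qed.

(** The Dirichlet form indexed by [nat], with value 0 where k is not a bond. *)
Let Dn (k : nat) : R := \sum_(i < N.*2) dirichlet mu i * (i == k :> nat)%:R.

Let Dn_ge0 k : 0 <= Dn k.
Proof. by apply: sumr_ge0 => i _; rewrite mulr_ge0. Qed.

Let Dn_ge i : dirichlet mu i <= Dn i.
Proof. by rewrite /Dn (bigD1 i)//= eqxx mulr1 lerDl; apply: sumr_ge0 => j _; rewrite mulr_ge0. Qed.

Let Dn_sum m p : \sum_(i < p) Dn (i + m)%N <= CD / N%:R.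
Proof.
apply: le_trans dirCD; rewrite /Dn exchange_big/=; apply: ler_sum => i _.
rewrite -mulr_sumr -[leRHS]mulr1 ler_wpM2l//.
have [mi|im] := leqP m i.
  apply: (@le_trans _ _ (\sum_(j < p) 1 * (j == i - m :> nat)%:R)%N%:R).
    rewrite natr_sum; apply: ler_sum => j _; rewrite mul1n ler_nat.
    by case: eqP => // ->; rewrite addnK eqxx.
  rewrite (sum_delta p (i - m) (fun=> 1%N)); case: ifP => _; by rewrite ?ler01.
rewrite big1// => j _; rewrite (_ : (i == _ :> nat) = false)//.
by apply/eqP => e; move: im; rewrite e ltnNge leq_addl.
Qed.

Let U : R := CD + 10 + 3 * K4.

Section Weight.
Variables (Psi : nat -> config N -> R) (c : R).
Hypothesis Psi_le : forall k eta, (k <= N.*2)%N -> `|Psi k eta| <= c.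
Hypothesis Psi_lip : forall k eta, (k < N.*2)%N -> `|Psi k.+1 eta - Psi k eta| <= c / N%:R.
Hypothesis Psi_swap : forall k i eta, (k <= N.*2)%N ->
  `|Psi k (swap i eta) - Psi k eta| <= c / N%:R.

Let c0 : 0 <= c.
Proof. by apply: le_trans (Psi_le [ffun=> false] (leq0n _)). Qed.

Let pair_sum (j k : nat) eta : R :=
  \sum_(i < N.*2.+1) Psi i eta * (om eta (i + j)%N * om eta (i + k)%N).

Let om_le a b eta : `|om eta a * om eta b| <= 1.
Proof. by rewrite normrM -[leRHS]mulr1 ler_pM// fluct_le1. Qed.

Let pair_sum_le j k eta : `|pair_sum j k eta| <= 3 * c * N%:R.
Proof.
apply: (le_trans (ler_norm_sum _ _ _)).
apply: (@le_trans _ _ (\sum_(i < N.*2.+1) c)).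
  apply: ler_sum => i _; rewrite normrM -[leRHS]mulr1 ler_pM// ?om_le//.
  by rewrite Psi_le// -ltnS.
rewrite sumr_const card_ord -[leLHS]mulr_natr -mulrA [leRHS]mulrCA ler_wpM2l//.
by rewrite -natrM ler_nat leq_sites.
Qed.

(** The second factor moves from i+m to i+m+1 across bond i+m. As m > 0 this bond does not touch
    site i, so the swap leaves the first factor unchanged and [bond_antisym_le] applies with the
    weight [Psi] times that factor. Past the right end the product is zero; only i+m = 2N leaves an
    edge term. *)
Let telescope_step (m : nat) : (0 < m)%N ->
  `|expect mu (pair_sum 0 m.+1) - expect mu (pair_sum 0 m)| <= c * U.
Proof.
move=> m0; rewrite -expectB.
rewrite (@eq_expect _ _ mu _ (fun eta => \sum_(i < N.*2.+1)
   (Psi i eta * om eta i) * (om eta (i + m).+1 - om eta (i + m)%N))); last first.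
  move=> eta; rewrite -sumrB; apply: eq_bigr => i _; rewrite addn0 addnS; ring.
rewrite expect_sum; apply: (le_trans (ler_norm_sum _ _ _)).
apply: (@le_trans _ _ (\sum_(i < N.*2.+1) (c * (N%:R * Dn (i + m)%N + (2 + K4) / N%:R) +
    c * (i == N.*2 - m :> nat)%N%:R))); last first.
  rewrite big_split/= -!mulr_sumr -mulrDr ler_wpM2l// big_split/= -mulr_sumr.
  have h1 : N%:R * \sum_(i < N.*2.+1) Dn (i + m)%N <= CD.
    by have := Dn_sum m N.*2.+1; rewrite (ler_pdivlMr _ _ NR0) mulrC.
  have h2 : \sum_(i < N.*2.+1) (2 + K4) / N%:R <= 3 * (2 + K4).
    have -> : \sum_(i < N.*2.+1) (2 + K4) / N%:R = (N.*2.+1)%:R / N%:R * (2 + K4).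
      by rewrite sumr_const card_ord -[LHS]mulr_natl; ring.
    by apply: ler_wpM2r; [apply: addr_ge0; [exact: ler0n|exact: K40]|exact: ratio_le3].
  have h3 : \sum_(i < N.*2.+1) (i == N.*2 - m :> nat)%N%:R <= 1 :> R.
    rewrite (eq_bigr (fun i : 'I_(N.*2.+1) => 1 * (i == N.*2 - m :> nat)%N%:R)); last first.
      by move=> i _; rewrite mul1r.
    by rewrite (sum_delta _ _ (fun=> 1)); case: ifP.
  by rewrite /U; lra.
apply: ler_sum => i _.
have Pom eta : `|Psi i eta * om eta i| <= c.
  by rewrite normrM -[leRHS]mulr1 ler_pM// ?fluct_le1// Psi_le// -ltnS.
have q0 : 0 < N%:R^-1 :> R by rewrite invr_gt0.
have k4 := K40; have cp := c0.
have z0 : 0 <= N%:R * Dn (i + m) by rewrite mulr_ge0.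
have z1 : 0 <= (2 + K4) / N%:R by rewrite divr_ge0//; lra.
case: (ltngtP (i + m) N.*2) => im.
- pose y := Ordinal im.
  rewrite (@eq_expect _ _ mu _ (fun eta =>
    (- (Psi i eta * om eta i)) * (occ R eta y - occ R eta y.+1)
    + - (r (i + m).+1 - r (i + m)%N) * (Psi i eta * om eta i))); last first.
    by move=> eta; rewrite {2 3}/fluct (ltnW im) im; ring.
  rewrite expectD expectZ; apply: (le_trans (ler_normD _ _)).
  have : `|expect mu (fun eta => - (Psi i eta * om eta i) * (occ R eta y - occ R eta y.+1))|
     <= c * (N%:R * dirichlet mu y / 4 + N%:R^-1) + c / N%:R / 2.
    apply: (@bond_antisym_le (fun eta => - (Psi i eta * om eta i)) c (c / N%:R) y) => eta.
      by rewrite normrN.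
    have -> : om (swap y eta) i = om eta i.
      rewrite /fluct occ_swap; have -> : (i == y :> nat) = false by apply: ltn_eqF; rewrite /= -[X in (X < _)%N]addn0 ltn_add2l.
      have -> : (i == y.+1 :> nat) = false by apply: ltn_eqF; rewrite /= ltnS leq_addr.
      by rewrite subrr mulr0 addr0.
    rewrite -opprD normrN -mulrBl normrM -[leRHS]mulr1 ler_pM// ?fluct_le1//.
    by rewrite Psi_swap// -ltnS.
  have h2 : `|- (r (i + m).+1 - r (i + m)%N) * expect mu (fun eta => Psi i eta * om eta i)| <=
      K4 / N%:R * c.
    by rewrite normrM normrN ler_pM// ?rlip// norm_expect_le.
  have h3 : c * (N%:R * dirichlet mu y) <= c * (N%:R * Dn (i + m)).
    by rewrite ler_wpM2l// ler_wpM2l ?(ltW NR0)//; exact: (Dn_ge y).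
  have h4 : 0 <= c * (N%:R * dirichlet mu y) by rewrite !mulr_ge0.
  have h5 : 0 <= c * (i == N.*2 - m :> nat)%N%:R by rewrite mulr_ge0.
  have h6 : 0 <= c * N%:R^-1 by rewrite mulr_ge0 ?(ltW q0).
  move: h2 => /=; lra.
- rewrite (@eq_expect _ _ mu _ (fun=> 0)); last first.
    by move=> eta; rewrite (fluct_out r eta im) (fluct_out r eta (leqW im)) subr0 mulr0.
  rewrite expect_cst// normr0; apply: addr_ge0; last by rewrite mulr_ge0.
  by apply: mulr_ge0 => //; exact: addr_ge0.
- have -> : (i == N.*2 - m :> nat)%N by apply/eqP; rewrite -[LHS](addnK m) im.
  rewrite mulr1; apply: (@le_trans _ _ c); last by rewrite lerDr mulr_ge0 ?addr_ge0.
  apply: norm_expect_le => // eta; rewrite im (fluct_out r _ (ltnSn _)) sub0r mulrN normrN.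
  by rewrite normrM -[leRHS]mulr1 ler_pM// fluct_le1.
Qed.

Let pair_near m : `|expect mu (pair_sum 0 m.+1) - expect mu (pair_sum 0 1)| <= c * U * m%:R.
Proof.
elim: m => [|m IH]; first by rewrite subrr normr0 mulr0.
rewrite -(subrK (expect mu (pair_sum 0 m.+1)) (expect mu (pair_sum 0 m.+2))) -addrA.
apply: (le_trans (ler_normD _ _)).
rewrite -[X in X%:R]addn1 natrD mulrDr mulr1 [leRHS]addrC; apply: lerD => //.
exact: telescope_step.
Qed.

Let pair_shift j m : `|expect mu (pair_sum j (j + m)) - expect mu (pair_sum 0 m)| <= 3 * c * j%:R.
Proof.
rewrite -expectB; apply: norm_expect_le => // eta.
have := @sum_shift_le R N N0 (fun k => Psi k eta) (fun k => om eta k * om eta (k + m)%N) c.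
move=> H; have {}H := H _ _ _ _ j.
rewrite (_ : pair_sum j (j + m) eta =
   \sum_(i < N.*2.+1) Psi i eta * (om eta (i + j)%N * om eta (i + j + m)%N)); last first.
  by apply: eq_bigr => i _; rewrite addnA.
rewrite (_ : pair_sum 0 m eta =
   \sum_(i < N.*2.+1) Psi i eta * (om eta i * om eta (i + m)%N)); last first.
  by apply: eq_bigr => i _; rewrite addn0.
apply: H => k.
- by move=> h; exact: Psi_le.
- by move=> h; exact: Psi_lip.
- exact: om_le.
- by move=> h; rewrite fluct_out// mul0r.
Qed.

(* The square of a block average is the mean of the pair products over the
   pairs (j, k) of the block; an off-diagonal pair is first translated to
   (0, k - j) and then its second member is moved next to the first. *)
Lemma block_replacement (l : nat) : (0 < l)%N ->
  `|expect mu (fun eta => \sum_(i < N.*2.+1) Psi i eta * block_avg l (om eta) i ^+ 2)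
    - expect mu (fun eta => \sum_(i < N.*2.+1) Psi i eta * (om eta i * om eta i.+1))|
  <= c * ((3 + U) * l%:R + 6 * N%:R / l%:R).
Proof.
move=> l0.
have lR0 : 0 < l%:R :> R by rewrite ltr0n.
have -> : expect mu (fun eta => \sum_(i < N.*2.+1) Psi i eta * (om eta i * om eta i.+1)) =
   expect mu (pair_sum 0 1).
  by apply: eq_expect => eta; apply: eq_bigr => i _; rewrite addn0 addn1.
set Q := expect mu (pair_sum 0 1).
have -> : expect mu (fun eta => \sum_(i < N.*2.+1) Psi i eta * block_avg l (om eta) i ^+ 2) - Q =
   (l%:R ^+ 2)^-1 * \sum_(j < l) \sum_(k < l) (expect mu (pair_sum j k) - Q).
  under [in RHS]eq_bigr do rewrite sumrB sumr_const card_ord.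
  rewrite sumrB sumr_const card_ord -mulrnA -[Q *+ _]mulr_natl natrM -expr2 mulrBr mulKf; last first.
    by rewrite expf_neq0 ?gt_eqF.
  congr (_ - _).
  under [in RHS]eq_bigr do rewrite -expect_sum.
  rewrite -expect_sum -expectZ; apply: eq_expect => eta.
  rewrite /pair_sum exchange_big/=; under [in RHS]eq_bigr do rewrite exchange_big/=.
  rewrite exchange_big/= mulr_sumr; apply: eq_bigr => i _.
  have -> : \sum_(j < l) \sum_(k < l) Psi i eta * (om eta (i + k)%N * om eta (i + j)%N) =
     Psi i eta * (\sum_(j < l) om eta (i + j)%N) ^+ 2.
    rewrite expr2 mulr_suml mulr_sumr; apply: eq_bigr => j _.
    by rewrite mulr_sumr mulr_sumr; apply: eq_bigr => k _; ring.
  by rewrite /block_avg exprMn exprVn; ring.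
rewrite normrM gtr0_norm ?invr_gt0 ?exprn_gt0// mulrC ler_pdivrMr ?exprn_gt0//.
apply: (le_trans (ler_norm_sum _ _ _)).
have cp := c0.
have U0 : 0 <= U by rewrite /U !addr_ge0 ?mulr_ge0.
(* Only the l diagonal pairs out of l^2 carry the trivial bound of order N, which becomes N/l after
   averaging; an off-diagonal pair costs O(l). *)
have bound (j k : 'I_l) : `|expect mu (pair_sum j k) - Q| <=
    c * (3 + U) * l%:R + 6 * c * N%:R * (k == j :> nat)%:R.
  have lt (a b : 'I_l) : (a < b)%N -> `|expect mu (pair_sum a b) - Q| <= c * (3 + U) * l%:R.
    move=> ab; rewrite -(subrK (expect mu (pair_sum 0 (b - a))) (expect mu (pair_sum a b))) -addrA.
    apply: (le_trans (ler_normD _ _)).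
    have h1 := pair_shift a (b - a); rewrite subnKC ?(ltnW ab)// in h1.
    have h2 := pair_near (b - a).-1; rewrite prednK ?subn_gt0// in h2.
    have h3 : 3 * c * a%:R <= 3 * c * l%:R.
      by apply: ler_wpM2l; [rewrite mulr_ge0|rewrite ler_nat ltnW].
    have h4 : c * U * (b - a).-1%:R <= c * U * l%:R.
      apply: ler_wpM2l; first by rewrite mulr_ge0.
      by rewrite ler_nat (leq_trans (leq_pred _))// (leq_trans (leq_subr _ _))// ltnW.
    lra.
  have p0 : 0 <= c * (3 + U) * l%:R.
    by apply: mulr_ge0 => //; apply: mulr_ge0 => //; exact: addr_ge0.
  case: (ltngtP j k) => jk.
  - by rewrite mulr0 addr0; exact: lt.
  - rewrite mulr0 addr0 (_ : pair_sum j k = pair_sum k j); first exact: lt.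
    by apply/funext => eta; apply: eq_bigr => i _; rewrite [om _ _ * _]mulrC.
  - rewrite mulr1; apply: (le_trans (ler_normB _ _)).
    have h1 : `|expect mu (pair_sum j k)| <= 3 * c * N%:R by apply: norm_expect_le.
    have h2 : `|Q| <= 3 * c * N%:R by apply: norm_expect_le.
    lra.
apply: (@le_trans _ _ (\sum_(j < l) (l%:R * (c * (3 + U) * l%:R) + 6 * c * N%:R))).
  apply: ler_sum => j _; apply: (le_trans (ler_norm_sum _ _ _)).
  apply: (le_trans (ler_sum _ (fun k _ => bound j k))).
  rewrite big_split/= sumr_const card_ord -[_ *+ l]mulr_natl lerD2l.
  by rewrite (sum_delta l j (fun=> 6 * c * N%:R)) ltn_ord.
rewrite sumr_const card_ord -[leLHS]mulr_natl.
rewrite le_eqVlt; apply/orP; left; apply/eqP; field; rewrite ?gt_eqF//.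
Qed.

End Weight.
End Replacement.

(** * The stationary energy estimate *)

Section MainEstimate.
Context {R : realType} {N : nat}.
Hypothesis N0 : (0 < N)%N.
Variables (J : R -> R -> R) (beta rhom rhop : R).
Variables (K : R -> R -> R) (B : R).
Variables (r : nat -> R) (c0 K1 K2 K3 K4 CD : R).
Hypothesis beta01 : 0 <= beta <= 1.
Hypothesis B1 : 1 <= B.
Hypothesis K_le : forall u v, `|K u v| <= B.
Hypothesis K_lipl : forall u u' v, `|K u v - K u' v| <= B * `|u - u'|.
Hypothesis K_lipr : forall u v v', `|K u v - K u v'| <= B * `|v - v'|.
Hypothesis r01 : forall k, 0 <= r k <= 1.
Hypothesis r0 : r 0 = rhom.
Hypothesis rn : r N.*2 = rhop.
Hypothesis rlip : forall k, (k < N.*2)%N -> `|r k.+1 - r k| <= K4 / N%:R.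
Implicit Types (eta : config N) (i : 'I_(N.*2)).
Notation rate i eta := (exchange_rate J beta (bond_l i) (bond_r i) eta).
Notation om := (fluct r).

(** With [K] the derivative of [Jneum] in its first argument, this is the lattice form of the
    gradient of the convolution of the kernel with the configuration. *)
Definition drift eta (k : nat) : R :=
  N%:R^-1 * \sum_(b < N.*2.+1) K (xpos N k) (xpos N b) * occ R eta b.

Definition mean_drift (k : nat) : R :=
  N%:R^-1 * \sum_(b < N.*2.+1) K (xpos N k) (xpos N b) * r b.

Hypothesis rate_le : forall i eta, `|rate i eta - 1| <= K1 / N%:R.
Hypothesis rate_expansion : forall i eta,
  `|(rate i eta - 1) * (occ R eta i - occ R eta i.+1)
    - beta / 2 * ((occ R eta i - occ R eta i.+1) ^+ 2 * drift eta i) / N%:R|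
  <= K2 / N%:R ^+ 2.
Hypothesis profile_expansion : forall k, (k < N.*2)%N ->
  `|r k.+1 - r k - (c0 + beta / 2 * (mobility (r k) * mean_drift k)) / N%:R|
  <= K3 / N%:R ^+ 2.

Let NR0 : 0 < N%:R :> R. Proof. by rewrite ltr0n. Qed.
Let q : R := N%:R^-1.
Let q0 : 0 < q. Proof. by rewrite invr_gt0. Qed.
Let qN : q * N%:R = 1. Proof. by rewrite mulVf ?gt_eqF. Qed.
Let n0 : (0 < N.*2)%N. Proof. by rewrite double_gt0. Qed.
Let B0 : 0 <= B. Proof. exact: le_trans ler01 B1. Qed.

Let K4_ge0 : 0 <= K4.
Proof.
by have := le_trans (normr_ge0 _) (rlip n0); rewrite pmulr_lge0 ?invr_gt0.
Qed.

Let K3_ge0 : 0 <= K3.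
Proof.
by have := le_trans (normr_ge0 _) (profile_expansion n0); rewrite pmulr_lge0 ?invr_gt0 ?exprn_gt0.
Qed.

Let K2_ge0 : 0 <= K2.
Proof.
have := le_trans (normr_ge0 _) (rate_expansion (Ordinal n0) [ffun=> false]).
by rewrite pmulr_lge0 ?invr_gt0 ?exprn_gt0.
Qed.

Let K1_ge0 : 0 <= K1.
Proof.
by have := le_trans (normr_ge0 _) (rate_le (Ordinal n0) [ffun=> false]); rewrite pmulr_lge0 ?invr_gt0.
Qed.

Let jump eta (k : nat) := occ R eta k - occ R eta k.+1.

Let jump_le1 eta k : `|jump eta k| <= 1.
Proof.
by rewrite /jump; case: (occ01 (R := R) eta k) => ->; case: (occ01 (R := R) eta k.+1) => ->;
   rewrite ler_norml; lra.
Qed.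

Lemma sum_cst_bonds (c : R) : \sum_(i < N.*2) c / N%:R = 2 * c.
Proof.
rewrite sumr_const card_ord -[LHS]mulr_natl -mul2n natrM; field; rewrite ?gt_eqF//.
Qed.

(** This is the cancellation between the second-order term and the dissipation: expanding the
    squares of om_i - om_{i+1} gives the sum of om_i^2 minus the neighbour correlations, and the end
    squares have a favourable sign. Passing from occupation numbers to fluctuations costs one
    increment of r per bond. *)
Lemma sum_fluct_jump_le eta :
  2^-1 * (\sum_(i < N.*2) jump eta i ^+ 2) <=
  \sum_(k < N.*2.+1) om eta k ^+ 2 - \sum_(i < N.*2.+1) om eta i * om eta i.+1 + 3 * K4.
Proof.
have term i : jump eta i ^+ 2 <= (om eta i - om eta i.+1) ^+ 2 + 3 * K4 / N%:R.
  set d := jump eta i; set w := om eta i - om eta i.+1.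
  have E : d - w = - (r i.+1 - r i).
    by rewrite /d /w /jump /fluct (ltnW (ltn_ord i)) ltn_ord; ring.
  have h1 : `|(d - w) * (d + w)| <= K4 / N%:R * 3.
    rewrite normrM ler_pM//; first by rewrite E normrN rlip.
    apply: (le_trans (ler_normD _ _)); have -> : 3 = 1 + (1 + 1) :> R by ring.
    apply: lerD; first exact: jump_le1.
    by apply: (le_trans (ler_normB _ _)); apply: lerD; exact: fluct_le1.
  have := le_trans (ler_norm _) h1.
  have -> : d ^+ 2 = w ^+ 2 + (d - w) * (d + w) by ring.
  lra.
have h : \sum_(i < N.*2) jump eta i ^+ 2 <=
    \sum_(i < N.*2) ((om eta i - om eta i.+1) ^+ 2 + 3 * K4 / N%:R).
  by apply: ler_sum => i _; exact: term.
rewrite big_split/= sum_cst_bonds in h.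
rewrite [X in _ - X + _]big_ord_recr/= (fluct_out r eta (ltnSn _)) mulr0 addr0.
have E : \sum_(i < N.*2) (om eta i - om eta i.+1) ^+ 2 =
   2 * (\sum_(k < N.*2.+1) om eta k ^+ 2) - om eta 0 ^+ 2 - om eta N.*2 ^+ 2
   - 2 * \sum_(i < N.*2) om eta i * om eta i.+1.
  have -> : \sum_(i < N.*2) (om eta i - om eta i.+1) ^+ 2 =
     \sum_(i < N.*2) om eta i ^+ 2 + \sum_(i < N.*2) om eta i.+1 ^+ 2
     - 2 * \sum_(i < N.*2) om eta i * om eta i.+1.
    by rewrite mulr_sumr -big_split/= -sumrB; apply: eq_bigr => i _; ring.
  have e1 : \sum_(k < N.*2.+1) om eta k ^+ 2 = \sum_(i < N.*2) om eta i ^+ 2 + om eta N.*2 ^+ 2.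
    by rewrite big_ord_recr.
  have e2 : \sum_(k < N.*2.+1) om eta k ^+ 2 = om eta 0 ^+ 2 + \sum_(i < N.*2) om eta i.+1 ^+ 2.
    by rewrite big_ord_recl.
  lra.
have := sqr_ge0 (om eta 0); have := sqr_ge0 (om eta N.*2).
rewrite E in h; lra.
Qed.

Let v eta (b : nat) : R := tilt r eta b / N%:R.

Let v_le6 eta b : (b <= N.*2.+1)%N -> `|v eta b| <= 6.
Proof.
move=> bN; rewrite /v normrM normfV [`|N%:R|]ger0_norm// ler_pdivrMr//.
exact: tilt_le6.
Qed.

Let C1 : R := K1 + 1 + 3 * K4 + 12 * (K2 + K3) + 12 * `|c0|.

Hypotheses (rhom01 : 0 < rhom < 1) (rhop01 : 0 < rhop < 1).

(** The errors of order 1/N^2 in the rate and profile expansions meet a tilt of size at most 6N on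
    2N bonds, hence contribute O(1) in total. *)
Lemma generator_tilt_energy_le eta :
  generator J beta rhom rhop (tilt_energy r) eta <=
  - (\sum_(i < N.*2.+1) om eta i * om eta i.+1) + C1
  + beta / 2 * \sum_(i < N.*2) v eta i.+1 *
      (jump eta i ^+ 2 * drift eta i - mobility (r i) * mean_drift i).
Proof.
rewrite (generator_tilt_energy J beta r0 rn).
set kappa := (1 - _); have k0 : 0 <= kappa <= 1.
  have a0 : 0 <= N.*2.+2%:R^-1 :> R by rewrite invr_ge0.
  have a1 : N.*2.+2%:R^-1 <= 1 :> R by rewrite invf_le1 ?ltr0n// ler1n.
  by rewrite /kappa; move: a0 a1; set a := _^-1; lra.
have hk : kappa / 2 * (\sum_(i < N.*2) rate i eta * (occ R eta i - occ R eta i.+1) ^+ 2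
    + boundary_rate rhom (eta ord0) + boundary_rate rhop (eta ord_max)) <=
  2^-1 * (\sum_(i < N.*2) jump eta i ^+ 2) + K1 + 1.
  have s1 : \sum_(i < N.*2) rate i eta * (occ R eta i - occ R eta i.+1) ^+ 2 <=
      \sum_(i < N.*2) jump eta i ^+ 2 + 2 * K1.
    rewrite -sum_cst_bonds -big_split/=; apply: ler_sum => i _; rewrite -/(jump eta i).
    have j2 : jump eta i ^+ 2 <= 1.
      by rewrite -real_normK ?num_real// exprn_ile1.
    have h : (rate i eta - 1) * jump eta i ^+ 2 <= K1 / N%:R * 1.
      apply: (le_trans (ler_norm _)); rewrite normrM ler_pM//.
      by rewrite ger0_norm ?sqr_ge0.
    lra.
  have s0 : 0 <= \sum_(i < N.*2) rate i eta * (occ R eta i - occ R eta i.+1) ^+ 2.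
    by apply: sumr_ge0 => i _; rewrite mulr_ge0 ?sqr_ge0// ltW// rate_gt0.
  have b1 := boundary_rate_le1 (eta ord0) rhom01.
  have b2 := boundary_rate_le1 (eta ord_max) rhop01.
  have b3 := boundary_rate_gt0 (eta ord0) rhom01.
  have b4 := boundary_rate_gt0 (eta ord_max) rhop01.
  move: s0 s1; set s := (\sum_(i < _) rate i eta * _) => s0 s1.
  set X := s + _ + _; have X0 : 0 <= X by rewrite /X; lra.
  have : kappa * X <= 1 * X by apply: ler_wpM2r; lra.
  rewrite /X; lra.
have hv : \sum_(i < N.*2) tilt r eta i.+1 *
      ((rate i eta - 1) * (occ R eta i - occ R eta i.+1) - (r i.+1 - r i)) <=
   beta / 2 * (\sum_(i < N.*2) v eta i.+1 *
      (jump eta i ^+ 2 * drift eta i - mobility (r i) * mean_drift i)) +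
   12 * (K2 + K3) + 12 * `|c0|.
  have term i : tilt r eta i.+1 *
      ((rate i eta - 1) * (occ R eta i - occ R eta i.+1) - (r i.+1 - r i)) <=
    beta / 2 * (v eta i.+1 * (jump eta i ^+ 2 * drift eta i - mobility (r i) * mean_drift i))
    + 6 * (K2 + K3) / N%:R + - (c0 / N%:R) * tilt r eta i.+1.
    have h1 := rate_expansion i eta; have h2 := profile_expansion (ltn_ord i).
    set V := tilt r eta i.+1.
    have V6 : `|V| <= 6 * N%:R by apply: tilt_le6 => //; rewrite ltnS ltnW.
    rewrite -/(jump eta i) in h1 *.
    set A := (rate i eta - 1) * jump eta i in h1 *.
    set a := beta / 2 * (jump eta i ^+ 2 * drift eta i) / N%:R in h1.
    set D := r i.+1 - r i in h2 *.
    set d := (c0 + _) / N%:R in h2.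
    have h3 : V * ((A - a) - (D - d)) <= 6 * N%:R * (K2 / N%:R ^+ 2 + K3 / N%:R ^+ 2).
      apply: (le_trans (ler_norm _)); rewrite normrM ler_pM//.
      by apply: (le_trans (ler_normB _ _)); apply: lerD.
    have h4 : 6 * N%:R * (K2 / N%:R ^+ 2 + K3 / N%:R ^+ 2) = 6 * (K2 + K3) / N%:R.
      by field; rewrite ?gt_eqF.
    have h5 : V * (a - d) = beta / 2 * (v eta i.+1 *
       (jump eta i ^+ 2 * drift eta i - mobility (r i) * mean_drift i)) - c0 / N%:R * V.
      by rewrite /v /a /d -/V; field; rewrite ?gt_eqF.
    have -> : V * (A - D) = V * ((A - a) - (D - d)) + V * (a - d) by ring.
    lra.
  apply: (le_trans (ler_sum _ (fun i _ => term i))).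
  rewrite !big_split/= sum_cst_bonds -!mulr_sumr.
  (* The tilts over all cuts sum to zero, so the constant current [c0] is seen only through the two
     end cuts and contributes O(1). *)
  have S0 : \sum_(i < N.*2) tilt r eta i.+1 = - tilt r eta 0 - tilt r eta N.*2.+1.
    have := @meanK R N.*2.+2 isT (height r eta).
    by rewrite big_ord_recl big_ord_recr/= -!/(tilt r eta _); lra.
  have t0 := @tilt_le6 R N r N0 r01 eta 0 isT.
  have tn := @tilt_le6 R N r N0 r01 eta N.*2.+1 (leqnn _).
  have h6 : - (c0 / N%:R) * \sum_(i < N.*2) tilt r eta i.+1 <= 12 * `|c0|.
    rewrite S0; apply: (le_trans (ler_norm _)).
    rewrite normrM normrN normrM normfV [`|N%:R|]ger0_norm//.
    have h : `|- tilt r eta 0 - tilt r eta N.*2.+1| <= 12 * N%:R.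
      by apply: (le_trans (ler_normB _ _)); rewrite normrN; lra.
    apply: (@le_trans _ _ (`|c0| / N%:R * (12 * N%:R))).
      by apply: ler_wpM2l => //; rewrite mulr_ge0// ltW.
    by rewrite le_eqVlt; apply/orP; left; apply/eqP; field; rewrite ?gt_eqF.
  lra.
have hj := sum_fluct_jump_le eta.
rewrite /C1; lra.
Qed.

Let Psi (k : nat) eta : R := v eta k.+1 * drift eta k.

Let drift_le eta k : `|drift eta k| <= 3 * B.
Proof.
rewrite /drift normrM gtr0_norm ?invr_gt0// mulrC ler_pdivrMr//.
apply: (le_trans (ler_norm_sum _ _ _)).
apply: (@le_trans _ _ (\sum_(b < N.*2.+1) B)).
  apply: ler_sum => b _; rewrite normrM -[leRHS]mulr1 ler_pM//.
  by rewrite ger0_norm ?occ_ge0// occ_le1.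
rewrite sumr_const card_ord -[leLHS]mulr_natl [leRHS]mulrAC ler_wpM2r//.
by rewrite -natrM ler_nat leq_sites.
Qed.

Let xpos_step k : `|xpos N k.+1 - xpos N k| = q :> R.
Proof.
rewrite /xpos -mulrBl -[k.+1]addn1 natrD.
have -> : k%:R + 1 - N%:R - (k%:R - N%:R) = 1 :> R by ring.
by rewrite mul1r gtr0_norm.
Qed.

Let drift_lip eta k : `|drift eta k.+1 - drift eta k| <= 3 * B / N%:R.
Proof.
rewrite /drift -mulrBr -sumrB normrM gtr0_norm ?invr_gt0// mulrC ler_pM2r ?invr_gt0//.
apply: (le_trans (ler_norm_sum _ _ _)).
apply: (@le_trans _ _ (\sum_(b < N.*2.+1) B / N%:R)).
  apply: ler_sum => b _; rewrite -mulrBl normrM -[leRHS]mulr1 ler_pM//.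
    by apply: (le_trans (K_lipl _ _ _)); rewrite xpos_step.
  by rewrite ger0_norm ?occ_ge0// occ_le1.
rewrite sumr_const card_ord -[leLHS]mulr_natl mulrCA mulrC ler_wpM2r//.
exact: ratio_le3.
Qed.

Let drift_swap eta i k : `|drift (swap i eta) k - drift eta k| <= B / N%:R.
Proof.
rewrite /drift (sum_occ_swap _ (fun b => K (xpos N k) (xpos N b))) mulrDr addrAC subrr add0r.
rewrite ltnS (ltnW (ltn_ord i)) ltnS ltn_ord.
rewrite normrM gtr0_norm ?invr_gt0// mulrC ler_pM2r ?invr_gt0//.
rewrite normrM -[leRHS]mul1r ler_pM//; first by rewrite distrC jump_le1.
apply: (le_trans (K_lipr _ _ _)); rewrite distrC xpos_step -[leRHS]mulr1 ler_wpM2l//.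
by rewrite invf_le1// ler1n.
Qed.

Let Psi_le k eta : (k <= N.*2)%N -> `|Psi k eta| <= 18 * B.
Proof.
move=> kN; rewrite /Psi normrM (_ : 18 * B = 6 * (3 * B)); last ring.
by rewrite ler_pM// v_le6.
Qed.

Let v_step eta b : `|v eta b.+1 - v eta b| <= q.
Proof.
rewrite /v -mulrBl tilt_step normrM normrN [`|_^-1|]gtr0_norm// -[leRHS]mul1r ler_wpM2r ?(ltW q0)//.
exact: fluct_le1.
Qed.

Let v_swap eta i b : (b <= N.*2.+1)%N -> `|v (swap i eta) b - v eta b| <= q.
Proof.
move=> bN; rewrite /v -mulrBl normrM [`|_^-1|]gtr0_norm// -[leRHS]mul1r ler_wpM2r ?(ltW q0)//.
exact: tilt_swap.
Qed.

Let Psi_lip k eta : (k < N.*2)%N -> `|Psi k.+1 eta - Psi k eta| <= 21 * B / N%:R.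
Proof.
move=> kN; have -> : Psi k.+1 eta - Psi k eta = v eta k.+2 * (drift eta k.+1 - drift eta k) +
   (v eta k.+2 - v eta k.+1) * drift eta k by rewrite /Psi; ring.
apply: (le_trans (ler_normD _ _)).
have -> : 21 * B / N%:R = 6 * (3 * B / N%:R) + q * (3 * B) by rewrite /q; ring.
have h1 := v_le6 eta (kN : (k.+2 <= N.*2.+1)%N).
have h2 := drift_lip eta k; have h3 := v_step eta k.+1; have h4 := drift_le eta k.
by apply: lerD; rewrite normrM; apply: ler_pM.
Qed.

Let Psi_swap k i eta : (k <= N.*2)%N -> `|Psi k (swap i eta) - Psi k eta| <= 21 * B / N%:R.
Proof.
move=> kN; have -> : Psi k (swap i eta) - Psi k eta =
   v (swap i eta) k.+1 * (drift (swap i eta) k - drift eta k) +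
   (v (swap i eta) k.+1 - v eta k.+1) * drift eta k by rewrite /Psi; ring.
apply: (le_trans (ler_normD _ _)).
apply: (@le_trans _ _ (6 * (B / N%:R) + q * (3 * B))).
  have h1 := v_le6 (swap i eta) (kN : (k.+1 <= N.*2.+1)%N).
  have h2 := drift_swap eta i k; have h3 := v_swap eta i (kN : (k.+1 <= N.*2.+1)%N).
  have h4 := drift_le eta k.
  by apply: lerD; rewrite normrM; apply: ler_pM.
have : 0 <= B * q by rewrite mulr_ge0// ltW.
rewrite /q; lra.
Qed.

Variable l : nat.
Hypotheses (l0 : (0 < l)%N) (lN : (l <= N)%N).

Let S eta (k : nat) : R := block_avg l (om eta) k.

Let Asum eta : R := q * \sum_(k < N.*2.+1) `|S eta k|.

Definition block_energy eta : R := q * \sum_(k < N.*2.+1) S eta k ^+ 2.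

Lemma block_sum_sqr_le eta : (q * \sum_(k < N.*2.+1) `|S eta k|) ^+ 2 <= 3 * block_energy eta.
Proof.
rewrite exprMn; apply: (@le_trans _ _ (q ^+ 2 * ((N.*2.+1)%:R * \sum_(k < N.*2.+1) `|S eta k| ^+ 2))).
  by apply: ler_wpM2l; [exact: sqr_ge0|exact: sqr_sum_le].
rewrite /block_energy (eq_bigr (fun k : 'I_(N.*2.+1) => S eta k ^+ 2)); last first.
  by move=> k _; rewrite real_normK ?num_real.
have -> : q ^+ 2 * ((N.*2.+1)%:R * \sum_(k < N.*2.+1) S eta k ^+ 2) =
  ((N.*2.+1)%:R / N%:R) * (q * \sum_(k < N.*2.+1) S eta k ^+ 2) by rewrite /q; ring.
apply: ler_wpM2r; last exact: ratio_le3.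
by rewrite mulr_ge0 ?(ltW q0)// sumr_ge0// => k _; exact: sqr_ge0.
Qed.

Let S_le1 eta k : `|S eta k| <= 1.
Proof. by apply: block_avg_le1 => // j; exact: fluct_le1. Qed.

Let A_le3 eta : Asum eta <= 3.
Proof.
rewrite /Asum mulrC ler_pdivrMr//; apply: (@le_trans _ _ (\sum_(k < N.*2.+1) 1)).
  by apply: ler_sum => k _.
by rewrite sumr_const card_ord -natrM ler_nat leq_sites.
Qed.

Let t : R := l%:R / N%:R.
Let t0 : 0 <= t. Proof. by rewrite divr_ge0// ltW. Qed.
Let t1 : t <= 1. Proof. by rewrite ler_pdivrMr// mul1r ler_nat. Qed.
Let tN : N%:R * t = l%:R. Proof. by rewrite mulrC divfK// gt_eqF. Qed.
Let NA eta : N%:R * Asum eta = \sum_(k < N.*2.+1) `|S eta k|.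
Proof. by rewrite mulrA [_ * q]mulrC qN mul1r. Qed.

(** In contrast to the crude bound 6, this one is linear in the block averages; it is the factor
    that makes linear terms quadratic. *)
Let v_le eta b : (b <= N.*2.+1)%N -> `|v eta b| <= 2 * (Asum eta + 2 * t).
Proof.
move=> bN; rewrite /v normrM normfV [`|N%:R|]ger0_norm// ler_pdivrMr//.
have -> : 2 * (Asum eta + 2 * t) * N%:R = 2 * (\sum_(k < N.*2.+1) `|S eta k| + 2 * l%:R).
  by rewrite -NA -tN; ring.
apply: tilt_le => // b' b'N; apply: partial_sum_le => // k; exact: fluct_le1.
Qed.

(** The kernel varies slowly in its second argument, so the fluctuations in the field may be
    replaced by their block averages. *)
Lemma drift_diff_le eta k : `|drift eta k - mean_drift k| <= B * (Asum eta + 3 * t).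
Proof.
rewrite /drift /mean_drift -mulrBr -sumrB.
have -> : \sum_(b < N.*2.+1) (K (xpos N k) (xpos N b) * occ R eta b - K (xpos N k) (xpos N b) * r b)
   = \sum_(b < N.*2.+1) K (xpos N k) (xpos N b) * om eta b.
  by apply: eq_bigr => b _; rewrite /fluct -ltnS ltn_ord; ring.
rewrite normrM gtr0_norm// mulrC ler_pdivrMr//.
have h := @sum_block_avg_le R N N0 l l0 (fun b => K (xpos N k) (xpos N b)) (om eta) B.
have {}h : `|\sum_(b < N.*2.+1) K (xpos N k) (xpos N b) * om eta b -
   \sum_(b < N.*2.+1) K (xpos N k) (xpos N b) * S eta b| <= 3 * B * l%:R.
  apply: h => b //.
  - by move=> _; apply: (le_trans (K_lipr _ _ _)); rewrite xpos_step.
  - exact: fluct_le1.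
  - exact: fluct_out.
have h2 : `|\sum_(b < N.*2.+1) K (xpos N k) (xpos N b) * S eta b| <= B * (N%:R * Asum eta).
  apply: (le_trans (ler_norm_sum _ _ _)); rewrite NA mulr_sumr; apply: ler_sum => b _.
  by rewrite normrM ler_wpM2r.
have -> : B * (Asum eta + 3 * t) * N%:R = 3 * B * l%:R + B * (N%:R * Asum eta).
  by rewrite -tN; ring.
set X := \sum_(b < _) _ in h *; set Y := (\sum_(b < _) _) in h h2.
rewrite -(subrK Y X); apply: (le_trans (ler_normD _ _)); exact: lerD.
Qed.

Let cg : R := 21 * B + 36 * B * K4.

(** The weight in front of the fluctuations contains [v] and varies slowly. Block averaging gives
    one factor [Asum] and [v_le] a second one; remainders of the form l * [Asum] are O(l) because
    [Asum] <= 3. *)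
Let linear_term eta :
  \sum_(i < N.*2) Psi i eta * (1 - 2 * r i) * (om eta i + om eta i.+1) <=
  12 * B * (N%:R * Asum eta ^+ 2) + (72 * B + 9 * cg) * l%:R + 18 * B.
Proof.
pose g k := Psi k eta * (1 - 2 * r k).
have l1 : 1 <= l%:R :> R by rewrite ler1n.
have rr k : `|1 - 2 * r k| <= 1 by have := r01 k; rewrite ler_norml; lra.
have cg0 : 0 <= cg by rewrite addr_ge0// !mulr_ge0.
have B36 : 0 <= 36 * B * K4 by rewrite !mulr_ge0.
have g_le k : (k <= N.*2)%N -> `|g k| <= 18 * B.
  by move=> kN; rewrite /g normrM -[leRHS]mulr1 ler_pM// Psi_le.
have g_le' k : (k <= N.*2)%N -> `|g k| <= cg.
  by move=> kN; apply: (le_trans (g_le k kN)); rewrite /cg; move: B36 B0; lra.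
have g_lip k : (k < N.*2)%N -> `|g k.+1 - g k| <= cg / N%:R.
  move=> kN; have -> : g k.+1 - g k = (Psi k.+1 eta - Psi k eta) * (1 - 2 * r k.+1) +
     Psi k eta * (-2 * (r k.+1 - r k)) by rewrite /g; ring.
  have -> : cg / N%:R = 21 * B / N%:R * 1 + 18 * B * (2 * (K4 / N%:R)) by rewrite /cg; ring.
  apply: (le_trans (ler_normD _ _)); apply: lerD; rewrite normrM; apply: ler_pM => //.
  - exact: Psi_lip.
  - by apply: Psi_le; exact: ltnW.
  - by rewrite mulNr normrN normrM (ger0_norm (ler0n R 2)) ler_wpM2l// rlip.
have omle k : `|om eta k| <= 1 by exact: fluct_le1.
have omout k : (N.*2 < k)%N -> om eta k = 0 by exact: fluct_out.
have h1 := @sum_block_avg_le R N N0 l l0 g (om eta) cg g_le' g_lip omle omout.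
have h2 := @sum_shift_le R N N0 g (om eta) cg g_le' g_lip omle omout 1.
rewrite mulr1 (eq_bigr (fun i : 'I_(N.*2.+1) => g i * om eta i.+1)) in h2; last first.
  by move=> i _; rewrite addn1.
have h3 : `|\sum_(i < N.*2.+1) g i * S eta i| <=
   6 * B * (N%:R * Asum eta ^+ 2) + 36 * B * l%:R.
  apply: (@le_trans _ _ (2 * (Asum eta + 2 * t) * (3 * B) * (N%:R * Asum eta))).
    apply: (le_trans (ler_norm_sum _ _ _)); rewrite NA mulr_sumr; apply: ler_sum => k _.
    rewrite normrM ler_wpM2r// /g normrM -[leRHS]mulr1 ler_pM// /Psi normrM ler_pM//.
    by apply: v_le; rewrite ltnS -ltnS.
  have -> : 2 * (Asum eta + 2 * t) * (3 * B) * (N%:R * Asum eta) =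
     6 * B * (N%:R * Asum eta ^+ 2) + 12 * (B * (N%:R * t) * Asum eta) by ring.
  have : B * l%:R * Asum eta <= B * l%:R * 3.
    by apply: ler_wpM2l; [rewrite mulr_ge0|exact: A_le3].
  by rewrite tN; lra.
have e1 : \sum_(i < N.*2) Psi i eta * (1 - 2 * r i) * (om eta i + om eta i.+1) =
   \sum_(i < N.*2.+1) g i * om eta i - g N.*2 * om eta N.*2 + \sum_(i < N.*2.+1) g i * om eta i.+1.
  rewrite [in RHS]big_ord_recr/= [X in _ + X]big_ord_recr/= (fluct_out r eta (ltnSn _)) mulr0 addr0.
  by rewrite addrK -big_split/=; apply: eq_bigr => i _; rewrite /g; ring.
have h4 : `|g N.*2 * om eta N.*2| <= 18 * B by rewrite normrM -[leRHS]mulr1 ler_pM// g_le.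
have h5 : cg * 1 <= cg * l%:R by apply: ler_wpM2l.
move: h1 h2 h3 h4; rewrite e1 -/(S eta).
set s0 := \sum_(i < _) g i * om eta i; set s1 := \sum_(i < _) g i * om eta i.+1.
rewrite (_ : \sum_(i < N.*2.+1) g i * block_avg l (om eta) i = \sum_(i < N.*2.+1) g i * S eta i)//.
set s2 := \sum_(i < _) g i * S eta i.
rewrite !ler_norml => /andP[_ a1] /andP[_ a2] /andP[_ a3] /andP[a4 _]; lra.
Qed.

(** Both [v] and the deviation of the drift are linear in the block averages, and the mobility is at
    most 1/2. *)
Let field_term eta :
  \sum_(i < N.*2) v eta i.+1 * (mobility (r i) * (drift eta i - mean_drift i)) <=
  2 * B * (N%:R * Asum eta ^+ 2) + 42 * B * l%:R.
Proof.
apply: (@le_trans _ _ (\sum_(i < N.*2) (N%:R * (2 * (Asum eta + 2 * t) * (2^-1 * (B * (Asum eta + 3 * t)))) / N%:R))).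
  apply: ler_sum => i _; apply: (le_trans (ler_norm _)).
  rewrite [leRHS]mulrAC divff ?gt_eqF// mul1r normrM; apply: ler_pM => //; first by apply: v_le; rewrite ltnS ltnW.
  rewrite normrM; apply: ler_pM => //; last exact: drift_diff_le.
  rewrite /mobility; have := r01 i; set x := r i => /andP[x0 x1].
  rewrite ger0_norm ?mulr_ge0// ?subr_ge0//; have := sqr_ge0 (x - 2^-1); lra.
rewrite sum_cst_bonds.
have -> : 2 * (N%:R * (2 * (Asum eta + 2 * t) * (2^-1 * (B * (Asum eta + 3 * t))))) =
  2 * B * (N%:R * Asum eta ^+ 2) + 10 * (B * (N%:R * t) * Asum eta) + 12 * (B * (N%:R * t) * t).
  by field.
have : B * l%:R * Asum eta <= B * l%:R * 3.
  by apply: ler_wpM2l; [rewrite mulr_ge0|exact: A_le3].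
have : B * l%:R * t <= B * l%:R * 1 by apply: ler_wpM2l; [rewrite mulr_ge0|exact: t1].
by rewrite tN; lra.
Qed.

Let C2 : R := C1 + 66 * B + 5 * cg + 54 * B * K4.

(** After expansion about the profile, every interaction term is bounded by the block energy except
    the weighted correlations, which are kept for [block_replacement]. *)
Lemma generator_tilt_energy_block_le eta :
  generator J beta rhom rhop (tilt_energy r) eta <=
  - (\sum_(i < N.*2.+1) om eta i * om eta i.+1)
  - beta * (\sum_(i < N.*2.+1) Psi i eta * (om eta i * om eta i.+1))
  + 21 * beta * B * (N%:R * block_energy eta) + C2 * l%:R.
Proof.
have /andP[be0 be1] := beta01.
have l1 : 1 <= l%:R :> R by rewrite ler1n.
apply: (le_trans (generator_tilt_energy_le eta)).
have term i : v eta i.+1 * (jump eta i ^+ 2 * drift eta i - mobility (r i) * mean_drift i) <=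
   Psi i eta * (1 - 2 * r i) * (om eta i + om eta i.+1)
   - 2 * (Psi i eta * (om eta i * om eta i.+1))
   + v eta i.+1 * (mobility (r i) * (drift eta i - mean_drift i)) + 54 * B * K4 / N%:R.
  set e := r i.+1 - r i.
  have e_le : `|e| <= K4 / N%:R by exact: rlip.
  (* Occupation numbers equal their squares, so the squared jump is occ + occ' - 2 occ occ'. Its
     value at the profile is the mobility; [e] collects the change of r across the bond. *)
  have E : jump eta i ^+ 2 = (1 - 2 * r i) * (om eta i + om eta i.+1) - 2 * (om eta i * om eta i.+1)
     + mobility (r i) + e * (1 - 2 * r i - 2 * om eta i).
    rewrite /mobility /e /jump /fluct (ltnW (ltn_ord i)) ltn_ord.
    by case: (occ01 (R := R) eta i) => ->; case: (occ01 (R := R) eta i.+1) => ->; ring.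
  have -> : v eta i.+1 * (jump eta i ^+ 2 * drift eta i - mobility (r i) * mean_drift i) =
     Psi i eta * (1 - 2 * r i) * (om eta i + om eta i.+1)
   - 2 * (Psi i eta * (om eta i * om eta i.+1))
   + v eta i.+1 * (mobility (r i) * (drift eta i - mean_drift i))
   + Psi i eta * (e * (1 - 2 * r i - 2 * om eta i)).
    by rewrite E /Psi; ring.
  rewrite lerD2l; apply: (le_trans (ler_norm _)); rewrite normrM.
  have -> : 54 * B * K4 / N%:R = 18 * B * (K4 / N%:R * 3) by ring.
  apply: ler_pM => //; first by apply: Psi_le; exact: ltnW.
  rewrite normrM; apply: ler_pM => //.
  have := r01 i; have := fluct_le1 r01 eta i; rewrite !ler_norml; lra.
have h : \sum_(i < N.*2) v eta i.+1 *
      (jump eta i ^+ 2 * drift eta i - mobility (r i) * mean_drift i) <=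
    \sum_(i < N.*2) (Psi i eta * (1 - 2 * r i) * (om eta i + om eta i.+1)
   - 2 * (Psi i eta * (om eta i * om eta i.+1))
   + v eta i.+1 * (mobility (r i) * (drift eta i - mean_drift i)) + 54 * B * K4 / N%:R).
  by apply: ler_sum => i _; exact: term.
rewrite !big_split/= sum_cst_bonds sumrN -mulr_sumr in h.
have h1 := linear_term eta; have h2 := field_term eta.
have h3 := block_sum_sqr_le eta; rewrite -/(Asum eta) in h3.
have NA2 : N%:R * Asum eta ^+ 2 <= 3 * (N%:R * block_energy eta).
  by rewrite [leRHS]mulrCA; apply: ler_wpM2l => //; exact: ltW.
rewrite [X in - (beta * X)]big_ord_recr/= (fluct_out r eta (ltnSn _)) !mulr0 addr0.
move: h h1 h2.
set s0 := \sum_(i < N.*2) v eta i.+1 * (jump eta i ^+ 2 * drift eta i - _).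
set s1 := \sum_(i < N.*2) Psi i eta * (1 - 2 * r i) * _.
set s2 := \sum_(i < N.*2) Psi i eta * (om eta i * om eta i.+1).
set s3 := \sum_(i < N.*2) v eta i.+1 * (mobility (r i) * _).
set s4 := \sum_(i < N.*2.+1) om eta i * om eta i.+1.
move=> h h1 h2.
(* Here 42 = 3 * (12 + 2): the linear and field terms give 12 and 2, and [block_sum_sqr_le] gives 3.
   The factor beta/2 then leaves 21 beta B. *)
have h4 : s0 <= 42 * B * (N%:R * block_energy eta) - 2 * s2 + (114 * B + 9 * cg) * l%:R + 18 * B + 108 * B * K4.
  have : B * (N%:R * Asum eta ^+ 2) <= B * (3 * (N%:R * block_energy eta)) by exact: ler_wpM2l.
  lra.
have h5 : beta / 2 * s0 <= beta / 2 * (42 * B * (N%:R * block_energy eta) - 2 * s2 + (114 * B + 9 * cg) * l%:R + 18 * B + 108 * B * K4).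
  by apply: ler_wpM2l => //; lra.
have cg0 : 0 <= cg by rewrite addr_ge0// !mulr_ge0.
have X0 : 0 <= (114 * B + 9 * cg) * l%:R + 18 * B + 108 * B * K4.
  by rewrite !addr_ge0 ?mulr_ge0 ?addr_ge0 ?mulr_ge0.
have h6 : beta / 2 * ((114 * B + 9 * cg) * l%:R + 18 * B + 108 * B * K4) <=
   2^-1 * ((114 * B + 9 * cg) * l%:R + 18 * B + 108 * B * K4).
  by apply: ler_wpM2r => //; lra.
have C10 : 0 <= C1 by rewrite /C1 !addr_ge0 ?mulr_ge0 ?addr_ge0.
have h7 : C1 * 1 <= C1 * l%:R by apply: ler_wpM2l.
have h8 : B * 1 <= B * l%:R by apply: ler_wpM2l.
have h9 : (54 * B * K4) * 1 <= (54 * B * K4) * l%:R by apply: ler_wpM2l => //; rewrite !mulr_ge0.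
have h10 : cg * 1 <= cg * l%:R by apply: ler_wpM2l.
rewrite /C2; lra.
Qed.

Variable mu : config N -> R.
Hypothesis muinv : invariant_prob (@generator R J beta rhom rhop N) mu.
Hypothesis dirCD : \sum_(i < N.*2) dirichlet mu i <= CD / N%:R.
Hypothesis beta_small : beta * (90 * B) <= 1.

(** The generator has mean zero, so the mean of its upper bound is nonnegative. [block_replacement]
    enters twice: with weight 1 it bounds the block energy by the correlations, and with weight
    [Psi] it bounds the weighted correlations by 18 B times the block energy. *)
Lemma expect_block_energy_le : expect mu block_energy <=
  2 * ((1 + 21 * B) * (19 + CD + 3 * K4) + C2) * (l%:R / N%:R + l%:R^-1).
Proof.
have muP : is_prob mu by case: muinv.
have /andP[be0 be1] := beta01.
have lR0 : 0 < l%:R :> R by rewrite ltr0n.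
have st : expect mu (generator J beta rhom rhop (tilt_energy r)) = 0.
  exact: (stationarity rhom01 rhop01 muinv).
set Y := expect mu block_energy.
set Q1 := expect mu (fun eta => \sum_(i < N.*2.+1) om eta i * om eta i.+1).
set QP := expect mu (fun eta => \sum_(i < N.*2.+1) Psi i eta * (om eta i * om eta i.+1)).
have main : Q1 + beta * QP <= 21 * beta * B * (N%:R * Y) + C2 * l%:R.
  have bnd eta : generator J beta rhom rhop (tilt_energy r) eta <=
      - 1 * (\sum_(i < N.*2.+1) om eta i * om eta i.+1) +
      (- beta * (\sum_(i < N.*2.+1) Psi i eta * (om eta i * om eta i.+1)) +
      (21 * beta * B * N%:R * block_energy eta + C2 * l%:R)).
    by apply: (le_trans (generator_tilt_energy_block_le eta)); lra.
  have := ler_expect muP bnd; rewrite st !expectD expect_cst//.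
  rewrite (expectZ mu (- 1)) (expectZ mu (- beta)) (expectZ mu (21 * beta * B * N%:R) block_energy) -/Q1 -/QP -/Y; lra.
have CD0 : 0 <= CD.
  have : 0 <= CD / N%:R.
    by apply: le_trans dirCD; apply: sumr_ge0 => i _; apply: sumr_ge0 => eta _; exact: sqr_ge0.
  by rewrite pmulr_lge0 ?invr_gt0.
set W := (3 + (CD + 10 + 3 * K4)) * l%:R + 6 * N%:R / l%:R.
have R1 : N%:R * Y - Q1 <= W.
  have H : `|expect mu (fun eta => \sum_(i < N.*2.+1) 1 * block_avg l (om eta) i ^+ 2)
      - expect mu (fun eta => \sum_(i < N.*2.+1) 1 * (om eta i * om eta i.+1))| <= 1 * W.
    apply: (@block_replacement R N N0 mu muP r K4 CD r01 rlip dirCD (fun _ _ => 1) 1) => //.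
    - by move=> *; rewrite normr1.
    - by move=> *; rewrite subrr normr0 mul1r ltW.
    - by move=> *; rewrite subrr normr0 mul1r ltW.
  have E1 : N%:R * Y = expect mu (fun eta => \sum_(i < N.*2.+1) 1 * block_avg l (om eta) i ^+ 2).
    rewrite /Y -expectZ; apply: eq_expect => eta; rewrite /block_energy mulrA [_ * q]mulrC qN mul1r.
    by apply: eq_bigr => i _; rewrite mul1r.
  have E2 : Q1 = expect mu (fun eta => \sum_(i < N.*2.+1) 1 * (om eta i * om eta i.+1)).
    by apply: eq_expect => eta; apply: eq_bigr => i _; rewrite mul1r.
  by rewrite E1 E2 -[W]mul1r; exact: le_trans (ler_norm _) H.
have R2 : - QP <= 18 * B * (N%:R * Y) + 21 * B * W.
  have H := @block_replacement R N N0 mu muP r K4 CD r01 rlip dirCD Psi (21 * B).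
  have {}H : `|expect mu (fun eta => \sum_(i < N.*2.+1) Psi i eta * block_avg l (om eta) i ^+ 2) - QP|
      <= 21 * B * W.
    apply: H => // k eta kN; apply: (le_trans (Psi_le eta kN)); move: B0; lra.
  have h : - expect mu (fun eta => \sum_(i < N.*2.+1) Psi i eta * block_avg l (om eta) i ^+ 2) <=
     18 * B * (N%:R * Y).
    have NY : N%:R * Y = expect mu (fun eta => \sum_(k < N.*2.+1) S eta k ^+ 2).
      by rewrite /Y -expectZ; apply: eq_expect => eta; rewrite /block_energy mulrA [_ * q]mulrC qN mul1r.
    rewrite NY -(expectZ mu (18 * B)) -[leLHS]mulN1r -(expectZ mu (- 1)).
    apply: ler_expect => // eta; rewrite !mulr_sumr; apply: ler_sum => k _.
    rewrite mulrA mulN1r; apply: ler_wpM2r; first exact: sqr_ge0.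
    by apply: (le_trans (ler_norm _)); rewrite normrN; apply: Psi_le; rewrite -ltnS.
  move: H; rewrite ler_norml => /andP[_ H]; lra.
have Y0 : 0 <= N%:R * Y.
  rewrite mulr_ge0 ?(ltW NR0)//; apply: sumr_ge0 => eta _.
  rewrite mulr_ge0 ?muP.1// mulr_ge0 ?(ltW q0)// sumr_ge0// => k _; exact: sqr_ge0.
have bQ : beta * - QP <= beta * (18 * B * (N%:R * Y) + 21 * B * W) by exact: ler_wpM2l.
have W0 : 0 <= W by rewrite /W !addr_ge0 ?mulr_ge0 ?addr_ge0 ?mulr_ge0 ?invr_ge0.
have bW : beta * (21 * B * W) <= 1 * (21 * B * W) by apply: ler_wpM2r => //; rewrite !mulr_ge0.
(* The right side of the closed inequality contains (21 + 18) beta B times N * Y, less than half of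
   the left side; absorbing it produces the factor 2. *)
have bY : beta * (90 * B) * (N%:R * Y) <= 1 * (N%:R * Y) by exact: ler_wpM2r.
have final : N%:R * Y <= 2 * ((1 + 21 * B) * W + C2 * l%:R) by lra.
have -> : l%:R / N%:R + l%:R^-1 = (l%:R + N%:R / l%:R) / N%:R :> R.
  by field; rewrite ?gt_eqF.
rewrite mulrA ler_pdivlMr// mulrC; apply: (le_trans final).
rewrite -[leRHS]mulrA ler_pM2l// [leRHS]mulrDl.
have C10 : 0 <= C1 by rewrite /C1 !addr_ge0 ?mulr_ge0 ?addr_ge0.
have cg0 : 0 <= cg by rewrite addr_ge0// !mulr_ge0.
have BK : 0 <= 54 * B * K4 by rewrite !mulr_ge0.
have C20 : 0 <= C2 by rewrite /C2; move: B0 C10 cg0 BK; lra.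
have z0 : 0 <= N%:R / l%:R :> R by rewrite divr_ge0.
apply: lerD.
  rewrite -[leRHS]mulrA; apply: ler_wpM2l; first by rewrite addr_ge0// mulr_ge0.
  have : 0 <= (CD + 10 + 3 * K4 + 3) * (N%:R / l%:R) by rewrite mulr_ge0 ?addr_ge0 ?mulr_ge0.
  have : 0 <= 6 * l%:R :> R by rewrite mulr_ge0.
  rewrite /W; lra.
by apply: ler_wpM2l => //; rewrite lerDl.
Qed.

End MainEstimate.

(** * Kernels *)

Section Calculus.
Context {R : realType}.

Lemma mean_value (f df : R -> R) (a b : R) :
  (forall x : R, is_derive x 1 f (df x)) ->
  exists2 c, `|c - a| <= `|b - a| & f b - f a = df c * (b - a).
Proof.
move=> fd.
have cf i : {within [set` i : interval R], continuous f}.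
  by apply: derivable_within_continuous => x _; have [] := fd x.
have [ab|ba] := leP a b.
  have [c] := MVT_segment ab (fun x _ => fd x) (cf _).
  rewrite in_itv/= => /andP[ac cb] ->; exists c => //.
  by rewrite !ger0_norm ?subr_ge0// lerB.
have [c] := MVT_segment (ltW ba) (fun x _ => fd x) (cf _).
rewrite in_itv/= => /andP[bc ca] E; exists c.
  by rewrite !ler0_norm ?subr_le0 ?(ltW ba)// !opprB lerB.
by rewrite -[LHS]opprB E; ring.
Qed.

Lemma lipschitz_of_derive (f df : R -> R) (B : R) :
  (forall x : R, is_derive x 1 f (df x)) -> (forall x, `|df x| <= B) ->
  forall a b, `|f a - f b| <= B * `|a - b|.
Proof.
move=> fd fB a b; have [c _ ->] := mean_value b a fd.
by rewrite normrM ler_wpM2r.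
Qed.

Lemma taylor_of_derive (f df : R -> R) (B : R) :
  (forall x : R, is_derive x 1 f (df x)) -> (forall a b, `|df a - df b| <= B * `|a - b|) ->
  forall a b, `|f b - f a - df a * (b - a)| <= B * (b - a) ^+ 2.
Proof.
move=> fd dfl a b; have [c ca ->] := mean_value a b fd.
rewrite -mulrBl normrM -[(b - a) ^+ 2]real_normK ?num_real// expr2 mulrA ler_wpM2r//.
apply: (le_trans (dfl _ _)); apply: ler_wpM2l => //.
have := le_trans (normr_ge0 _) (dfl 1 0); rewrite subr0 normr1 mulr1//.
Qed.

Lemma bounded_of_support (f : R -> R) : continuous f ->
  (forall u, 1 < `|u| -> f u = 0) -> exists2 B, 0 <= B & forall u, `|f u| <= B.
Proof.
move=> cf f0.
have cn : {within `[(-1 : R), 1], continuous (fun u => `|f u|)}.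
  by apply: continuous_subspaceT => u; apply: continuous_comp; [exact: cf|exact: norm_continuous].
have [|c _ H] := EVT_max _ cn; first by lra.
exists `|f c| => // u; have [h|h] := leP `|u| 1.
  by apply: H; rewrite in_itv/= -ler_norml.
by rewrite f0// normr0.
Qed.

Lemma derive1_support (f : R -> R) : (forall u, 1 < `|u| -> f u = 0) ->
  forall u, 1 < `|u| -> derive1 f u = 0.
Proof.
move=> f0 u u1; rewrite derive1E (@near_eq_derive _ _ _ f (cst 0)) ?derive_cst//.
have : \forall x \near u, 1 < `|x|.
  have cu : (fun x : R => `|x|) @ u --> `|u| by exact: norm_continuous.
  exact: (cvgr_gt _ cu).
by apply: filterS => x; exact: f0.
Qed.

End Calculus.

(** [K] is the derivative of [Jneum J] in its first argument, as [kd_taylor] expresses with a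
    uniform error. The later estimates see the regularity of [J] only through this interface and the
    single constant [B]. *)
Record kernel_data (R : realType) (J K : R -> R -> R) (B : R) : Prop := KernelData {
  kd_ge1 : 1 <= B;
  kd_le : forall u v, `|K u v| <= B;
  kd_lipl : forall u u' v, `|K u v - K u' v| <= B * `|u - u'|;
  kd_lipr : forall u v v', `|K u v - K u v'| <= B * `|v - v'|;
  kd_sym : forall u v, Jneum J u v = Jneum J v u;
  kd_Jle : forall u v, `|Jneum J u v| <= B;
  kd_Jlip : forall u u' v, `|Jneum J u v - Jneum J u' v| <= B * `|u - u'|;
  kd_taylor : forall u h v,
    `|Jneum J (u + h) v - Jneum J u v - h * K u v| <= B * h ^+ 2
}.

(** By translation invariance the kernel and its two reflections are j(w - u) with w = v, 2 - v, -2
    - v and j = J 0. Compact support bounds j and its first two derivatives, uniformly in w.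
    Symmetry holds because j is even and the reflected arguments are symmetric in u and v. The
    factor 3 counts the images; adding 1 ensures B >= 1. *)
Lemma kernel_data_exists (R : realType) (J : R -> R -> R) : is_kernel J ->
  exists K B, kernel_data J K B.
Proof.
move=> HJ; have sm := kernel_smooth HJ.
pose j : R -> R := J 0; pose j1 : R -> R := derive1 j; pose j2 : R -> R := derive1 j1.
have diffw w (v : R) : derivable (fun v => partials w J 0 v) v 1.
  apply/derivable1_diffP.
  rewrite (_ : (fun v => _) = (fun q : R * R => partials w J q.1 q.2) \o (fun v => (0, v)))//.
  by apply: differentiable_comp; [exact: differentiable_pair|exact: sm].
have dj (u : R) : is_derive u 1 j (j1 u).
  by split; [exact: (diffw [::])|rewrite /j1 derive1E].
have dj1 (u : R) : is_derive u 1 j1 (j2 u).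
  by split; [exact: (diffw [:: true])|rewrite /j2 derive1E].
have cj2 : continuous j2.
  by move=> u; apply: differentiable_continuous; apply/derivable1_diffP; exact: (diffw [:: true; true]).
have cj1 : continuous j1.
  by move=> u; apply: differentiable_continuous; apply/derivable1_diffP; exact: (diffw [:: true]).
have j0 u : 1 < `|u| -> j u = 0 by exact: kernel_range.
have j10 := derive1_support j0; have j20 := derive1_support j10.
have cj : continuous j.
  by move=> u; apply: differentiable_continuous; apply/derivable1_diffP; exact: (diffw [::]).
have [b0 b00 B0] := bounded_of_support cj j0.
have [b1 b10 B1] := bounded_of_support cj1 j10.
have [b2 b20 B2] := bounded_of_support cj2 j20.
have jl := lipschitz_of_derive dj B1; have j1l := lipschitz_of_derive dj1 B2.
have jt := taylor_of_derive dj j1l.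
have jev u : j (- u) = j u.
  by rewrite /j (kernel_sym HJ) (kernel_transl HJ) sub0r opprK.
have Jn u v : Jneum J u v = j (v - u) + j (2 - v - u) + j (- 2 - v - u).
  by rewrite /Jneum !(kernel_transl HJ u).
exists (fun u v => - (j1 (v - u) + j1 (2 - v - u) + j1 (- 2 - v - u))), (3 * (b0 + b1 + b2) + 1).
have norm3 a b c (x y z : R) : `|x| <= a -> `|y| <= b -> `|z| <= c -> `|x + y + z| <= a + b + c.
  move=> ha hb hc; apply: (le_trans (ler_normD _ _)); apply: lerD => //.
  by apply: (le_trans (ler_normD _ _)); apply: lerD.
split.
- lra.
- move=> u v; rewrite normrN; apply: (le_trans (norm3 _ _ _ _ _ _ (B1 _) (B1 _) (B1 _))); lra.
- move=> u u' v.
  have -> : - (j1 (v - u) + j1 (2 - v - u) + j1 (- 2 - v - u)) -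
      - (j1 (v - u') + j1 (2 - v - u') + j1 (- 2 - v - u')) =
    (j1 (v - u') - j1 (v - u)) + (j1 (2 - v - u') - j1 (2 - v - u)) +
    (j1 (- 2 - v - u') - j1 (- 2 - v - u)) by ring.
  have h w : `|j1 (w - u') - j1 (w - u)| <= b2 * `|u - u'|.
    by apply: (le_trans (j1l _ _)); rewrite (_ : w - u' - (w - u) = u - u')//; ring.
  apply: (le_trans (norm3 _ _ _ _ _ _ (h v) (h (2 - v)) (h (- 2 - v)))).
  have := normr_ge0 (u - u'); set z := `|_| => z0.
  have : 0 <= b0 * z by rewrite mulr_ge0.
  have : 0 <= b1 * z by rewrite mulr_ge0.
  lra.
- move=> u v v'.
  have -> : - (j1 (v - u) + j1 (2 - v - u) + j1 (- 2 - v - u)) -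
      - (j1 (v' - u) + j1 (2 - v' - u) + j1 (- 2 - v' - u)) =
    (j1 (v' - u) - j1 (v - u)) + (j1 (2 - v' - u) - j1 (2 - v - u)) +
    (j1 (- 2 - v' - u) - j1 (- 2 - v - u)) by ring.
  have h1 : `|j1 (v' - u) - j1 (v - u)| <= b2 * `|v - v'|.
    by apply: (le_trans (j1l _ _)); rewrite (_ : v' - u - (v - u) = - (v - v')) ?normrN//; ring.
  have h w : `|j1 (w - v' - u) - j1 (w - v - u)| <= b2 * `|v - v'|.
    by apply: (le_trans (j1l _ _)); rewrite (_ : w - v' - u - (w - v - u) = v - v')//; ring.
  apply: (le_trans (norm3 _ _ _ _ _ _ h1 (h 2) (h (- 2)))).
  have := normr_ge0 (v - v'); set z := `|_| => z0.
  have : 0 <= b0 * z by rewrite mulr_ge0.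
  have : 0 <= b1 * z by rewrite mulr_ge0.
  lra.
- move=> u v; rewrite !Jn -(jev (u - v)) opprB.
  by congr (_ + _ + _); congr j; ring.
- by move=> u v; rewrite Jn; apply: (le_trans (norm3 _ _ _ _ _ _ (B0 _) (B0 _) (B0 _))); lra.
- move=> u u' v; rewrite !Jn.
  have -> : j (v - u) + j (2 - v - u) + j (- 2 - v - u) -
      (j (v - u') + j (2 - v - u') + j (- 2 - v - u')) =
    (j (v - u) - j (v - u')) + (j (2 - v - u) - j (2 - v - u')) +
    (j (- 2 - v - u) - j (- 2 - v - u')) by ring.
  have h w : `|j (w - u) - j (w - u')| <= b1 * `|u - u'|.
    by apply: (le_trans (jl _ _)); rewrite (_ : w - u - (w - u') = - (u - u')) ?normrN//; ring.
  apply: (le_trans (norm3 _ _ _ _ _ _ (h v) (h (2 - v)) (h (- 2 - v)))).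
  have := normr_ge0 (u - u'); set z := `|_| => z0.
  have : 0 <= b0 * z by rewrite mulr_ge0.
  have : 0 <= b2 * z by rewrite mulr_ge0.
  lra.
- move=> u h v; rewrite !Jn.
  have H w : `|j (w - (u + h)) - j (w - u) + h * j1 (w - u)| <= b2 * h ^+ 2.
    have := jt (w - u) (w - (u + h)).
    rewrite (_ : w - (u + h) - (w - u) = - h); last by ring.
    by rewrite sqrrN mulrN opprK [j1 _ * _]mulrC.
  have -> : j (v - (u + h)) + j (2 - v - (u + h)) + j (- 2 - v - (u + h)) -
    (j (v - u) + j (2 - v - u) + j (- 2 - v - u)) -
    h * - (j1 (v - u) + j1 (2 - v - u) + j1 (- 2 - v - u)) =
    (j (v - (u + h)) - j (v - u) + h * j1 (v - u)) +
    (j (2 - v - (u + h)) - j (2 - v - u) + h * j1 (2 - v - u)) +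
    (j (- 2 - v - (u + h)) - j (- 2 - v - u) + h * j1 (- 2 - v - u)) by ring.
  apply: (le_trans (norm3 _ _ _ _ _ _ (H v) (H (2 - v)) (H (- 2 - v)))).
  have := sqr_ge0 h; set z := h ^+ 2 => z0.
  have : 0 <= b0 * z by rewrite mulr_ge0.
  have : 0 <= b1 * z by rewrite mulr_ge0.
  lra.
Qed.

(** * Expansion of the exchange rates *)

Section RateExpansion.
Context {R : realType} {N : nat}.
Hypothesis N0 : (0 < N)%N.
Variables (J K : R -> R -> R) (B beta : R).
Hypothesis HK : kernel_data J K B.
Hypothesis beta01 : 0 <= beta <= 1.
Implicit Types (eta : config N) (i : 'I_(N.*2)).
Notation rate i eta := (exchange_rate J beta (bond_l i) (bond_r i) eta).
Notation x k := (xpos N k : R).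

Let NR0 : 0 < N%:R :> R. Proof. by rewrite ltr0n. Qed.
Let q : R := N%:R^-1.
Let q0 : 0 < q. Proof. by rewrite invr_gt0. Qed.
Let q1 : q <= 1. Proof. by rewrite invf_le1// ler1n. Qed.
Let B0 : 0 <= B. Proof. exact: le_trans ler01 (kd_ge1 HK). Qed.

Lemma xposS k : xpos N k.+1 = x k + q.
Proof. by rewrite /xpos -[k.+1]addn1 natrD /q; field; rewrite ?gt_eqF. Qed.

Let G eta (a : nat) : R := \sum_(b < N.*2.+1) Jneum J (x a) (x b) * occ R eta b.

Let hamiltonianE eta : hamiltonian J eta =
  - 2^-1 * (q * \sum_(a < N.*2.+1) G eta a * occ R eta a).
Proof.
rewrite /hamiltonian; congr (_ * _); rewrite mulr_sumr; apply: eq_bigr => a _.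
rewrite mulrA mulr_sumr mulr_suml; apply: eq_bigr => b _.
by rewrite !occE /macro -!/(xpos N _) -/q; ring.
Qed.

(** An exact expansion: the Hamiltonian is a quadratic form and the swap adds d at i and -d at i+1.
    The first term contains the increment of the local field, close to [drift]; the second
    difference of the kernel is O(1/N). *)
Lemma hamiltonian_swap i eta (d := occ R eta i.+1 - occ R eta i) :
  hamiltonian J (swap i eta) - hamiltonian J eta =
  - (q * d * (G eta i - G eta i.+1)) - 2^-1 * (q * d ^+ 2 *
    (Jneum J (x i) (x i) - 2 * Jneum J (x i) (x i.+1) + Jneum J (x i.+1) (x i.+1))).
Proof.
have iN := ltn_ord i.
have Gs a : G (swap i eta) a = G eta a + d * (Jneum J (x a) (x i) - Jneum J (x a) (x i.+1)).
  rewrite /G (sum_occ_swap _ (fun b => Jneum J (x a) (x b))) ltnS (ltnW iN) ltnS iN.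
  by [].
rewrite !hamiltonianE.
rewrite (sum_occ_swap _ (fun a => G (swap i eta) a)) ltnS (ltnW iN) ltnS iN.
rewrite (eq_bigr (fun a : 'I_(N.*2.+1) => G eta a * occ R eta a +
  d * (Jneum J (x i) (x a) * occ R eta a) - d * (Jneum J (x i.+1) (x a) * occ R eta a))); last first.
  by move=> a _; rewrite Gs (kd_sym HK (x a) (x i)) (kd_sym HK (x a) (x i.+1)); ring.
rewrite sumrB big_split/= -!mulr_sumr -!/(G _ _) !Gs -/d (kd_sym HK (x i.+1) (x i)).
by field.
Qed.

Let jump eta (k : nat) := occ R eta k - occ R eta k.+1.

Let jump_le1 eta k : `|jump eta k| <= 1.
Proof.
by rewrite /jump; case: (occ01 (R := R) eta k) => ->; case: (occ01 (R := R) eta k.+1) => ->;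
   rewrite ler_norml; lra.
Qed.

Let drift_err i eta : `|(G eta i.+1 - G eta i) - drift K eta i| <= 3 * B * q.
Proof.
rewrite /G /drift mulr_sumr -!sumrB; apply: (le_trans (ler_norm_sum _ _ _)).
apply: (@le_trans _ _ (\sum_(b < N.*2.+1) B * q ^+ 2)).
  apply: ler_sum => b _; rewrite xposS mulrA -!mulrBl normrM -[leRHS]mulr1; apply: ler_pM => //.
    exact: (kd_taylor HK).
  by rewrite ger0_norm ?occ_ge0// occ_le1.
rewrite sumr_const card_ord -[leLHS]mulr_natl.
have -> : (N.*2.+1)%:R * (B * q ^+ 2) = (N.*2.+1)%:R / N%:R * (B * q) by rewrite /q; ring.
by rewrite -[leRHS]mulrA; apply: ler_wpM2r; [rewrite mulr_ge0 ?(ltW q0)|exact: ratio_le3].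
Qed.

Let second_diff i : `|Jneum J (x i) (x i) - 2 * Jneum J (x i) (x i.+1)
   + Jneum J (x i.+1) (x i.+1)| <= 2 * B * q.
Proof.
have -> : Jneum J (x i) (x i) - 2 * Jneum J (x i) (x i.+1) + Jneum J (x i.+1) (x i.+1)
  = (Jneum J (x i) (x i) - Jneum J (x i.+1) (x i)) -
    (Jneum J (x i) (x i.+1) - Jneum J (x i.+1) (x i.+1)).
  by rewrite (kd_sym HK (x i.+1) (x i)); ring.
have h v : `|Jneum J (x i) v - Jneum J (x i.+1) v| <= B * q.
  apply: (le_trans (kd_Jlip HK _ _ _)); rewrite xposS.
  have -> : x i - (x i + q) = - q by ring.
  by rewrite normrN gtr0_norm.
apply: (le_trans (ler_normB _ _)); have := h (x i); have := h (x i.+1); lra.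
Qed.

Let expo i eta : R := - (beta / 2) * (hamiltonian J (swap i eta) - hamiltonian J eta).

Let expo_main i eta :
  `|expo i eta - beta / 2 * (jump eta i * drift K eta i) / N%:R| <= 2 * B / N%:R ^+ 2.
Proof.
have /andP[be0 be1] := beta01.
rewrite /expo hamiltonian_swap.
set X := (_ - 2 * _ + _); set D := drift K eta i; set j := jump eta i.
have -> : occ R eta i.+1 - occ R eta i = - j by rewrite /j /jump; ring.
have -> : - (beta / 2) * (- (q * - j * (G eta i - G eta i.+1)) - 2^-1 * (q * (- j) ^+ 2 * X)) -
   beta / 2 * (j * D) / N%:R =
   beta / 2 * q * (j * ((G eta i.+1 - G eta i) - D) + 2^-1 * (j * j * X)).
  by rewrite -/q; field.
have -> : 2 * B / N%:R ^+ 2 = 2^-1 * q * (4 * B * q) by rewrite /q; field; rewrite ?gt_eqF.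
have j1 := jump_le1 eta i; rewrite -/j in j1.
rewrite normrM; apply: ler_pM => //.
  rewrite ger0_norm; last by rewrite !mulr_ge0// ltW.
  by rewrite ler_wpM2r ?(ltW q0)//; lra.
apply: (le_trans (ler_normD _ _)).
have h1 : `|j * ((G eta i.+1 - G eta i) - D)| <= 1 * (3 * B * q).
  by rewrite normrM ler_pM//; exact: drift_err.
have h2 : `|2^-1 * (j * j * X)| <= 2^-1 * (1 * 1 * (2 * B * q)).
  rewrite normrM ger0_norm ?invr_ge0// ler_wpM2l ?invr_ge0//.
  by rewrite normrM ler_pM//; [rewrite normrM ler_pM|exact: second_diff].
lra.
Qed.

Let drift_le3 i eta : `|drift K eta i| <= 3 * B.
Proof.
rewrite /drift normrM gtr0_norm// mulrC ler_pdivrMr//.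
apply: (le_trans (ler_norm_sum _ _ _)).
apply: (@le_trans _ _ (\sum_(b < N.*2.+1) B)).
  apply: ler_sum => b _; rewrite normrM -[leRHS]mulr1 ler_pM//; first exact: (kd_le HK).
  by rewrite ger0_norm ?occ_ge0// occ_le1.
rewrite sumr_const card_ord -[leLHS]mulr_natl [leRHS]mulrAC ler_wpM2r//.
by rewrite -natrM ler_nat leq_sites.
Qed.

Let expo_le i eta : `|expo i eta| <= 4 * B / N%:R.
Proof.
have /andP[be0 be1] := beta01.
rewrite -[X in `|X|](subrK (beta / 2 * (jump eta i * drift K eta i) / N%:R)).
apply: (le_trans (ler_normD _ _)).
have h1 := expo_main i eta.
have h2 : `|beta / 2 * (jump eta i * drift K eta i) / N%:R| <= 2^-1 * (1 * (3 * B)) / N%:R.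
  rewrite normrM [`|_^-1|]gtr0_norm// ler_wpM2r ?(ltW q0)// normrM ler_pM//.
    by rewrite ger0_norm; lra.
  by rewrite normrM ler_pM.
have h3 : 2 * B / N%:R ^+ 2 <= 2 * B / N%:R.
  apply: ler_wpM2l; first by rewrite mulr_ge0.
  by rewrite expr2 invfM -/q; apply: ler_piMl => //; exact: ltW.
have : 0 <= B / N%:R by rewrite mulr_ge0// ltW.
lra.
Qed.

Let expo_exp i eta : expR `|expo i eta| <= expR (4 * B).
Proof.
rewrite ler_expR; apply: (le_trans (expo_le i eta)).
by rewrite ler_piMr// mulr_ge0.
Qed.

Lemma exchange_rate_le i eta : `|rate i eta - 1| <= 4 * B * expR (4 * B) / N%:R.
Proof.
rewrite mulrAC; apply: (le_trans (norm_expRB1_le (expo i eta))).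
by apply: ler_pM => //; exact: expR_ge0.
Qed.

(** The rate minus 1 equals its exponent up to the square of the exponent, and the exponent is
    beta/2 * jump * drift / N up to O(1/N^2). The outer factor turns the jump into its square. *)
Lemma exchange_rate_expansion i eta :
  `|(rate i eta - 1) * (occ R eta i - occ R eta i.+1)
    - beta / 2 * ((occ R eta i - occ R eta i.+1) ^+ 2 * drift K eta i) / N%:R|
  <= (16 * B ^+ 2 * expR (4 * B) + 2 * B) / N%:R ^+ 2.
Proof.
rewrite -/(jump eta i); set j := jump eta i.
have j1 : `|j| <= 1 := jump_le1 eta i.
set C := exchange_rate _ _ _ _ _.
have -> : (C - 1) * j - beta / 2 * (j ^+ 2 * drift K eta i) / N%:R =
  ((C - 1 - expo i eta) + (expo i eta - beta / 2 * (j * drift K eta i) / N%:R)) * j by ring.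
rewrite normrM -[leRHS]mulr1; apply: ler_pM => //.
apply: (le_trans (ler_normD _ _)); rewrite [leRHS]mulrDl; apply: lerD; last exact: expo_main.
apply: (le_trans (norm_expRB1D_le (expo i eta))).
have -> : 16 * B ^+ 2 * expR (4 * B) / N%:R ^+ 2 = (4 * B / N%:R) ^+ 2 * expR (4 * B).
  by field; rewrite ?gt_eqF.
apply: ler_pM => //; first exact: sqr_ge0.
by apply: sqr_le_norm; exact: expo_le.
Qed.

End RateExpansion.

(** * Primitives of bounded measurable functions *)

Section BoundedMeasurable.
Context {R : realType}.
Local Notation leb := (@lebesgue_measure R).

(** Bounded measurable functions on the whole line form an algebra and are integrable on every
    bounded interval, which discharges the integrability conditions below. *)
Definition bmeas (f : R -> R) : Prop :=
  measurable_fun [set: R] f /\ exists M, forall u, `|f u| <= M.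

Lemma bmeas_cst c : bmeas (fun=> c).
Proof. by split; [exact: measurable_cst|exists `|c|]. Qed.

Lemma bmeasD f g : bmeas f -> bmeas g -> bmeas (fun u => f u + g u).
Proof.
move=> [mf [M fM]] [mg [M' gM]]; split; first exact: measurable_funD.
by exists (M + M') => u; apply: (le_trans (ler_normD _ _)); exact: lerD.
Qed.

Lemma bmeasM f g : bmeas f -> bmeas g -> bmeas (fun u => f u * g u).
Proof.
move=> [mf [M fM]] [mg [M' gM]]; split; first exact: measurable_funM.
by exists (M * M') => u; rewrite normrM ler_pM.
Qed.

Lemma bmeasZ c f : bmeas f -> bmeas (fun u => c * f u).
Proof. by move=> hf; apply: bmeasM => //; exact: bmeas_cst. Qed.

Lemma bmeasB f g : bmeas f -> bmeas g -> bmeas (fun u => f u - g u).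
Proof.
move=> hf hg; have := bmeasD hf (bmeasZ (-1) hg).
by congr bmeas; apply/funext => u; rewrite mulN1r.
Qed.

Lemma bmeas_continuous f : continuous f -> (exists M, forall u, `|f u| <= M) -> bmeas f.
Proof. by move=> cf bf; split => //; exact: continuous_measurable_fun. Qed.

Lemma lipschitz_continuous (f : R -> R) (L : R) :
  (forall u v, `|f u - f v| <= L * `|u - v|) -> continuous f.
Proof.
move=> fL u; apply/cvgrPdist_le => /= e e0.
have L0 : 0 <= L.
  by have := le_trans (normr_ge0 _) (fL 1 0); rewrite subr0 normr1 mulr1.
have L1 : 0 < L + 1 by lra.
near=> t; apply: (le_trans (fL _ _)).
apply: (@le_trans _ _ ((L + 1) * `|u - t|)); first by rewrite ler_wpM2r//; lra.
rewrite mulrC -ler_pdivlMr//; near: t.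
by apply: cvgr_dist_le => //; rewrite divr_gt0.
Unshelve. all: by end_near.
Qed.

Lemma bmeas_lipschitz f L : (forall u v, `|f u - f v| <= L * `|u - v|) ->
  (exists M, forall u, `|f u| <= M) -> bmeas f.
Proof. by move=> fL; apply: bmeas_continuous; exact: lipschitz_continuous fL. Qed.

Lemma bmeas_integrable f (A : set R) : bmeas f -> measurable A -> (leb A < +oo)%E ->
  leb.-integrable A (EFin \o f).
Proof.
move=> [mf [M fM]] mA Afin; apply: measurable_bounded_integrable => //.
  exact: measurable_funTS.
exists M; split; first exact: num_real.
by move=> x Mx y _ /=; exact: le_trans (fM y) (ltW Mx).
Qed.

Lemma itv_measure_fin (a b : itv_bound R) (x y : R) :
  a = BLeft x \/ a = BRight x -> b = BLeft y \/ b = BRight y ->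
  (leb [set` Interval a b] < +oo)%E.
Proof.
by move=> [] -> [] ->; rewrite lebesgue_measure_itv/=; case: ifP => _ //; rewrite -EFinB ltry.
Qed.

(** Half-open intervals make increments additive; [prim f 1] is the integral over [Lambda]. *)
Definition prim (f : R -> R) (u : R) : R := \int[leb]_(t in `]-1, u]) f t.

Lemma prim_integrable f u : bmeas f -> leb.-integrable `]-1, u] (EFin \o f).
Proof.
by move=> bf; apply: bmeas_integrable => //; apply: itv_measure_fin; right.
Qed.

Lemma Lambda_measure : leb (Lambda R) = 2%:E.
Proof.
rewrite /Lambda lebesgue_measure_itv/= lte_fin ifT; last by lra.
by rewrite -EFinD; congr EFin; ring.
Qed.

Lemma Lambda_measurable : measurable (Lambda R).
Proof. exact: measurable_itv. Qed.

Lemma Lambda_fin : (leb (Lambda R) < +oo)%E.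
Proof. by rewrite Lambda_measure ltry. Qed.

Lemma Lambda_integrable f : bmeas f -> leb.-integrable (Lambda R) (EFin \o f).
Proof.
by move=> bf; apply: bmeas_integrable => //; [exact: Lambda_measurable|exact: Lambda_fin].
Qed.

Lemma integral_Lambda f : bmeas f -> \int[leb]_(t in Lambda R) f t = prim f 1.
Proof. by move=> bf; apply: Rintegral_itv_bndo_bndc; exact: Lambda_integrable. Qed.

Lemma primB f g u : bmeas f -> bmeas g -> prim (fun t => f t - g t) u = prim f u - prim g u.
Proof. by move=> bf bg; apply: RintegralB => //; exact: prim_integrable. Qed.

Lemma primD f g u : bmeas f -> bmeas g -> prim (fun t => f t + g t) u = prim f u + prim g u.
Proof. by move=> bf bg; apply: RintegralD => //; exact: prim_integrable. Qed.

Lemma primZ c f u : bmeas f -> prim (fun t => c * f t) u = c * prim f u.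
Proof. by move=> bf; apply: RintegralZl => //; exact: prim_integrable. Qed.

Lemma integral_ocitv_le f (a b c D : R) : bmeas f -> a <= b ->
  (forall t, a < t <= b -> `|f t - c| <= D) ->
  `|\int[leb]_(t in `]a, b]) f t - c * (b - a)| <= D * (b - a).
Proof.
move=> bf ab fc.
have mi : measurable (`]a, b]%classic : set R) by exact: measurable_itv.
have fi : (leb `]a, b] < +oo)%E by apply: itv_measure_fin; right.
have len d : \int[leb]_(t in `]a, b]) d = d * (b - a).
  have E : leb `]a, b] = (b - a)%:E.
    rewrite lebesgue_measure_itv/= lte_fin; move: ab; rewrite le_eqVlt => /orP[/eqP ->|ab].
      by rewrite ltxx subrr.
    by rewrite ab -EFinB.
  transitivity (d * fine (leb `]a, b])); [exact: Rintegral_cst|by rewrite E].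
rewrite -(len c) -RintegralB//; last 2 first.
- exact: bmeas_integrable.
- by apply: bmeas_integrable => //; exact: bmeas_cst.
have bfc : bmeas (fun t => f t - c) by apply: bmeasB => //; exact: bmeas_cst.
apply: (le_trans (le_normr_Rintegral _ _)) => //; first exact: bmeas_integrable.
rewrite -(len D); apply: le_Rintegral => //.
- apply: bmeas_integrable => //; split; last by case: bfc => _ [M h]; exists M => u; rewrite normr_id.
  by apply: measurableT_comp => //; case: bfc.
- by apply: bmeas_integrable => //; exact: bmeas_cst.
Qed.

Lemma prim_sub f a b : bmeas f -> -1 <= a -> a <= b ->
  prim f b - prim f a = \int[leb]_(t in `]a, b]) f t.
Proof.
by move=> bf a1 ab; apply: Rintegral_itvB; [exact: prim_integrable|rewrite bnd_simp|rewrite bnd_simp].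
Qed.

Lemma prim_approx f (a b c D : R) : bmeas f -> -1 <= a -> a <= b ->
  (forall t, a < t <= b -> `|f t - c| <= D) ->
  `|prim f b - prim f a - c * (b - a)| <= D * (b - a).
Proof. by move=> bf a1 ab fc; rewrite prim_sub//; exact: integral_ocitv_le. Qed.

Lemma prim_le f (u D : R) : bmeas f -> -1 <= u ->
  (forall t, -1 < t <= u -> `|f t| <= D) -> `|prim f u| <= D * (u + 1).
Proof.
move=> bf u1 fD; have := @integral_ocitv_le f (-1) u 0 D bf u1.
rewrite mul0r subr0 opprK; apply => t /fD; by rewrite subr0.
Qed.

Lemma prim_diff_le f g (u D : R) : bmeas f -> bmeas g -> -1 <= u ->
  (forall t, -1 < t <= u -> `|f t - g t| <= D) -> `|prim f u - prim g u| <= D * (u + 1).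
Proof. by move=> bf bg u1 fg; rewrite -primB//; apply: prim_le => //; exact: bmeasB. Qed.

Lemma Rintegral_ae (A : set R) f g : measurable A -> A `<=` Lambda R ->
  measurable_fun A f -> measurable_fun A g ->
  {ae leb, forall t, Lambda R t -> f t = g t} ->
  \int[leb]_(t in A) f t = \int[leb]_(t in A) g t.
Proof.
move=> mA AL mf mg fg; congr fine; apply: ae_eq_integral => //.
- exact/measurable_EFinP.
- exact/measurable_EFinP.
move: fg; apply: filterS; first exact: (ae_filter_ringOfSetsType leb).
by move=> t /= h At; congr EFin; apply: h; exact: AL.
Qed.

Lemma prim_ae f g u : u <= 1 ->
  {ae leb, forall t, Lambda R t -> f t = g t} -> bmeas f -> bmeas g -> prim f u = prim g u.
Proof.
move=> u1 fg bf bg; have [mf _] := bf; have [mg _] := bg.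
move: u1; rewrite le_eqVlt => /orP[/eqP ->|u1].
  rewrite -!integral_Lambda//; apply: Rintegral_ae => //; [exact: Lambda_measurable|..];
  exact: measurable_funTS.
apply: Rintegral_ae => //; [|exact: measurable_funTS..].
by move=> t /=; rewrite /Lambda/= !in_itv/= => /andP[-> h]; rewrite (le_lt_trans h).
Qed.

Lemma prim_left f : prim f (-1) = 0.
Proof. by rewrite /prim set_itvoc0 ?Rintegral_set0. Qed.

(** The retraction onto [-1,1]. Composition with it turns a function known only on [-1,1] into one
    on the whole line with the same bounds. *)
Definition clampi (u : R) : R := Num.max (-1) (Num.min 1 u).

Lemma clampi_itv u : -1 <= clampi u <= 1.
Proof. by rewrite /clampi le_max lexx/= ge_max ge_min lexx/= andbT; lra. Qed.

Lemma clampi_id u : -1 <= u <= 1 -> clampi u = u.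
Proof. by move=> /andP[u1 u2]; rewrite /clampi min_r// max_r. Qed.

Lemma norm_max_sub (a x y : R) : `|Num.max a x - Num.max a y| <= `|x - y|.
Proof.
have h1 := ler_norm (x - y); have h2 : y - x <= `|x - y| by rewrite distrC ler_norm.
by case: (leP a x) => hx; case: (leP a y) => hy; rewrite ler_norml; lra.
Qed.

Lemma norm_min_sub (a x y : R) : `|Num.min a x - Num.min a y| <= `|x - y|.
Proof.
have h1 := ler_norm (x - y); have h2 : y - x <= `|x - y| by rewrite distrC ler_norm.
by case: (leP a x) => hx; case: (leP a y) => hy; rewrite ler_norml; lra.
Qed.

Lemma clampi_lip u v : `|clampi u - clampi v| <= `|u - v|.
Proof. exact: le_trans (norm_max_sub _ _ _) (norm_min_sub _ _ _). Qed.

End BoundedMeasurable.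

(** * The integral operator of the stationary problem *)

Section Operator.
Context {R : realType}.
Variables (J K : R -> R -> R) (B : R).
Hypothesis HK : kernel_data J K B.
Implicit Types rho : R -> R.

Definition cl01 (r : R) : R := Num.max 0 (Num.min 1 r).

Lemma cl01_itv r : 0 <= cl01 r <= 1.
Proof. by rewrite /cl01 le_max lexx/= ge_max ge_min lexx/= andbT; lra. Qed.

Lemma cl01_id r : 0 <= r <= 1 -> cl01 r = r.
Proof. by move=> /andP[r0 r1]; rewrite /cl01 min_r// max_r. Qed.

Lemma cl01_lip r s : `|cl01 r - cl01 s| <= `|r - s|.
Proof. exact: le_trans (norm_max_sub _ _ _) (norm_min_sub _ _ _). Qed.

Definition sig (r : R) : R := mobility (cl01 r).

Lemma sig_le r : `|sig r| <= 2^-1.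
Proof.
rewrite /sig /mobility; have /andP[] := cl01_itv r; set x := cl01 r => x0 x1.
have h : 0 <= x * (1 - x) by rewrite mulr_ge0// subr_ge0.
rewrite ger0_norm; first by have := sqr_ge0 (x - 2^-1); lra.
by rewrite -mulrA mulr_ge0.
Qed.

Lemma sig_lip r s : `|sig r - sig s| <= 2 * `|r - s|.
Proof.
rewrite /sig /mobility; apply: (@le_trans _ _ (2 * `|cl01 r - cl01 s|)); last first.
  by rewrite ler_wpM2l// cl01_lip.
have /andP[] := cl01_itv r; have /andP[] := cl01_itv s.
set x := cl01 r; set y := cl01 s => y0 y1 x0 x1.
have -> : 2 * x * (1 - x) - 2 * y * (1 - y) = 2 * (x - y) * (1 - x - y) by ring.
rewrite normrM normrM ger0_norm// -[leRHS]mulr1 ler_wpM2l ?mulr_ge0//.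
by rewrite ler_norml; lra.
Qed.

(** The gradient of the convolution of [Jneum] with the density, truncated to [0,1] so that it is
    bounded for every measurable argument. *)
Definition field (rho : R -> R) (u : R) : R := prim (fun v => K u v * cl01 (rho v)) 1.

Definition src (rho : R -> R) (u : R) : R := sig (rho u) * field rho u.

Let B0 : 0 <= B. Proof. exact: le_trans ler01 (kd_ge1 HK). Qed.

Lemma bmeas_kernel u : bmeas (K u).
Proof.
apply: (@bmeas_lipschitz _ _ B); first exact: (kd_lipr HK).
by exists B; exact: (kd_le HK).
Qed.

Lemma bmeas_cl01 rho : measurable_fun setT rho -> bmeas (fun u => cl01 (rho u)).
Proof.
move=> mr; split; last by exists 1 => u; have := cl01_itv (rho u); rewrite ler_norml; lra.
apply: (measurableT_comp _ mr); apply: continuous_measurable_fun.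
by apply: (@lipschitz_continuous _ _ 1) => r s; rewrite mul1r cl01_lip.
Qed.

Lemma bmeas_sig rho : measurable_fun setT rho -> bmeas (fun u => sig (rho u)).
Proof.
move=> mr; split; last by exists 2^-1 => u; exact: sig_le.
apply: (measurableT_comp _ mr); apply: continuous_measurable_fun.
exact: (@lipschitz_continuous _ _ 2 sig_lip).
Qed.

Lemma bmeas_field_integrand rho u : measurable_fun setT rho ->
  bmeas (fun v => K u v * cl01 (rho v)).
Proof. by move=> mr; apply: bmeasM; [exact: bmeas_kernel|exact: bmeas_cl01]. Qed.

Let cl01_norm r : `|cl01 r| <= 1.
Proof. by have := cl01_itv r; rewrite ler_norml; lra. Qed.

Let p11 : -1 <= 1 :> R. Proof. lra. Qed.

Lemma field_le rho u : measurable_fun setT rho -> `|field rho u| <= 2 * B.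
Proof.
move=> mr; rewrite (_ : 2 * B = B * (1 + 1)); last ring.
apply: prim_le => //; first exact: bmeas_field_integrand.
by move=> t _; rewrite normrM -[leRHS]mulr1 ler_pM//; exact: (kd_le HK).
Qed.

Lemma field_lip rho u v : measurable_fun setT rho ->
  `|field rho u - field rho v| <= 2 * B * `|u - v|.
Proof.
move=> mr; rewrite (_ : 2 * B * `|u - v| = B * `|u - v| * (1 + 1)); last ring.
apply: prim_diff_le => //; [exact: bmeas_field_integrand..|].
move=> t _; rewrite -mulrBl normrM -[leRHS]mulr1 ler_pM//; exact: (kd_lipl HK).
Qed.

Lemma field_diff rho rho' (M : R) u : measurable_fun setT rho -> measurable_fun setT rho' ->
  (forall t, `|rho t - rho' t| <= M) -> `|field rho u - field rho' u| <= 2 * B * M.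
Proof.
move=> mr mr' rM; rewrite (_ : 2 * B * M = B * M * (1 + 1)); last ring.
apply: prim_diff_le => //; [exact: bmeas_field_integrand..|].
move=> t _; rewrite -mulrBr normrM ler_pM//; first exact: (kd_le HK).
exact: le_trans (cl01_lip _ _) (rM t).
Qed.

Lemma bmeas_field rho : measurable_fun setT rho -> bmeas (field rho).
Proof.
move=> mr; apply: (@bmeas_lipschitz _ _ (2 * B)); first by move=> u v; exact: field_lip.
by exists (2 * B) => u; exact: field_le.
Qed.

Lemma bmeas_src rho : measurable_fun setT rho -> bmeas (src rho).
Proof. by move=> mr; apply: bmeasM; [exact: bmeas_sig|exact: bmeas_field]. Qed.

Lemma src_le rho u : measurable_fun setT rho -> `|src rho u| <= B.
Proof.
move=> mr; rewrite /src normrM (_ : B = 2^-1 * (2 * B)); last by field.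
by apply: ler_pM => //; [exact: sig_le|exact: field_le].
Qed.

Lemma src_diff rho rho' (M : R) u : measurable_fun setT rho -> measurable_fun setT rho' ->
  (forall t, `|rho t - rho' t| <= M) -> `|src rho u - src rho' u| <= 5 * B * M.
Proof.
move=> mr mr' rM.
have -> : src rho u - src rho' u = (sig (rho u) - sig (rho' u)) * field rho u +
   sig (rho' u) * (field rho u - field rho' u) by rewrite /src; ring.
have -> : 5 * B * M = 2 * M * (2 * B) + 2^-1 * (2 * B * M) by field.
apply: (le_trans (ler_normD _ _)); apply: lerD; rewrite normrM; apply: ler_pM => //.
- by apply: (le_trans (sig_lip _ _)); rewrite ler_wpM2l.
- exact: field_le.
- exact: sig_le.
- exact: field_diff.
Qed.

Lemma src_lip rho (L : R) u v : measurable_fun setT rho ->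
  `|rho u - rho v| <= L * `|u - v| ->
  `|src rho u - src rho v| <= (4 * B * L + B) * `|u - v|.
Proof.
move=> mr rL.
have -> : src rho u - src rho v = (sig (rho u) - sig (rho v)) * field rho u +
   sig (rho v) * (field rho u - field rho v) by rewrite /src; ring.
have -> : (4 * B * L + B) * `|u - v| = 2 * (L * `|u - v|) * (2 * B) + 2^-1 * (2 * B * `|u - v|).
  by field.
apply: (le_trans (ler_normD _ _)); apply: lerD; rewrite normrM; apply: ler_pM => //.
- by apply: (le_trans (sig_lip _ _)); rewrite ler_wpM2l.
- exact: field_le.
- exact: sig_le.
- exact: field_lip.
Qed.

Lemma src_ae rho rho' : measurable_fun setT rho -> measurable_fun setT rho' ->
  {ae lebesgue_measure, forall u, Lambda R u -> rho u = rho' u} ->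
  forall u, u <= 1 -> prim (src rho) u = prim (src rho') u.
Proof.
move=> mr mr' rr u u1; apply: prim_ae => //; [|exact: bmeas_src..].
have ff v : field rho v = field rho' v.
  apply: prim_ae => //; [|exact: bmeas_field_integrand..].
  move: rr; apply: filterS; first exact: (ae_filter_ringOfSetsType lebesgue_measure).
  by move=> t h /h ->.
move: rr; apply: filterS; first exact: (ae_filter_ringOfSetsType lebesgue_measure).
by move=> t h /h; rewrite /src ff => ->.
Qed.

Variables (beta rhom rhop : R).
Hypothesis rhom01 : 0 < rhom < 1.
Hypothesis rhop01 : 0 < rhop < 1.
Hypothesis beta0 : 0 <= beta.
Hypothesis beta_small : beta * (90 * B) <= 1.

(** The integration constant of the once-integrated equation, chosen so that [picard] takes the
    value [rhop] at 1. *)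
Definition slope (rho : R -> R) : R := (rhop - rhom - beta / 2 * prim (src rho) 1) / 2.

(** The equation integrated twice. Through [clampi] the result is constant outside [-1,1], so the
    contraction holds in the supremum norm of the line. *)
Definition picard (rho : R -> R) (u : R) : R :=
  rhom + slope rho * (clampi u + 1) + beta / 2 * prim (src rho) (clampi u).

Lemma picard_left rho : picard rho (-1) = rhom.
Proof. by rewrite /picard clampi_id ?prim_left; [ring|lra]. Qed.

Lemma picard_right rho : picard rho 1 = rhop.
Proof. by rewrite /picard clampi_id; [rewrite /slope; field|lra]. Qed.

(** The sources differ by 5BM, their primitives over length 2 by 10BM, and the change of the slope
    adds as much again. The factor beta/2 gives 10 beta B M, below M/2 by [beta_small]. *)
Lemma picard_diff rho rho' (M : R) : measurable_fun setT rho -> measurable_fun setT rho' ->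
  (forall t, `|rho t - rho' t| <= M) ->
  forall t, `|picard rho t - picard rho' t| <= 2^-1 * M.
Proof.
move=> mr mr' rM t.
have M0 : 0 <= M by exact: le_trans (rM 0).
have BM : 0 <= B * M by rewrite mulr_ge0.
have H u : -1 <= u <= 1 -> `|prim (src rho) u - prim (src rho') u| <= 10 * B * M.
  move=> /andP[u1 u2]; apply: (@le_trans _ _ (5 * B * M * (u + 1))).
    apply: prim_diff_le => //; [exact: bmeas_src..|].
    by move=> s _; exact: src_diff.
  have : B * M * (u + 1) <= B * M * 2 by rewrite ler_wpM2l//; lra.
  lra.
have /andP[c1 c2] := clampi_itv t; set u := clampi t in c1 c2 *.
rewrite /picard -/u.
have h1 : `|prim (src rho) u - prim (src rho') u| <= 10 * B * M by apply: H; rewrite c1.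
have h2 : `|prim (src rho) 1 - prim (src rho') 1| <= 10 * B * M by apply: H; rewrite p11/=.
set a := prim (src rho) u in h1 *; set a' := prim (src rho') u in h1 *.
rewrite /slope; set b := prim (src rho) 1 in h2 *; set b' := prim (src rho') 1 in h2 *.
have -> : rhom + (rhop - rhom - beta / 2 * b) / 2 * (u + 1) + beta / 2 * a -
   (rhom + (rhop - rhom - beta / 2 * b') / 2 * (u + 1) + beta / 2 * a') =
   beta / 2 * ((a - a') - (b - b') * ((u + 1) / 2)) by field.
rewrite normrM ger0_norm; last by rewrite mulr_ge0.
have h3 : `|(b - b') * ((u + 1) / 2)| <= 10 * B * M * 1.
  by rewrite normrM ler_pM// ger0_norm; lra.
have h4 : `|(a - a') - (b - b') * ((u + 1) / 2)| <= 20 * B * M.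
  by apply: (le_trans (ler_normB _ _)); lra.
apply: (@le_trans _ _ (beta / 2 * (20 * B * M))); first by rewrite ler_wpM2l// mulr_ge0.
have := ler_wpM2r M0 beta_small; lra.
Qed.

Let beta1 : beta <= 1.
Proof.
apply: le_trans beta_small; rewrite ler_peMr//.
by have := kd_ge1 HK; lra.
Qed.

Lemma prim_src_le rho u : measurable_fun setT rho -> -1 <= u <= 1 ->
  `|prim (src rho) u| <= 2 * B.
Proof.
move=> mr /andP[u1 u2]; apply: (@le_trans _ _ (B * (u + 1))).
  by apply: prim_le => //; [exact: bmeas_src|move=> t _; exact: src_le].
by rewrite [leRHS]mulrC ler_wpM2l//; lra.
Qed.

Lemma slope_le rho : measurable_fun setT rho -> `|slope rho| <= 1 + B.
Proof.
have b1 := beta1; have Bp := B0; have bp := beta0; have rm := rhom01; have rp := rhop01.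
move=> mr; have := @prim_src_le rho 1 mr; rewrite p11 lexx => /(_ isT).
rewrite /slope; set p := prim _ _ => hp.
have h : `|beta / 2 * p| <= 2^-1 * (2 * B).
  by rewrite normrM ler_pM// ger0_norm; lra.
move: h; rewrite !ler_norml; lra.
Qed.

Lemma picard_lip rho : measurable_fun setT rho ->
  forall u v, `|picard rho u - picard rho v| <= (1 + 2 * B) * `|u - v|.
Proof.
have b1 := beta1; have Bp := B0; have bp := beta0; have rm := rhom01; have rp := rhop01.
move=> mr u v; apply: (@le_trans _ _ ((1 + 2 * B) * `|clampi u - clampi v|)); last first.
  by rewrite ler_wpM2l ?clampi_lip//; lra.
rewrite /picard; have := clampi_itv u; have := clampi_itv v.
move: (clampi u) (clampi v) => {u v}.
suff H a b : -1 <= a -> a <= b ->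
   `|(rhom + slope rho * (b + 1) + beta / 2 * prim (src rho) b) -
     (rhom + slope rho * (a + 1) + beta / 2 * prim (src rho) a)| <= (1 + 2 * B) * (b - a).
  move=> u v /andP[v1 v2] /andP[u1 u2]; have [uv|vu] := leP u v.
    by rewrite distrC (@ler0_norm _ (u - v)) ?subr_le0// opprB; apply: H.
  by rewrite (@gtr0_norm _ (u - v)) ?subr_gt0//; apply: H => //; exact: ltW.
move=> a1 ab.
set A := prim (src rho) a; set C := prim (src rho) b.
have -> : rhom + slope rho * (b + 1) + beta / 2 * C - (rhom + slope rho * (a + 1) + beta / 2 * A)
  = slope rho * (b - a) + beta / 2 * (C - A) by ring.
have h : `|C - A| <= B * (b - a).
  have := @prim_approx _ (src rho) a b 0 B (bmeas_src mr) a1 ab.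
  by rewrite mul0r subr0; apply => t _; rewrite subr0 src_le.
have ba : 0 <= b - a by rewrite subr_ge0.
apply: (le_trans (ler_normD _ _)).
have h1 : `|slope rho * (b - a)| <= (1 + B) * (b - a).
  by rewrite normrM (ger0_norm ba) ler_wpM2r// slope_le.
have h2 : `|beta / 2 * (C - A)| <= 2^-1 * (B * (b - a)).
  by rewrite normrM ler_pM// ger0_norm; lra.
have : 0 <= B * (b - a) by rewrite mulr_ge0.
lra.
Qed.

Lemma picard_bounded rho : measurable_fun setT rho ->
  forall u, `|picard rho u| <= 3 + 4 * B.
Proof.
have Bp := B0; have rm := rhom01.
move=> mr u.
have -> : picard rho u = picard rho (clampi u).
  by rewrite /picard (clampi_id (clampi_itv u)).
rewrite -(subrK (picard rho (-1)) (picard rho (clampi u))).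
apply: (le_trans (ler_normD _ _)); rewrite {2}picard_left.
have h := picard_lip mr (clampi u) (-1).
have h2 : `|clampi u - -1| <= 2 by have := clampi_itv u; rewrite ler_norml; lra.
have h3 : (1 + 2 * B) * `|clampi u - -1| <= (1 + 2 * B) * 2 by rewrite ler_wpM2l//; lra.
have : `|rhom| <= 1 by rewrite ler_norml; lra.
lra.
Qed.

Lemma bmeas_picard rho : measurable_fun setT rho -> bmeas (picard rho).
Proof.
move=> mr; apply: (bmeas_lipschitz (picard_lip mr)).
by exists (3 + 4 * B); exact: picard_bounded.
Qed.

(** The operator sees only the almost-everywhere class of its argument but returns a true function;
    this upgrades an almost-everywhere fixed point to a genuine one. *)
Lemma picard_ae rho rho' : measurable_fun setT rho -> measurable_fun setT rho' ->
  {ae lebesgue_measure, forall u, Lambda R u -> rho u = rho' u} ->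
  picard rho =1 picard rho'.
Proof.
move=> mr mr' rr u; have H := src_ae mr mr' rr.
have /andP[_ c1] := clampi_itv u.
by rewrite /picard /slope !H.
Qed.

End Operator.

(** * The stationary profile *)

Section Auxiliary.
Context {R : realType}.

Lemma le0_of_geometric (x C : R) : (forall n, x <= C * 2^-1 ^+ n) -> x <= 0.
Proof.
move=> H.
have cv : geometric C (2^-1 : R) @ \oo --> (0 : R).
  by apply: cvg_geometric; rewrite ger0_norm ?invr_ge0// invf_lt1//; lra.
rewrite -(cvg_lim _ cv)//; apply: limr_ge; first by apply/cvg_ex; exists 0.
by near=> n; exact: H.
Unshelve. all: by end_near.
Qed.

Lemma half_powS (c : R) n : 2 * c * 2^-1 ^+ n.+1 = c * 2^-1 ^+ n.
Proof. by rewrite exprS; field. Qed.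

Lemma is_derive_of_quadratic (f : R -> R) (u l C d : R) : 0 < d ->
  (forall h, `|h| <= d -> `|f (u + h) - f u - h * l| <= C * h ^+ 2) ->
  is_derive u (1 : R) f l.
Proof.
move=> d0 H.
have C0 : 0 <= C.
  have dd : `|d| <= d by rewrite gtr0_norm.
  by have := le_trans (normr_ge0 _) (H d dd); rewrite pmulr_lge0// exprn_gt0.
have cv : (fun h : R => h^-1 *: (f (h *: (1 : R) + u) - f u)) @ 0^' --> l.
  apply/cvgrPdist_le => /= e e0.
  have C1 : 0 < C + 1 by lra.
  near=> h.
  have h0 : h != 0 by near: h; exact: nbhs_dnbhs_neq.
  have hd : `|h| <= d.
    near: h; apply: dnbhs0_le => //.
  have he : `|h| <= e / (C + 1).
    by near: h; apply: dnbhs0_le; rewrite divr_gt0.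
  have -> : l - h^-1 *: (f (h *: (1 : R) + u) - f u) = - (h^-1 * (f (u + h) - f u - h * l)).
    by rewrite /GRing.scale/= mulr1 [h + u]addrC; field.
  rewrite normrN normrM normfV mulrC ler_pdivrMr ?normr_gt0//.
  apply: (le_trans (H h hd)); rewrite -[h ^+ 2]real_normK ?num_real// expr2 mulrA.
  apply: ler_wpM2r => //; apply: (@le_trans _ _ ((C + 1) * `|h|)).
    by rewrite ler_wpM2r//; lra.
  by rewrite mulrC -ler_pdivlMr.
apply: DeriveDef; first by apply/cvg_ex; exists l.
exact: cvg_lim cv.
Unshelve. all: by end_near.
Qed.

(* Adding e * u gives f a nonzero slope wherever it is negative, so a negative
   interior minimum is impossible. *)
Lemma nonneg_of_slope (f df : R -> R) (c : R) :
  (forall u : R, -1 < u < 1 -> is_derive u (1 : R) f (df u)) ->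
  continuous f -> 0 <= f (-1) -> 0 <= f 1 ->
  (forall u : R, -1 < u < 1 -> f u < 0 -> df u = c) ->
  forall u, -1 <= u <= 1 -> 0 <= f u.
Proof.
move=> fd cf f0 f1 fc u0 /andP[u1 u2]; rewrite leNgt; apply/negP => fu0.
(* Of two candidates at most one can equal -c. The bound on e keeps f negative at the minimum of g,
   since the interval has length 2 and hence f t0 <= f u0 / 2. *)
have [e [e0 em ce]] : exists e, [/\ 0 < e, e <= - f u0 / 4 & c + e != 0].
  have [h|h] := eqVneq (c + - f u0 / 4) 0; last by exists (- f u0 / 4); split => //; lra.
  exists (- f u0 / 8); split; [lra|lra|]; apply/eqP => h'; lra.
pose g u := f u + e * u.
have cg : {within `[(-1 : R), 1], continuous g}.
  apply: continuous_subspaceT => u; apply: cvgD; first exact: cf.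
  by apply: cvgM; [exact: cvg_cst|exact: cvg_id].
have [|t0 t0I tmin] := EVT_min _ cg; first by lra.
move: (t0I); rewrite in_itv/= => /andP[t1 t2].
have ft0 : f t0 < 0.
  have := tmin u0; rewrite in_itv/= u1 u2 => /(_ isT); rewrite /g => h.
  have : e * (u0 - t0) <= e * 2 by rewrite ler_wpM2l ?(ltW e0)//; lra.
  lra.
have t1' : -1 < t0 by rewrite lt_neqAle t1 andbT; apply/eqP => E; move: f0; rewrite E leNgt ft0.
have t2' : t0 < 1 by rewrite lt_neqAle t2 andbT; apply/eqP => E; move: f1; rewrite -E leNgt ft0.
have gd (u : R) : -1 < u < 1 -> is_derive u (1 : R) g (df u + e).
  move=> uI; have fdu := fd u uI.
  by apply: is_derive_eq; rewrite /GRing.scale/= mulr1.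
have E : is_derive t0 (1 : R) g 0.
  apply: (@derive1_at_min _ g (-1) 1 t0); first by lra.
  - by move=> t; rewrite in_itv/= => tI; have [] := gd t tI.
  - by rewrite in_itv/= t1'.
  - by move=> t; rewrite in_itv/= => /andP[a b]; apply: tmin; rewrite in_itv/= !ltW.
have [_ E1] := E.
have tI : -1 < t0 < 1 by rewrite t1'.
have [_ E2] := gd t0 tI.
by move: ce; rewrite -(fc t0 tI ft0) -E2 E1 eqxx.
Qed.

End Auxiliary.

Section FixedPoint.
Context {R : realType}.
Variables (J K : R -> R -> R) (B : R).
Hypothesis HK : kernel_data J K B.
Variables (beta rhom rhop : R).
Hypothesis rhom01 : 0 < rhom < 1.
Hypothesis rhop01 : 0 < rhop < 1.
Hypothesis beta0 : 0 <= beta.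
Hypothesis beta_small : beta * (90 * B) <= 1.

Notation T := (picard K beta rhom rhop).
Let C0 : R := 3 + 4 * B.
Let B0 : 0 <= B. Proof. exact: le_trans ler01 (kd_ge1 HK). Qed.
Let C0_ge0 : 0 <= C0. Proof. by rewrite addr_ge0// mulr_ge0. Qed.

Let f (n : nat) : R -> R := iter n T (fun=> 0).

Let f_meas n : measurable_fun setT (f n).
Proof.
elim: n => [|n IH]; first exact: measurable_cst.
exact: (bmeas_picard HK rhom01 rhop01 beta0 beta_small IH).1.
Qed.

Let f_step n u : `|f n.+1 u - f n u| <= C0 * 2^-1 ^+ n.
Proof.
elim: n u => [|n IH] u.
  by rewrite expr0 mulr1 /= subr0; exact: (picard_bounded HK rhom01 rhop01 beta0 beta_small (f_meas 0)).
rewrite exprS mulrCA.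
exact: (picard_diff HK rhom rhop beta0 beta_small (f_meas n.+1) (f_meas n) IH).
Qed.

Let f_cauchy n p u : `|f (n + p) u - f n u| <= 2 * C0 * 2^-1 ^+ n.
Proof.
suff: `|f (n + p) u - f n u| <= 2 * C0 * 2^-1 ^+ n - 2 * C0 * 2^-1 ^+ (n + p).
  move=> h; apply: (le_trans h); rewrite lerBlDr lerDl; apply: mulr_ge0; first by rewrite mulr_ge0.
  by rewrite exprn_ge0// invr_ge0.
elim: p => [|p IH]; first by rewrite addn0 !subrr normr0.
rewrite addnS -(subrK (f (n + p) u) (f (n + p).+1 u)) -addrA.
apply: (le_trans (ler_normD _ _)); have := f_step (n + p) u.
have -> : 2^-1 ^+ (n + p).+1 = 2^-1 * 2^-1 ^+ (n + p) :> R by rewrite exprS.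
lra.
Qed.

Let f_cvg u : cvgn (fun n => f n u).
Proof.
have -> : (fun n => f n u) = series (fun k => f k.+1 u - f k u).
  by apply/funext => n; rewrite /series/= telescope_sumr// subr0.
apply: normed_cvg; apply: (@series_le_cvg _ _ (geometric C0 (2^-1 : R))).
- by move=> n /=; exact: normr_ge0.
- by move=> n /=; rewrite mulr_ge0// exprn_ge0// invr_ge0.
- by move=> n /=; exact: f_step.
- by apply: is_cvg_geometric_series; rewrite ger0_norm ?invr_ge0// invf_lt1//; lra.
Qed.

Definition stationary_profile (u : R) : R := limn (fun n => f n u).

Let f_lim n u : `|stationary_profile u - f n u| <= 2 * C0 * 2^-1 ^+ n.
Proof.
have cv : (fun m => `|f m u - f n u|) @ \oo --> `|stationary_profile u - f n u|.
  by apply: cvg_norm; apply: cvgB; [exact: f_cvg|exact: cvg_cst].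
rewrite -(cvg_lim _ cv)//; apply: limr_le; first by apply/cvg_ex; eexists; exact: cv.
near=> m; have nm : (n <= m)%N by near: m; exact: nbhs_infty_ge.
by rewrite -(subnKC nm); exact: f_cauchy.
Unshelve. all: by end_near.
Qed.

Notation rho := stationary_profile.

Lemma profile_lip u v : `|rho u - rho v| <= (1 + 2 * B) * `|u - v|.
Proof.
rewrite -subr_le0; apply: (@le0_of_geometric _ _ (4 * C0)) => n.
have -> : rho u - rho v = (rho u - f n.+1 u) + (f n.+1 u - f n.+1 v) - (rho v - f n.+1 v).
  by move: (f n.+1 u) (f n.+1 v) => x y; ring.
have h1 := f_lim n.+1 u; have h2 := f_lim n.+1 v.
have h3 := picard_lip HK rhom01 rhop01 beta0 beta_small (f_meas n) u v.
have h4 : `|(rho u - f n.+1 u) + (f n.+1 u - f n.+1 v) - (rho v - f n.+1 v)| <=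
   `|rho u - f n.+1 u| + `|f n.+1 u - f n.+1 v| + `|rho v - f n.+1 v|.
  by apply: (le_trans (ler_normB _ _)); rewrite lerD2r; exact: ler_normD.
have p0 : 0 <= C0 * 2^-1 ^+ n by rewrite mulr_ge0// exprn_ge0// invr_ge0.
rewrite half_powS in h1; rewrite half_powS in h2.
rewrite lerBlDr; apply: (le_trans h4).
apply: (le_trans (lerD (lerD h1 h3) h2)).
rewrite -[4 * _ * _]mulrA; move: p0; move: (C0 * _) ((1 + 2 * B) * _) => p X p0; lra.
Qed.

Lemma profile_meas : measurable_fun setT rho.
Proof. by apply: continuous_measurable_fun; exact: lipschitz_continuous profile_lip. Qed.

Lemma profile_fixed u : T rho u = rho u.
Proof.
apply/eqP; rewrite -subr_eq0 -normr_le0; apply: (@le0_of_geometric _ _ (4 * C0)) => n.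
have h1 := picard_diff HK rhom rhop beta0 beta_small profile_meas (f_meas n) (f_lim n) u.
have h2 := f_lim n.+1 u.
have -> : T rho u - rho u = (T rho u - f n.+1 u) - (rho u - f n.+1 u) by ring.
apply: (le_trans (ler_normB _ _)).
have p0 : 0 <= C0 * 2^-1 ^+ n by rewrite mulr_ge0// exprn_ge0// invr_ge0.
rewrite half_powS in h2; have h1' : `|T rho u - f n.+1 u| <= C0 * 2^-1 ^+ n.
  by apply: (le_trans h1); rewrite -(mulrA 2) mulKf.
apply: (le_trans (lerD h1' h2)); rewrite -[4 * _ * _]mulrA; move: p0; move: (C0 * _) => p p0; lra.
Qed.

(** A fixed point is a value of [picard], hence bounded, so iterating the contraction applies to any
    measurable one. *)
Lemma fixed_point_unique (w : R -> R) : measurable_fun setT w ->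
  T w =1 w -> w =1 rho.
Proof.
move=> mw wf u.
have bw t : `|w t| <= C0.
  by rewrite -wf; exact: (picard_bounded HK rhom01 rhop01 beta0 beta_small mw).
have br t : `|rho t| <= C0.
  by rewrite -profile_fixed; exact: (picard_bounded HK rhom01 rhop01 beta0 beta_small profile_meas).
have H n t : `|w t - rho t| <= 2 * C0 * 2^-1 ^+ n.
  elim: n t => [|n IH] t.
    rewrite expr0 mulr1; apply: (le_trans (ler_normB _ _)).
    have := bw t; have := br t; lra.
  rewrite -wf -profile_fixed exprS mulrCA.
  exact: (picard_diff HK rhom rhop beta0 beta_small mw profile_meas IH).
by apply/eqP; rewrite -subr_eq0 -normr_le0; apply: le0_of_geometric => n; exact: H.
Qed.

Lemma profile_left : rho (-1) = rhom.
Proof. by rewrite -profile_fixed picard_left. Qed.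

Lemma profile_right : rho 1 = rhop.
Proof. by rewrite -profile_fixed picard_right. Qed.

(** The quadratic error is uniform up to the endpoints, so it gives both the derivative inside and
    the increments of the profile along the lattice. *)
Lemma picard_expansion (r : R -> R) (L : R) : measurable_fun setT r ->
  (forall u v, `|r u - r v| <= L * `|u - v|) ->
  forall u v, -1 <= u <= 1 -> -1 <= v <= 1 ->
  `|T r v - T r u - (v - u) * (slope K beta rhom rhop r + beta / 2 * src K r u)|
  <= beta / 2 * (4 * B * L + B) * (v - u) ^+ 2.
Proof.
move=> mr rL u v uI vI.
rewrite /picard !clampi_id//; set s := slope _ _ _ _ _; set q := src K r u.
set V := prim _ v; set U := prim _ u.
have -> : rhom + s * (v + 1) + beta / 2 * V - (rhom + s * (u + 1) + beta / 2 * U) -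
  (v - u) * (s + beta / 2 * q) = beta / 2 * (V - U - q * (v - u)) by ring.
have b2 : 0 <= beta / 2 by rewrite mulr_ge0.
rewrite normrM (ger0_norm b2) -mulrA; apply: ler_wpM2l => //.
set Ls := 4 * B * L + B.
have Ls0 : 0 <= Ls.
  by have := le_trans (normr_ge0 _) (src_lip HK mr (rL 1 0)); rewrite subr0 normr1 mulr1.
have sl t : `|src K r t - q| <= Ls * `|t - u| by exact: (src_lip HK mr (rL t u)).
move: uI vI => /andP[u1 u2] /andP[v1 v2].
have [uv|vu] := leP u v.
  apply: (@le_trans _ _ (Ls * (v - u) * (v - u))); last by rewrite -mulrA -expr2.
  apply: prim_approx => //; first exact: (bmeas_src HK).
  move=> t /andP[t1 t2]; apply: (le_trans (sl t)); apply: ler_wpM2l => //.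
  by rewrite ger0_norm; lra.
rewrite -normrN; have -> : - (V - U - q * (v - u)) = U - V - q * (u - v) by ring.
apply: (@le_trans _ _ (Ls * (u - v) * (u - v))); last first.
  by rewrite -mulrA -expr2 -sqrrN opprB.
apply: prim_approx => //; [exact: (bmeas_src HK)|exact: ltW|].
move=> t /andP[t1 t2]; apply: (le_trans (sl t)); apply: ler_wpM2l => //.
by rewrite ler0_norm; lra.
Qed.

Lemma picard_derive (r : R -> R) (L : R) : measurable_fun setT r ->
  (forall u v, `|r u - r v| <= L * `|u - v|) -> forall u : R, -1 < u < 1 ->
  is_derive u (1 : R) (T r) (slope K beta rhom rhop r + beta / 2 * src K r u).
Proof.
move=> mr rL u /andP[u1 u2].
pose d := Num.min (u + 1) (1 - u).
have d0 : 0 < d by rewrite lt_min; lra.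
apply: (@is_derive_of_quadratic _ _ _ _ (beta / 2 * (4 * B * L + B)) d d0) => h hd.
have /andP[h1 h2] : - (u + 1) <= h <= 1 - u.
  move: hd; rewrite ler_norml => /andP[a b].
  have d1 : d <= u + 1 by rewrite ge_min lexx.
  have d2 : d <= 1 - u by rewrite ge_min lexx orbT.
  lra.
have := @picard_expansion r L mr rL u (u + h).
by rewrite (_ : u + h - u = h); [apply; lra|ring].
Qed.

Lemma profile_derive (u : R) : -1 < u < 1 ->
  is_derive u (1 : R) rho (slope K beta rhom rhop rho + beta / 2 * src K rho u).
Proof.
move=> uI; have E : T rho = rho by apply/funext => t; exact: profile_fixed.
have H := picard_derive profile_meas profile_lip uI.
by rewrite E in H.
Qed.

Lemma profile01 u : -1 <= u <= 1 -> 0 <= rho u <= 1.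
Proof.
have rm := rhom01; have rp := rhop01.
set s := slope K beta rhom rhop rho.
have crho : continuous rho := lipschitz_continuous profile_lip.
move=> uI; apply/andP; split.
  apply: (nonneg_of_slope profile_derive crho (c := s)) => //.
  - by rewrite profile_left; lra.
  - by rewrite profile_right; lra.
  - move=> t _ t0; rewrite /src /sig /cl01 (_ : Num.max 0 _ = 0).
      by rewrite /mobility mulr0 !mul0r mulr0 addr0.
    by apply: max_l; rewrite ge_min (ltW t0) orbT.
rewrite -subr_ge0.
apply: (@nonneg_of_slope _ (fun u => 1 - rho u) (fun u => - (s + beta / 2 * src K rho u)) (- s)) => //.
- move=> t tI; have h := profile_derive tI.
  by apply: is_derive_eq; rewrite add0r mul1r.
- by move=> t; apply: cvgB; [exact: cvg_cst|exact: crho].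
- by rewrite profile_left; lra.
- by rewrite profile_right; lra.
- move=> t _ t0; have t1 : 1 < rho t by lra.
  rewrite /src /sig /cl01 min_l ?(ltW t1)// max_r//.
  by rewrite /mobility subrr !mulr0 mul0r mulr0 addr0.
Qed.

End FixedPoint.

(** * Integration by parts *)

Section IntegrationByParts.
Context {R : realType}.
Local Notation leb := (@lebesgue_measure R).

Lemma clampi_continuous : continuous (@clampi R).
Proof. by apply: (@lipschitz_continuous _ _ 1) => u v; rewrite mul1r clampi_lip. Qed.

Lemma clampi_within (h : R -> R) : {within `[-1, 1], continuous h} ->
  continuous (fun u => h (clampi u)).
Proof.
move=> /subspace_continuousP ch u.
have uI : `[(-1 : R), 1]%classic (clampi u) by rewrite /= in_itv/= clampi_itv.
apply: cvg_trans (ch _ uI) => E /= [e e0 H]; rewrite /nbhs/=.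
have := clampi_continuous (x := u); move=> /cvgrPdist_lt /(_ e e0).
apply: filterS => t te /=; apply: H => //=.
by rewrite in_itv/= clampi_itv.
Qed.

Lemma clampi_bounded (h : R -> R) : {within `[-1, 1], continuous h} ->
  exists M, forall u, `|h (clampi u)| <= M.
Proof.
move=> ch; have ch' := clampi_within ch.
have cn : {within `[(-1 : R), 1], continuous (fun u => `|h (clampi u)|)}.
  by apply: continuous_subspaceT => u; apply: continuous_comp; [exact: ch'|exact: norm_continuous].
have [|c _ H] := EVT_max _ cn; first by lra.
exists `|h (clampi c)| => u; have := H (clampi u).
by rewrite in_itv/= clampi_itv => /(_ isT); rewrite (clampi_id (clampi_itv u)).
Qed.

(** The derivative relation is required inside (-1,1) only, since after composition with [clampi] it
    may fail at and beyond the ends. *)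
Record C1pair (H h : R -> R) : Prop := MkC1pair {
  C1_cont : continuous H;
  C1_contd : continuous h;
  C1_bound : exists M, forall u, `|H u| <= M;
  C1_boundd : exists M, forall u, `|h u| <= M;
  C1_derive : forall u : R, -1 < u < 1 -> is_derive u (1 : R) H (h u)
}.

Lemma near_clampi (u : R) : -1 < u < 1 -> \forall t \near u, clampi t = t.
Proof.
move=> uI; near=> t; apply: clampi_id.
have : t \in `]-1, 1[ by near: t; apply: near_in_itvoo; rewrite in_itv.
by rewrite in_itv/= => /andP[a b]; rewrite !ltW.
Unshelve. all: by end_near.
Qed.

Lemma C1pair_clampi (H h : R -> R) : {within `[-1, 1], continuous H} ->
  {within `[-1, 1], continuous h} ->
  (forall u : R, -1 < u < 1 -> is_derive u (1 : R) H (h u)) ->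
  C1pair (fun u => H (clampi u)) (fun u => h (clampi u)).
Proof.
move=> cH ch Hd; split.
- exact: clampi_within.
- exact: clampi_within.
- exact: clampi_bounded.
- exact: clampi_bounded.
move=> u uI; rewrite (clampi_id (u := u)); last by move/andP: uI => [a b]; rewrite !ltW.
apply: near_eq_is_derive (Hd u uI).
by apply: filterS (near_clampi uI) => t ->.
Qed.

Lemma C1pair_bmeas H h : C1pair H h -> bmeas H /\ bmeas h.
Proof. by case=> *; split; exact: bmeas_continuous. Qed.

Lemma integral_ccitv (f : R -> R) : bmeas f -> \int[leb]_(t in `[-1, 1]) f t = prim f 1.
Proof. by move=> bf; rewrite -Rintegral_itv_obnd_cbnd//; exact: prim_integrable. Qed.

Lemma prim_derive (f : R -> R) (u : R) : bmeas f -> continuous f -> -1 < u < 1 ->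
  is_derive u (1 : R) (prim f) (f u).
Proof.
move=> bf cf /andP[u1 u2].
have [|d1 d2] := @continuous_FTC1 R f (BRight (-1)) u 1 u2 (prim_integrable 1 bf) _ (cf u).
  exact: u1.
split; first exact: d1.
by rewrite -derive1E; exact: d2.
Qed.

Lemma prim_lip (f : R -> R) (M : R) : bmeas f -> (forall u, `|f u| <= M) ->
  forall u v, `|prim f (clampi u) - prim f (clampi v)| <= M * `|u - v|.
Proof.
move=> bf fM u v; have M0 : 0 <= M by exact: le_trans (fM 0).
apply: (@le_trans _ _ (M * `|clampi u - clampi v|)); last by rewrite ler_wpM2l ?clampi_lip.
have := clampi_itv u; have := clampi_itv v; move: (clampi u) (clampi v) => {u v}.
suff H a b : -1 <= a -> a <= b -> `|prim f b - prim f a| <= M * (b - a).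
  move=> u v /andP[v1 v2] /andP[u1 u2]; have [uv|vu] := leP u v.
    by rewrite distrC (@ler0_norm _ (u - v)) ?subr_le0// opprB; apply: H.
  by rewrite (@gtr0_norm _ (u - v)) ?subr_gt0//; apply: H => //; exact: ltW.
move=> a1 ab; have := @prim_approx _ f a b 0 M bf a1 ab.
by rewrite mul0r subr0; apply => t _; rewrite subr0.
Qed.

Lemma prim_clampi_continuous (f : R -> R) : bmeas f -> continuous (fun u => prim f (clampi u)).
Proof. by move=> bf; have [_ [M fM]] := bf; exact: lipschitz_continuous (prim_lip bf fM). Qed.

Lemma bmeas_prim (f : R -> R) : bmeas f -> bmeas (fun u => prim f (clampi u)).
Proof.
move=> bf; have [_ [M fM]] := bf; apply: (bmeas_lipschitz (prim_lip bf fM)).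
exists (M * 2) => u; have := clampi_itv u => /andP[u1 u2].
have M0 : 0 <= M by exact: le_trans (fM 0).
apply: (@le_trans _ _ (M * (clampi u + 1))); first by apply: prim_le.
by rewrite ler_wpM2l//; lra.
Qed.

Lemma prim_clampi_derive (f : R -> R) (u : R) : bmeas f -> continuous f -> -1 < u < 1 ->
  is_derive u (1 : R) (fun t => prim f (clampi t)) (f u).
Proof.
move=> bf cf uI; apply: near_eq_is_derive (prim_derive bf cf uI).
by apply: filterS (near_clampi uI) => t ->.
Qed.

Let ibp_endpoints (F : R -> R) : continuous F ->
  (forall u : R, -1 < u < 1 -> derivable F u 1) -> derivable_oo_LRcontinuous F (-1) 1.
Proof.
move=> cF dF; split; first by move=> u; rewrite in_itv/=; exact: dF.
- by apply: cvg_at_right_filter; exact: cF.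
- by apply: cvg_at_left_filter; exact: cF.
Qed.

Lemma prim_ibp_continuous (f H h : R -> R) : bmeas f -> continuous f -> C1pair H h ->
  prim (fun u => prim f (clampi u) * h u) 1 = prim f 1 * H 1 - prim (fun u => f u * H u) 1.
Proof.
move=> bf cf CH; have [bH bh] := C1pair_bmeas CH.
have c1 : clampi 1 = 1 :> R by apply: clampi_id; lra.
have cm1 : clampi (-1) = -1 :> R by apply: clampi_id; lra.
have b1 : bmeas (fun u => prim f (clampi u) * h u) by apply: bmeasM => //; exact: bmeas_prim.
have b2 : bmeas (fun u => f u * H u) by exact: bmeasM.
rewrite -(integral_ccitv b1) -(integral_ccitv b2).
rewrite (@Rintegration_by_parts _ (fun u => prim f (clampi u)) H f h (-1) 1).
- by rewrite c1 cm1 prim_left mul0r subr0.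
- lra.
- exact: continuous_subspaceT.
- apply: ibp_endpoints; first exact: prim_clampi_continuous.
  by move=> u uI; have [] := prim_clampi_derive bf cf uI.
- move=> u; rewrite in_itv/= => uI; rewrite derive1E.
  by have [_ ->] := prim_clampi_derive bf cf uI.
- exact: continuous_subspaceT (C1_contd CH).
- apply: ibp_endpoints; first exact: C1_cont CH.
  by move=> u uI; have [] := C1_derive CH uI.
- move=> u; rewrite in_itv/= => uI; rewrite derive1E.
  by have [_ ->] := C1_derive CH uI.
Qed.

Lemma prim_fundamental (H h : R -> R) : C1pair H h -> prim h 1 = H 1 - H (-1).
Proof.
move=> CH; have [bH bh] := C1pair_bmeas CH.
rewrite -integral_ccitv// /Rintegral (@continuous_FTC2 _ h H (-1) 1)//.
- exact: continuous_subspaceT (C1_contd CH).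
- apply: ibp_endpoints; first exact: C1_cont CH.
  by move=> u uI; have [] := C1_derive CH uI.
- move=> u; rewrite in_itv/= => uI; rewrite derive1E.
  by have [_ ->] := C1_derive CH uI.
Qed.

Lemma bmeas_norm (f : R -> R) : bmeas f -> bmeas (fun u => `|f u|).
Proof.
move=> [mf [M fM]]; split; last by exists M => u; rewrite normr_id.
exact: measurableT_comp.
Qed.

Lemma prim_norm_le (f : R -> R) u : bmeas f -> `|prim f u| <= prim (fun t => `|f t|) u.
Proof. by move=> bf; apply: le_normr_Rintegral => //; exact: prim_integrable. Qed.

Lemma prim_mono (f g : R -> R) u : bmeas f -> bmeas g -> (forall t, f t <= g t) ->
  prim f u <= prim g u.
Proof. by move=> bf bg fg; apply: le_Rintegral => //; exact: prim_integrable. Qed.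

Lemma prim_norm_mono (f : R -> R) u : bmeas f -> -1 <= u <= 1 ->
  prim (fun t => `|f t|) u <= prim (fun t => `|f t|) 1.
Proof.
move=> bf /andP[u1 u2]; rewrite -subr_ge0 prim_sub//; last exact: bmeas_norm.
exact: Rintegral_ge0.
Qed.

Lemma L1_approximation (f : R -> R) (e : R) : bmeas f -> 0 < e ->
  exists g, [/\ continuous g, bmeas g & prim (fun u => `|f u - g u|) 1 <= e].
Proof.
move=> bf e0.
have [g [cg ig cv]] := @approximation_continuous_integrable R (Lambda R) f
  (@Lambda_measurable R) (@Lambda_fin R) (Lambda_integrable bf).
have : \forall n \near \oo, (\int[leb]_(z in Lambda R) `|(f z - g n z)%:E| <= e%:E)%E.
  have /fine_cvgP[fin cvf] : (\int[leb]_(z in Lambda R) `|(f z - g n z)%:E|)%E @[n --> \oo]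
      --> (0 : R)%:E by exact: cv.
  near=> n.
  have fn : (\int[leb]_(z in Lambda R) `|(f z - g n z)%:E|)%E \is a fin_num by near: n; exact: fin.
  rewrite -(fineK fn) lee_fin; apply: ltW; near: n.
  exact: (cvgr_lt _ cvf _ e0).
move=> [n _ /(_ n (leqnn n))] H.
(* This makes the continuous approximant bounded on the line without changing it on [Lambda]. *)
pose h u := g n (clampi u).
have wc : {within `[(-1 : R), 1], continuous (g n)} by exact: continuous_subspaceT (cg n).
have ch : continuous h by exact: clampi_within.
have bh : bmeas h by apply: bmeas_continuous => //; exact: clampi_bounded.
exists h; split => //.
have bfh : bmeas (fun u => `|f u - h u|) by apply: bmeas_norm; exact: bmeasB.
rewrite -integral_Lambda// -lee_fin /Rintegral fineK; last first.
  by apply: integrable_fin_num; [exact: Lambda_measurable|exact: (Lambda_integrable bfh)].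
apply: le_trans H; rewrite le_eqVlt; apply/orP; left; apply/eqP.
apply: eq_integral => t; rewrite inE /Lambda/= in_itv/= => /andP[a b].
by rewrite /h clampi_id ?ltW.
Unshelve. all: by end_near.
Qed.

(** All three terms are continuous in f for the L^1 norm, so the case of continuous f carries over
    by density. *)
Lemma prim_ibp (f H h : R -> R) : bmeas f -> C1pair H h ->
  prim (fun u => prim f (clampi u) * h u) 1 = prim f 1 * H 1 - prim (fun u => f u * H u) 1.
Proof.
move=> bf CH; have [bH bh] := C1pair_bmeas CH.
have [_ [MH HM]] := bH; have [_ [Mh hM]] := bh.
have MH0 : 0 <= MH by exact: le_trans (HM 0).
have Mh0 : 0 <= Mh by exact: le_trans (hM 0).
apply/eqP; rewrite -subr_eq0 -normr_le0; apply/ler_addgt0Pr => e e0; rewrite add0r.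
(* The errors [h1], [h2], [h3] below sum to d * (2 Mh + 2 MH); adding 1 makes the divisor
   positive. *)
pose C := 2 * Mh + 2 * MH + 1; have C0 : 0 < C by rewrite /C; lra.
have [g [cg bg gf]] := L1_approximation bf (divr_gt0 e0 C0).
set d := e / C in gf.
have E := prim_ibp_continuous bg cg CH.
have close u : -1 <= u <= 1 -> `|prim f u - prim g u| <= d.
  move=> uI; rewrite -primB//; apply: le_trans gf; apply: (le_trans (prim_norm_le _ _)).
    exact: bmeasB.
  by apply: prim_norm_mono => //; exact: bmeasB.
have h1 : `|prim (fun u => prim f (clampi u) * h u) 1 - prim (fun u => prim g (clampi u) * h u) 1|
    <= d * Mh * (1 + 1).
  apply: prim_diff_le; [by apply: bmeasM => //; exact: bmeas_prim..|lra|].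
  by move=> t _; rewrite -mulrBl normrM ler_pM//; apply: close; exact: clampi_itv.
have h2 : `|(prim f 1 - prim g 1) * H 1| <= d * MH.
  by rewrite normrM ler_pM//; apply: close; lra.
have h3 : `|prim (fun u => f u * H u) 1 - prim (fun u => g u * H u) 1| <= d * MH.
  rewrite -primB; [|exact: bmeasM..]; apply: (le_trans (prim_norm_le _ _)).
    by apply: bmeasB; exact: bmeasM.
  apply: (@le_trans _ _ (prim (fun u => MH * `|f u - g u|) 1)).
    apply: prim_mono; first by apply: bmeas_norm; apply: bmeasB; exact: bmeasM.
      by apply: bmeasZ; apply: bmeas_norm; exact: bmeasB.
    by move=> t; rewrite -mulrBl normrM mulrC ler_wpM2r.
  rewrite primZ; last by apply: bmeas_norm; exact: bmeasB.
  by rewrite [leRHS]mulrC ler_wpM2l.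
have -> : e = d * C by rewrite /d divfK// gt_eqF.
have d0 : 0 <= d by rewrite divr_ge0 ?ltW.
move: h1 h2 h3; rewrite E.
set a := prim _ 1; set b := prim f 1; set c := prim g 1.
set x := prim (fun u => g u * H u) 1; set y := prim (fun u => f u * H u) 1.
move=> h1 h2 h3.
have -> : a - (b * H 1 - y) = (a - (c * H 1 - x)) - (b - c) * H 1 + (y - x) by ring.
apply: (le_trans (ler_normD _ _)); apply: (@le_trans _ _ (d * Mh * (1 + 1) + d * MH + d * MH)).
  by apply: lerD => //; apply: (le_trans (ler_normB _ _)); exact: lerD.
by rewrite /C; lra.
Qed.

End IntegrationByParts.

(** * Weak solutions *)

Section WeakSolution.
Context {R : realType}.
Variables (J K : R -> R -> R) (B : R).
Hypothesis HK : kernel_data J K B.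
Variables (beta rhom rhop : R).
Hypothesis rhom01 : 0 < rhom < 1.
Hypothesis rhop01 : 0 < rhop < 1.
Hypothesis beta0 : 0 <= beta.
Hypothesis beta_small : beta * (90 * B) <= 1.
Local Notation leb := (@lebesgue_measure R).
Notation T := (picard K beta rhom rhop).
Notation rho := (stationary_profile K beta rhom rhop).

Let p11 : (-1 : R) <= (1 : R) <= (1 : R).
Proof. by rewrite lexx andbT; lra. Qed.

Lemma bmeas_Jneum u : bmeas (Jneum J u).
Proof.
apply: (@bmeas_lipschitz _ _ B); last by exists B; exact: (kd_Jle HK).
by move=> v v'; rewrite !(kd_sym HK u); exact: (kd_Jlip HK).
Qed.

(** The Taylor bound on the kernel is uniform in v, so it integrates to a quadratic error for the
    convolution, whatever representative of the density is used. *)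
Lemma Jconv_derive (r m : R -> R) u : measurable_fun (Lambda R) r ->
  measurable_fun setT m ->
  {ae leb, forall v, Lambda R v -> r v = cl01 (m v)} ->
  derive1 (Jconv J r) u = field K m u.
Proof.
move=> mr mm rm.
have bm := bmeas_cl01 mm.
have E v : Jconv J r v = prim (fun t => Jneum J v t * cl01 (m t)) 1.
  rewrite -integral_Lambda; last by apply: bmeasM => //; exact: bmeas_Jneum.
  have [mJ _] := bmeas_Jneum v.
  apply: Rintegral_ae => //.
  - exact: Lambda_measurable.
  - by apply: measurable_funM => //; exact: measurable_funTS.
  - by apply: measurable_funM; [exact: measurable_funTS|case: bm => h _; exact: measurable_funTS].
  - move: rm; apply: filterS; first exact: (ae_filter_ringOfSetsType leb).
    by move=> t h /h ->.
suff D : is_derive u (1 : R) (Jconv J r) (field K m u) by rewrite derive1E; case: D.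
apply: (@is_derive_of_quadratic _ _ _ _ (2 * B) 1) => // h _; rewrite !E.
have b1 v : bmeas (fun t => Jneum J v t * cl01 (m t)) by apply: bmeasM => //; exact: bmeas_Jneum.
have b2 := bmeas_field_integrand HK u mm.
rewrite /field -primB// -primZ// -primB//; last 2 first.
- exact: bmeasB.
- exact: bmeasZ.
rewrite (_ : 2 * B * h ^+ 2 = B * h ^+ 2 * (1 + 1)); last by ring.
apply: prim_le; [|lra|].
  by apply: bmeasB; [exact: bmeasB|exact: bmeasZ].
move=> t _; have -> : Jneum J (u + h) t * cl01 (m t) - Jneum J u t * cl01 (m t) -
  h * (K u t * cl01 (m t)) = (Jneum J (u + h) t - Jneum J u t - h * K u t) * cl01 (m t) by ring.
rewrite normrM -[leRHS]mulr1 ler_pM//; first exact: (kd_taylor HK).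
by have := cl01_itv (m t); rewrite ler_norml; lra.
Qed.

Let bmeas_picard' m : measurable_fun setT m -> bmeas (T m).
Proof. exact: (bmeas_picard HK rhom01 rhop01 beta0 beta_small). Qed.

(** [picard] of a merely measurable m is a primitive of a bounded function that may be
    discontinuous; this is why [prim_ibp] is stated for [bmeas]. *)
Lemma picard_ibp (m H h : R -> R) : measurable_fun setT m -> C1pair H h ->
  prim (fun u => T m u * h u) 1 = rhop * H 1 - rhom * H (-1)
   - prim (fun u => (slope K beta rhom rhop m + beta / 2 * src K m u) * H u) 1.
Proof.
move=> mm CH; have [bH bh] := C1pair_bmeas CH.
set s := slope K beta rhom rhop m.
have bs := bmeas_src HK mm.
pose g u := s + beta / 2 * src K m u.
have bg : bmeas g by apply: bmeasD; [exact: bmeas_cst|exact: bmeasZ].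
have Tg u : T m u = rhom + prim g (clampi u).
  rewrite /picard /g primD; [|exact: bmeas_cst|exact: bmeasZ]; rewrite primZ// -/s addrA.
  congr (_ + _ + _); have := @prim_approx _ (fun=> s) (-1) (clampi u) s 0 (bmeas_cst s) (lexx _).
  have /andP[c1 _] := clampi_itv u; move=> /(_ c1); rewrite mul0r prim_left subr0 opprK => h'.
  apply/eqP; rewrite eq_sym -subr_eq0 -normr_le0; apply: h' => t _.
  by rewrite subrr normr0.
rewrite (_ : (fun u => T m u * h u) = (fun u => rhom * h u + prim g (clampi u) * h u)); last first.
  by apply/funext => u; rewrite Tg; ring.
rewrite primD; [|exact: bmeasZ|by apply: bmeasM => //; exact: bmeas_prim].
rewrite primZ// (prim_fundamental CH) (prim_ibp bg CH) -/g.
have c1 : clampi 1 = 1 :> R by exact: clampi_id.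
have := Tg 1; rewrite picard_right c1 => ->.
by ring.
Qed.

Lemma C2_C1pair (G dG d2G : R -> R) : C2_0_with G dG d2G ->
  C1pair (fun u => dG (clampi u)) (fun u => d2G (clampi u)) /\
  C1pair (fun u => G (clampi u)) (fun u => dG (clampi u)).
Proof.
by case=> c0 c1 c2 d1 d2 _ _; split; exact: C1pair_clampi.
Qed.

Lemma inner_clampi (f h : R -> R) : bmeas f -> bmeas (fun u => h (clampi u)) ->
  inner f h = prim (fun u => f u * h (clampi u)) 1.
Proof.
move=> bf bh; rewrite -integral_Lambda; last exact: bmeasM.
apply: eq_Rintegral => t; rewrite inE /Lambda/= in_itv/= => /andP[a b].
by rewrite clampi_id// !ltW.
Qed.

(** The linear weak equation with the source frozen at m. The slope disappears because dG has
    integral zero. With m the profile it gives existence; with m a weak solution it is the equation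
    to subtract for uniqueness. *)
Lemma picard_weak_eq (m : R -> R) (G dG d2G : R -> R) : measurable_fun setT m ->
  C2_0_with G dG d2G ->
  - inner (T m) d2G + rhop * dG 1 - rhom * dG (-1)
  - beta / 2 * prim (fun u => src K m u * dG (clampi u)) 1 = 0.
Proof.
move=> mm HG; have [C1 C0] := C2_C1pair HG.
have [b1 b2] := C1pair_bmeas C1.
have bs := bmeas_src HK mm.
rewrite inner_clampi//; last exact: bmeas_picard'.
rewrite (picard_ibp mm C1).
have c1 : clampi 1 = 1 :> R by exact: clampi_id.
have cm1 : clampi (-1) = -1 :> R by apply: clampi_id; lra.
rewrite c1 cm1; set s := slope K beta rhom rhop m.
rewrite (_ : (fun u => (s + beta / 2 * src K m u) * dG (clampi u)) =
  (fun u => s * dG (clampi u) + beta / 2 * (src K m u * dG (clampi u)))); last first.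
  by apply/funext => u; ring.
rewrite primD; [|exact: bmeasZ|by apply: bmeasZ; exact: bmeasM].
rewrite primZ// primZ; last exact: bmeasM.
by rewrite (prim_fundamental C0) c1 cm1 (C2_left HG) (C2_right HG); ring.
Qed.

Let rho_meas : measurable_fun setT rho.
Proof. exact: (profile_meas HK rhom01 rhop01 beta0 beta_small). Qed.

Let rho_T : T rho = rho.
Proof. by apply/funext => u; exact: (profile_fixed HK rhom01 rhop01 beta0 beta_small). Qed.

Let rho_bmeas : bmeas rho.
Proof. by rewrite -rho_T; exact: bmeas_picard'. Qed.

Let rho01 (u : R) : -1 <= u <= 1 -> 0 <= rho u <= 1.
Proof. exact: (profile01 HK rhom01 rhop01 beta0 beta_small). Qed.

Lemma bmeas_L2 (f : R -> R) : bmeas f -> L2 f.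
Proof.
move=> bf; split; first by case: bf => mf _; exact: measurable_funTS.
by apply: Lambda_integrable; exact: bmeasM.
Qed.

Lemma profile_H1 : H1 rho.
Proof.
split; first exact: bmeas_L2.
set s := slope K beta rhom rhop rho.
have bg : bmeas (fun u => s + beta / 2 * src K rho u).
  by apply: bmeasD; [exact: bmeas_cst|apply: bmeasZ; exact: (bmeas_src HK)].
exists (fun u => s + beta / 2 * src K rho u); first exact: bmeas_L2.
move=> phi [dphi [r r1 supp]].
have d0 (u : R) : is_derive u (1 : R) phi (derive1 phi u).
  by split; [exact: (dphi 0%N)|rewrite derive1E].
have cont f : (forall u : R, derivable f u 1) -> continuous f.
  by move=> df u; apply: differentiable_continuous; apply/derivable1_diffP; exact: df.
have C : C1pair (fun u => phi (clampi u)) (fun u => derive1 phi (clampi u)).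
  apply: C1pair_clampi.
  - by apply: continuous_subspaceT; apply: cont; exact: (dphi 0%N).
  - by apply: continuous_subspaceT; apply: cont; exact: (dphi 1%N).
have [b1 b2] := C1pair_bmeas C.
rewrite !inner_clampi// -{1}rho_T (picard_ibp rho_meas C).
have c1 : clampi 1 = 1 :> R by exact: clampi_id.
have cm1 : clampi (-1) = -1 :> R by apply: clampi_id; lra.
by rewrite c1 cm1 !supp ?normrN ?normr1//; ring.
Qed.

Lemma profile_weak_solution : weak_solution J beta rhom rhop rho.
Proof.
split; first exact: profile_H1.
- apply: aeW => u; rewrite /Lambda/= in_itv/= => /andP[a b].
  by apply: rho01; rewrite !ltW.
move=> G dG d2G HG; have [C1 C0] := C2_C1pair HG.
rewrite -[RHS](picard_weak_eq rho_meas HG) rho_T; congr (_ - _ * _).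
have [_ b2] := C1pair_bmeas C0.
rewrite -integral_Lambda; last by apply: bmeasM => //; exact: (bmeas_src HK).
apply: eq_Rintegral => t; rewrite inE /Lambda/= in_itv/= => /andP[a b].
have tI : -1 <= t <= 1 by rewrite !ltW.
rewrite (@Jconv_derive rho rho)//; last 2 first.
- exact: measurable_funTS.
- apply: aeW => v; rewrite /Lambda/= in_itv/= => /andP[a' b'].
  by rewrite cl01_id//; apply: rho01; rewrite !ltW.
by rewrite /src /sig cl01_id ?rho01// clampi_id//; ring.
Qed.

(** A second primitive of g, with the constant [c] in its derivative adjusted so that it vanishes at
    1. Thus second derivatives of admissible test functions exhaust the bounded continuous
    functions. *)
Lemma C2_of_continuous (g : R -> R) : continuous g -> bmeas g ->
  exists G dG, C2_0_with G dG g.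
Proof.
move=> cg bg.
pose P u := prim g (clampi u).
have bP : bmeas P by exact: bmeas_prim.
have cP : continuous P by exact: prim_clampi_continuous.
pose c := prim P 1 / 2.
pose dG u := P u - c.
have bd : bmeas dG by apply: bmeasB => //; exact: bmeas_cst.
have cd : continuous dG by move=> u; apply: cvgB; [exact: cP|exact: cvg_cst].
exists (fun u => prim dG (clampi u)), dG; split.
- by apply: continuous_subspaceT; exact: prim_clampi_continuous.
- exact: continuous_subspaceT.
- exact: continuous_subspaceT.
- by move=> u uI; exact: prim_clampi_derive.
- move=> u uI; have h := prim_clampi_derive bg cg uI.
  by apply: is_derive_eq; rewrite subr0.
- by rewrite clampi_id ?prim_left//; lra.
- rewrite clampi_id// /dG primB//; last exact: bmeas_cst.
  have := @prim_approx _ (fun=> c) (-1) 1 c 0 (bmeas_cst c) (lexx _).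
  rewrite mul0r prim_left subr0 opprK => h.
  have {}h : prim (fun=> c) 1 = c * (1 + 1).
    apply/eqP; rewrite -subr_eq0 -normr_le0; apply: h; first by lra.
    by move=> t _; rewrite subrr normr0.
  by rewrite h /c; field.
Qed.

(** For g close to q in L^1, orthogonality turns the integral of q^2 into that of q(q - g), at most
    the bound of q times the L^1 distance. *)
Lemma ae_zero_of_orthogonal (q : R -> R) : bmeas q ->
  (forall g, continuous g -> bmeas g -> prim (fun u => q u * g u) 1 = 0) ->
  {ae leb, forall u, Lambda R u -> q u = 0}.
Proof.
move=> bq orth; have [_ [M qM]] := bq.
have M0 : 0 <= M by exact: le_trans (qM 0).
have bqq : bmeas (fun u => q u * q u) by exact: bmeasM.
have qq0 : prim (fun u => q u * q u) 1 <= 0.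
  apply/ler_addgt0Pr => e e0; rewrite add0r.
  have M1 : 0 < M + 1 by lra.
  have [g [cg bg gq]] := L1_approximation bq (divr_gt0 e0 M1).
  have bqg : bmeas (fun u => q u * g u) by exact: bmeasM.
  rewrite -[X in X <= _]subr0 -(orth g cg bg) -primB//.
  apply: (le_trans (ler_norm _)); apply: (le_trans (prim_norm_le _ _)); first exact: bmeasB.
  have bn : bmeas (fun u => `|q u - g u|) by apply: bmeas_norm; exact: bmeasB.
  apply: (@le_trans _ _ (prim (fun u => M * `|q u - g u|) 1)).
    apply: prim_mono; [by apply: bmeas_norm; exact: bmeasB|exact: bmeasZ|].
    by move=> t; rewrite -mulrBr normrM ler_wpM2r.
  rewrite primZ//; apply: (@le_trans _ _ (M * (e / (M + 1)))); first by rewrite ler_wpM2l.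
  by rewrite mulrA ler_pdivrMr// mulrC ler_wpM2l ?(ltW e0)//; lra.
have mqq : measurable_fun (Lambda R) (EFin \o (fun u => q u * q u)).
  by apply/measurable_EFinP; case: bqq => h _; exact: measurable_funTS.
have : (\int[leb]_(x in Lambda R) `|(EFin \o (fun u => (q u * q u)%R)) x|)%E = 0%E.
  have fin : (\int[leb]_(x in Lambda R) (EFin \o (fun u => (q u * q u)%R)) x)%E \is a fin_num.
    by apply: integrable_fin_num; [exact: Lambda_measurable|exact: (Lambda_integrable bqq)].
  have e1 : (\int[leb]_(x in Lambda R) `|(EFin \o (fun u => (q u * q u)%R)) x|)%E =
      (\int[leb]_(x in Lambda R) (EFin \o (fun u => (q u * q u)%R)) x)%E.
    by apply: eq_integral => x _ /=; rewrite ger0_norm// -expr2 sqr_ge0.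
  rewrite e1 -(fineK fin); congr EFin; apply/eqP; rewrite eq_le; apply/andP; split.
    by move: qq0; rewrite -integral_Lambda.
  by apply: Rintegral_ge0 => x _; rewrite -expr2 sqr_ge0.
move=> /(ae_eq_integral_abs leb (@Lambda_measurable R) mqq).
apply: filterS.
move=> x /= h Lx; have [] := h Lx.
by move/eqP; rewrite mulf_eq0 orbb => /eqP.
Qed.

(** Subtracting the two weak equations makes r - T r orthogonal to every bounded continuous
    function, so r = T r almost everywhere. Then T r is a genuine measurable fixed point, hence the
    profile. *)
Lemma weak_solution_unique (r : R -> R) : weak_solution J beta rhom rhop r ->
  {ae leb, forall u, Lambda R u -> r u = rho u}.
Proof.
move=> [[[mr _] _] r01 weq].
(* Extension by zero gives measurability on the line; [cl01] of it equals r almost everywhere on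
   [Lambda] and is bounded everywhere, as [bmeas] requires. *)
pose m := r \_ (Lambda R).
have mm : measurable_fun setT m.
  by apply/(measurable_restrictT _ (@Lambda_measurable R)).
have mE v : Lambda R v -> m v = r v by move=> Lv; rewrite /m patchE mem_set.
have rm : {ae leb, forall v, Lambda R v -> r v = cl01 (m v)}.
  move: r01; apply: filterS; first exact: (ae_filter_ringOfSetsType leb).
  by move=> t h Lt; rewrite mE// cl01_id//; exact: h.
pose cm u := cl01 (m u).
have bcm : bmeas cm by exact: bmeas_cl01.
have bT := bmeas_picard' mm.
pose q u := cm u - T m u.
have bq : bmeas q by exact: bmeasB.
have q0 : {ae leb, forall u, Lambda R u -> q u = 0}.
  apply: ae_zero_of_orthogonal => // g cg bg.
  have [G [dG HG]] := C2_of_continuous cg bg.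
  have [C1 C0] := C2_C1pair HG.
  have [b1 b2] := C1pair_bmeas C1.
  have w1 := weq _ _ _ HG; have w2 := picard_weak_eq mm HG.
  have bsrc := bmeas_src HK mm.
  have e1 : inner (fun u => mobility (r u)) (fun u => dG u * derive1 (Jconv J r) u) =
      prim (fun u => src K m u * dG (clampi u)) 1.
    rewrite -integral_Lambda; last exact: bmeasM.
    have bfield := bmeas_field HK mm.
    have mdG : measurable_fun (Lambda R) dG.
      have [mc _] := b1; apply: (eq_measurable_fun (fun u => dG (clampi u))).
        move=> u; rewrite inE /Lambda/= in_itv/= => /andP[a b].
        by rewrite clampi_id// !ltW.
      exact: measurable_funTS.
    have dJ : derive1 (Jconv J r) = field K m.
      by apply/funext => u; exact: Jconv_derive.
    rewrite /inner dJ; apply: Rintegral_ae => //.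
    - exact: Lambda_measurable.
    - apply: measurable_funM; last first.
        by apply: measurable_funM => //; case: bfield => h _; exact: measurable_funTS.
      apply: measurable_funM; first by apply: measurable_funM => //; exact: measurable_cst.
      by apply: measurable_funB => //; exact: measurable_cst.
    - by apply: measurable_funM; [case: bsrc => h _|case: b1 => h _]; exact: measurable_funTS.
    - move: rm; apply: filterS; first exact: (ae_filter_ringOfSetsType leb).
      move=> t h Lt; rewrite /src /sig -(h Lt) clampi_id; first by ring.
      by move: Lt; rewrite /Lambda/= in_itv/= => /andP[a b]; rewrite !ltW.
  have e2 : inner r g = prim (fun u => cm u * g u) 1.
    rewrite -integral_Lambda; last exact: bmeasM.
    have [mg _] := bg; apply: Rintegral_ae => //.
    - exact: Lambda_measurable.
    - by apply: measurable_funM => //; exact: measurable_funTS.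
    - by apply: measurable_funM; [case: bcm => h _|]; exact: measurable_funTS.
    - move: rm; apply: filterS; first exact: (ae_filter_ringOfSetsType leb).
      by move=> t h Lt; rewrite (h Lt).
  have e3 : inner (T m) g = prim (fun u => T m u * g u) 1.
    by rewrite /inner integral_Lambda//; exact: bmeasM.
  rewrite (_ : (fun u => q u * g u) = (fun u => cm u * g u - T m u * g u)); last first.
    by apply/funext => u; rewrite /q; ring.
  rewrite primB; [|exact: bmeasM..].
  rewrite -e2 -e3; move: w1 w2; rewrite e1; lra.
have rT : {ae leb, forall u, Lambda R u -> r u = T m u}.
  apply: (filterS2 _ _ rm q0); first exact: (ae_filter_ringOfSetsType leb).
  move=> u h1 h2 Lu; rewrite (h1 Lu); apply/eqP; rewrite -subr_eq0; apply/eqP; exact: h2.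
have TT : T (T m) =1 T m.
  apply: (picard_ae HK) => //; first by case: bT.
  move: rT; apply: filterS; first exact: (ae_filter_ringOfSetsType leb).
  by move=> u h Lu; rewrite -(h Lu) mE.
have Trho := fixed_point_unique HK rhom01 rhop01 beta0 beta_small bT.1 TT.
move: rT; apply: filterS; first exact: (ae_filter_ringOfSetsType leb).
by move=> u h Lu; rewrite (h Lu) Trho.
Qed.

End WeakSolution.

(** * Riemann sums *)

Section RiemannSums.
Context {R : realType} {N : nat}.
Hypothesis N0 : (0 < N)%N.
Local Notation leb := (@lebesgue_measure R).
Notation x k := (xpos N k : R).

Let NR0 : 0 < N%:R :> R. Proof. by rewrite ltr0n. Qed.
Let q : R := N%:R^-1.
Let q0 : 0 < q. Proof. by rewrite invr_gt0. Qed.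

Lemma xpos0 : x 0 = -1.
Proof. by rewrite /xpos sub0r mulNr divff ?gt_eqF. Qed.

Lemma xpos_max : x N.*2 = 1.
Proof. by rewrite /xpos -mul2n natrM mulr_natl mulr2n addrK divff ?gt_eqF. Qed.

Lemma xpos_itv k : (k <= N.*2)%N -> -1 <= x k <= 1.
Proof.
move=> kN; rewrite /xpos ler_pdivlMr// ler_pdivrMr// mulN1r mul1r lerBrDr addNr ler0n/=.
by rewrite lerBlDr -natrD addnn ler_nat.
Qed.

Lemma xposS_sub k : x k.+1 - x k = q.
Proof. by rewrite xposS// addrAC subrr add0r. Qed.

(** Each of the 2N cells contributes at most L/N^2; the sum has 2N+1 points, and the extra last one
    costs M/N. *)
Lemma riemann_sum (f : R -> R) (L M : R) : bmeas f ->
  (forall u v, -1 <= u <= 1 -> -1 <= v <= 1 -> `|f u - f v| <= L * `|u - v|) ->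
  (forall u, -1 <= u <= 1 -> `|f u| <= M) ->
  `|prim f 1 - N%:R^-1 * \sum_(b < N.*2.+1) f (x b)| <= (2 * L + M) / N%:R.
Proof.
move=> bf fL fM.
have m1 : -1 <= (1 : R) <= 1 by rewrite lexx andbT; lra.
have L0 : 0 <= L.
  have m0 : -1 <= (0 : R) <= 1 by lra.
  by have := le_trans (normr_ge0 _) (fL 1 0 m1 m0); rewrite subr0 normr1 mulr1.
have E : prim f 1 = \sum_(b < N.*2) (prim f (x b.+1) - prim f (x b)).
  have := telescope_sumr (fun b => prim f (x b)) (leq0n N.*2).
  by rewrite xpos0 xpos_max prim_left subr0 big_mkord => ->.
rewrite big_ord_recr/= mulrDr opprD addrA E mulr_sumr -sumrB.
apply: (le_trans (ler_normB _ _)); rewrite mulrDl; apply: lerD; last first.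
  by rewrite normrM gtr0_norm// mulrC ler_wpM2r ?(ltW q0)//; apply: fM; exact: xpos_itv.
rewrite -mulrA -(sum_cst_bonds N0 (L / N%:R)); apply: (le_trans (ler_norm_sum _ _ _)).
apply: ler_sum => b _; have bN := ltn_ord b.
have /andP[b1 b2] := xpos_itv (ltnW bN); have /andP[c1 c2] := xpos_itv bN.
have bc : x b <= x b.+1 by rewrite -subr_ge0 xposS_sub ltW.
have := @prim_approx _ f (x b) (x b.+1) (f (x b)) (L * q) bf b1 bc.
rewrite xposS_sub [f _ * _]mulrC; apply => t /andP[t1 t2]; apply: (le_trans (fL _ _ _ _)); [lra|lra|].
rewrite ler_wpM2l// ger0_norm ?subr_ge0 ?(ltW t1)// -(xposS_sub b); lra.
Qed.

Lemma prim_sum (I : Type) (s : seq I) (F : I -> R -> R) u : (forall i, bmeas (F i)) ->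
  prim (fun t => \sum_(i <- s) F i t) u = \sum_(i <- s) prim (F i) u /\
  bmeas (fun t => \sum_(i <- s) F i t).
Proof.
move=> bF; elim: s => [|i s [IH1 IH2]].
  have e : (fun t => \sum_(i <- [::]) F i t) = (fun=> 0 : R) by apply/funext => t; rewrite big_nil.
  rewrite e big_nil; split; last exact: bmeas_cst.
  rewrite -[RHS](mul0r (prim (fun=> 0 : R) u)) -primZ; last exact: bmeas_cst.
  by congr prim; apply/funext => t; rewrite mul0r.
have e : (fun t => \sum_(j <- i :: s) F j t) = (fun t => F i t + \sum_(j <- s) F j t).
  by apply/funext => t; rewrite big_cons.
by rewrite e big_cons primD// IH1; split => //; exact: bmeasD.
Qed.

Lemma bmeas_indic (a b : R) : bmeas (fun u => \1_`[a, b[%classic u : R).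
Proof.
split; first exact: measurable_indic.
by exists 1 => u; rewrite indicE; case: (_ \in _); rewrite ?normr1 ?normr0.
Qed.

Lemma integral_cell (g : R -> R) (a b : R) : bmeas g -> -1 < a -> a <= b -> b <= 1 ->
  prim (fun u => \1_`[a, b[%classic u * g u) 1 = \int[leb]_(t in `]a, b]) g t.
Proof.
move=> bg a1 ab b1.
rewrite -integral_Lambda; last by apply: bmeasM => //; exact: bmeas_indic.
have -> : \int[leb]_(t in Lambda R) (\1_`[a, b[%classic t * g t) =
    \int[leb]_(t in Lambda R) (g \_ `[a, b[%classic) t.
  apply: eq_Rintegral => t _; rewrite indicE patchE.
  by case: (t \in _); rewrite ?mul1r ?mul0r.
rewrite -Rintegral_mkcondr (_ : Lambda R `&` `[a, b[ = `[a, b[%classic); last first.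
  apply/seteqP; split => t /=; first by case.
  rewrite /Lambda/= !in_itv/= => /andP[t1 t2]; split; last by rewrite t1.
  by rewrite (lt_le_trans a1 t1) (lt_le_trans t2 b1).
have fin (i j : itv_bound R) : i = BLeft a \/ i = BRight a -> j = BLeft b \/ j = BRight b ->
    leb.-integrable [set` Interval i j] (EFin \o g).
  move=> hi hj; apply: bmeas_integrable => //.
  exact: itv_measure_fin hi hj.
rewrite Rintegral_itv_bndo_bndc; last by apply: fin; left.
by rewrite Rintegral_itv_obnd_cbnd//; apply: fin; right.
Qed.

(** The cells of the interior sites have width 1/N and lie inside [-1,1], so each costs only the
    oscillation of G. The two end sites have no cell and cost M/N each. *)
Lemma empirical_integral (eta : config N) (G : R -> R) (L M : R) : bmeas G ->
  (forall u v, `|G u - G v| <= L * `|u - v|) -> (forall u, `|G u| <= M) ->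
  `|prim (fun u => empirical eta u * G u) 1 -
    N%:R^-1 * \sum_(k < N.*2.+1) occ R eta k * G (x k)| <= (3 * L + 2 * M) / N%:R.
Proof.
move=> bG GL GM.
have L0 : 0 <= L by have := le_trans (normr_ge0 _) (GL 1 0); rewrite subr0 normr1 mulr1.
have M0 : 0 <= M by exact: le_trans (GM 0).
pose a k : R := x k - (2 * N%:R)^-1; pose b k : R := x k + (2 * N%:R)^-1.
pose inner_site (k : site N) := (0 < k < N.*2)%N.
pose F (k : site N) u : R :=
  (inner_site k)%:R * (occ R eta k * (\1_`[a k, b k[%classic u * G u)).
have h0 : (2 * N%:R)^-1 = q / 2 :> R by rewrite invfM mulrC.
have bcell (k : site N) : bmeas (fun u => \1_`[a k, b k[%classic u * G u).
  by apply: bmeasM => //; exact: bmeas_indic.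
have bF k : bmeas (F k) by apply: bmeasZ; exact: bmeasZ.
have eF : (fun u => empirical eta u * G u) = (fun u => \sum_(k <- index_enum (site N)) F k u).
  apply/funext => u; rewrite /empirical mulr_suml big_mkcond/=.
  apply: eq_bigr => k _; rewrite /F /inner_site; case: ifP => _; last by rewrite mul0r.
  by rewrite mul1r occE /a /b /macro -/(xpos N k) mulrA.
rewrite eF (prim_sum _ _ bF).1 mulr_sumr -sumrB.
apply: (le_trans (ler_norm_sum _ _ _)).
apply: (@le_trans _ _ (\sum_(k < N.*2.+1) (L * q ^+ 2 +
   (M * q * (k == 0 :> nat)%:R + M * q * (k == N.*2 :> nat)%:R)))); last first.
  rewrite !big_split/= (sum_delta _ _ (fun=> M * q)) (sum_delta _ _ (fun=> M * q)) ltnSn ltn0Sn.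
  rewrite sumr_const card_ord -[_ *+ _]mulr_natl.
  have -> : (3 * L + 2 * M) / N%:R = 3 * (L * q) + (M * q + M * q) by rewrite -/q; ring.
  rewrite lerD2r; have -> : (N.*2.+1)%:R * (L * q ^+ 2) = (N.*2.+1)%:R / N%:R * (L * q).
    by rewrite -/q; ring.
  by rewrite ler_wpM2r ?ratio_le3// mulr_ge0// ltW.
apply: ler_sum => k _.
have kN : (k <= N.*2)%N by rewrite -ltnS.
have Lq0 : 0 <= L * q ^+ 2 by rewrite mulr_ge0 ?sqr_ge0.
have Mq0 : 0 <= M * q by rewrite mulr_ge0// ltW.
have occ1 : `|occ R eta k| <= 1 by rewrite ger0_norm ?occ_ge0 ?occ_le1.
have edge : inner_site k = false -> `|prim (F k) 1 - q * (occ R eta k * G (x k))| <= M * q.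
  move=> ik; rewrite /F ik.
  have -> : (fun u => false%:R * (occ R eta k * (\1_`[a k, b k[%classic u * G u))) = (fun u => 0 * 0 : R).
    by apply/funext => u; rewrite !mul0r.
  rewrite primZ; last exact: bmeas_cst.
  rewrite mul0r sub0r normrN normrM gtr0_norm// mulrC ler_wpM2r ?(ltW q0)//.
  by rewrite normrM -[leRHS]mul1r ler_pM.
have [k0|k0] := eqVneq (k : nat) 0%N.
  rewrite mulr1; apply: (@le_trans _ _ (M * q)).
    by apply: edge; rewrite /inner_site k0.
  by have : 0 <= M * q * (k == N.*2 :> nat)%:R by [rewrite mulr_ge0 | rewrite k0 mulr_ge0]; rewrite ?k0; lra.
have [kn|kn] := eqVneq (k : nat) N.*2.
  rewrite mulr0 mulr1 add0r; apply: (@le_trans _ _ (M * q)); last by rewrite lerDr.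
  by apply: edge; rewrite /inner_site kn ltnn andbF.
rewrite !mulr0 !addr0.
have ik : inner_site k by rewrite /inner_site lt0n k0 ltn_neqAle kn.
rewrite /F ik (_ : (fun u => _) = (fun u => occ R eta k * (\1_`[a k, b k[%classic u * G u))); last first.
  by apply/funext => u; rewrite mul1r.
rewrite primZ//.
have xk : k = k.-1.+1 :> nat by rewrite prednK// lt0n.
have ak1 : -1 < a k.
  have /andP[y1 _] : -1 <= x k.-1 <= 1 by apply: xpos_itv; exact: leq_trans (leq_pred _) kN.
  rewrite /a xk xposS// h0 -/q; move: q0; lra.
have bk1 : b k <= 1.
  have /andP[_ y1] : -1 <= x k.+1 <= 1 by apply: xpos_itv; rewrite ltn_neqAle kn.
  rewrite xposS// in y1; rewrite /b h0; move: q0 y1; rewrite -/q; lra.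
have ab : a k <= b k by rewrite /a /b h0; move: q0; lra.
rewrite integral_cell//.
have len : b k - a k = q by rewrite /a /b h0; field.
have := @integral_ocitv_le _ G (a k) (b k) (G (x k)) (L * q) bG ab.
rewrite len => H.
have -> : occ R eta k * \int[leb]_(t in `]a k, b k]) G t - N%:R^-1 * (occ R eta k * G (x k)) =
   occ R eta k * (\int[leb]_(t in `]a k, b k]) G t - G (x k) * q) by rewrite -/q; ring.
rewrite normrM -[leRHS]mul1r; apply: ler_pM => //.
rewrite expr2 mulrA; apply: H => t /andP[t1 t2].
apply: (le_trans (GL _ _)); apply: ler_wpM2l => //.
by move: t1 t2; rewrite /a /b h0 ler_norml; move: q0; lra.
Qed.

End RiemannSums.

(** * Hydrostatic limit *)

Lemma lipschitz_of_C1 (R : realType) (G dG : R -> R) : {within `[-1, 1], continuous G} ->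
  {within `[-1, 1], continuous dG} ->
  (forall u : R, -1 < u < 1 -> is_derive u (1 : R) G (dG u)) ->
  exists2 L, 0 <= L & forall u v, `|G (clampi u) - G (clampi v)| <= L * `|u - v|.
Proof.
move=> cG cd dGd; have [L dL] := clampi_bounded cd.
have L0 : 0 <= L by exact: le_trans (dL 0).
exists L => // u v; apply: (@le_trans _ _ (L * `|clampi u - clampi v|)); last first.
  by rewrite ler_wpM2l// clampi_lip.
have := clampi_itv u; have := clampi_itv v; move: (clampi u) (clampi v) => {u v}.
suff H a b : -1 <= a -> b <= 1 -> a <= b -> `|G b - G a| <= L * (b - a).
  move=> u v /andP[v1 v2] /andP[u1 u2]; have [uv|vu] := leP u v.
    by rewrite distrC (@ler0_norm _ (u - v)) ?subr_le0// opprB; apply: H.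
  by rewrite (@gtr0_norm _ (u - v)) ?subr_gt0//; apply: H => //; exact: ltW.
move=> a1 b1 ab.
have [c|c|] := @MVT_segment R G dG a b ab.
- rewrite in_itv/= => /andP[ac cb]; apply: dGd.
  by rewrite (le_lt_trans a1 ac) (lt_le_trans cb b1).
- have sub : `[a, b] `<=` `[-1, 1].
    move=> t /=; rewrite !in_itv/= => /andP[at' tb].
    by rewrite (le_trans a1 at') (le_trans tb b1).
  exact: (continuous_subspaceW sub cG).
move=> c; rewrite in_itv/= => /andP[ac cb] ->.
rewrite normrM (@ger0_norm _ (b - a)) ?subr_ge0// ler_wpM2r ?subr_ge0//.
have cI : -1 <= c <= 1 by rewrite (le_trans a1 ac) (le_trans cb b1).
by have := dL c; rewrite clampi_id.
Qed.

Section Hydrostatics.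
Context {R : realType}.
Variables (J K : R -> R -> R) (B : R).
Hypothesis HK : kernel_data J K B.
Variables (beta rhom rhop : R).
Hypothesis rhom01 : 0 < rhom < 1.
Hypothesis rhop01 : 0 < rhop < 1.
Hypothesis beta0 : 0 <= beta.
Hypothesis beta_small : beta * (90 * B) <= 1.
Notation rho := (stationary_profile K beta rhom rhop).

(** [clampi] keeps the value in [0,1] for every k, also past the lattice. *)
Definition site_profile (N k : nat) : R := rho (clampi (xpos N k)).

Let B0 : 0 <= B. Proof. exact: le_trans ler01 (kd_ge1 HK). Qed.

Let beta01 : 0 <= beta <= 1.
Proof.
rewrite beta0/=; apply: le_trans beta_small; rewrite ler_peMr//.
by have := kd_ge1 HK; lra.
Qed.

Let rho_lip := profile_lip HK rhom01 rhop01 beta0 beta_small.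
Let rho_meas := profile_meas HK rhom01 rhop01 beta0 beta_small.
Let rho_fixed := profile_fixed HK rhom01 rhop01 beta0 beta_small.
Let rho01 := profile01 HK rhom01 rhop01 beta0 beta_small.

Lemma site_profile01 N k : 0 <= site_profile N k <= 1.
Proof. by apply: rho01; exact: clampi_itv. Qed.

Lemma site_profileE N k : (0 < N)%N -> (k <= N.*2)%N -> site_profile N k = rho (xpos N k).
Proof. by move=> N0 kN; rewrite /site_profile clampi_id//; exact: xpos_itv. Qed.

Lemma site_profile_lip N k : (0 < N)%N -> (k < N.*2)%N ->
  `|site_profile N k.+1 - site_profile N k| <= (1 + 2 * B) / N%:R.
Proof.
move=> N0 kN; rewrite !site_profileE// 1?ltnW//.
apply: (le_trans (rho_lip _ _)); rewrite xposS_sub// ger0_norm//.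
Qed.

Let Cf : R := 2 * (B * (2 + 2 * B)) + B.

Lemma field_mean_drift N k : (0 < N)%N ->
  `|field K rho (xpos N k) - mean_drift (N := N) K (site_profile N) k| <= Cf / N%:R.
Proof.
move=> N0; pose f v := K (xpos N k) v * cl01 (rho v).
have bf : bmeas f by exact: (bmeas_field_integrand HK).
have -> : mean_drift (N := N) K (site_profile N) k = N%:R^-1 * \sum_(b < N.*2.+1) f (xpos N b).
  rewrite /mean_drift; congr (_ * _); apply: eq_bigr => b _.
  have bN : (b <= N.*2)%N by rewrite -ltnS.
  by rewrite /f site_profileE// cl01_id//; apply: rho01; exact: xpos_itv.
apply: riemann_sum => //.
- move=> u v _ _.
  have -> : f u - f v = (K (xpos N k) u - K (xpos N k) v) * cl01 (rho u) +
     K (xpos N k) v * (cl01 (rho u) - cl01 (rho v)) by rewrite /f; ring.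
  have -> : B * (2 + 2 * B) * `|u - v| = B * `|u - v| * 1 + B * ((1 + 2 * B) * `|u - v|) by ring.
  apply: (le_trans (ler_normD _ _)); apply: lerD; rewrite normrM; apply: ler_pM => //.
  + exact: (kd_lipr HK).
  + by have := cl01_itv (rho u); rewrite ler_norml; lra.
  + exact: (kd_le HK).
  + exact: le_trans (cl01_lip _ _) (rho_lip _ _).
- move=> u _; rewrite /f normrM -[leRHS]mulr1 ler_pM//; first exact: (kd_le HK).
  by have := cl01_itv (rho u); rewrite ler_norml; lra.
Qed.

Let c0 := slope K beta rhom rhop rho.
Let K3 : R := beta / 2 * (4 * B * (1 + 2 * B) + B) + Cf.

(** The fixed-point equation read along the lattice: [picard_expansion] gives the increment, and the
    field is replaced by its Riemann sum at a further cost of order 1/N^2. *)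
Lemma site_profile_expansion N k : (0 < N)%N -> (k < N.*2)%N ->
  `|site_profile N k.+1 - site_profile N k -
    (c0 + beta / 2 * (mobility (site_profile N k) *
      mean_drift (N := N) K (site_profile N) k)) / N%:R| <= K3 / N%:R ^+ 2.
Proof.
move=> N0 kN; have NR0 : 0 < N%:R :> R by rewrite ltr0n.
have xk := xpos_itv (R := R) N0 (ltnW kN); have xk1 := xpos_itv (R := R) N0 kN.
have := picard_expansion HK rhom rhop beta0 rho_meas rho_lip xk xk1.
rewrite !rho_fixed xposS_sub// -!site_profileE// 1?ltnW// => h1.
have h2 := field_mean_drift k N0.
rewrite /src /sig cl01_id ?rho01// -site_profileE// 1?ltnW// in h1.
set r := site_profile N k in h1 h2 *; set r' := site_profile N k.+1 in h1 *.
set m := mean_drift _ _ _ in h2 *; set fl := field K rho _ in h1 h2.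
have -> : r' - r - (c0 + beta / 2 * (mobility r * m)) / N%:R =
  (r' - r - N%:R^-1 * (c0 + beta / 2 * (mobility r * fl))) +
  N%:R^-1 * (beta / 2 * (mobility r * (fl - m))) by ring.
apply: (le_trans (ler_normD _ _)); rewrite /K3 mulrDl; apply: lerD.
  by apply: (le_trans h1); rewrite exprVn.
have -> : Cf / N%:R ^+ 2 = N%:R^-1 * (1 * (1 * (Cf / N%:R))) by field; rewrite gt_eqF.
rewrite normrM gtr0_norm ?invr_gt0// ler_wpM2l ?invr_ge0 ?(ltW NR0)//.
have b01 := beta01.
rewrite normrM ler_pM//; first by rewrite ger0_norm; lra.
rewrite normrM ler_pM// /mobility.
have := site_profile01 N k; rewrite -/r => /andP[ra rb].
rewrite ger0_norm ?mulr_ge0// ?subr_ge0//; have := sqr_ge0 (r - 2^-1); lra.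
Qed.

Lemma block_energy_bound : exists2 C, 0 <= C &
  forall (N l : nat) (mu : config N -> R), (0 < N)%N -> (0 < l)%N -> (l <= N)%N ->
    invariant_prob (@generator R J beta rhom rhop N) mu ->
    expect mu (block_energy (site_profile N) l) <= C * (l%:R / N%:R + l%:R^-1).
Proof.
have K10 : 0 <= 4 * B * expR (4 * B) by rewrite !mulr_ge0 ?expR_ge0.
(* The constant is supplied by unification with the energy estimate; as it is introduced first, it
   cannot depend on N, l or mu. *)
eexists; last first.
  move=> N l mu N0 l0 lN muinv.
  apply: (expect_block_energy_le N0 beta01 (kd_ge1 HK) (kd_le HK) (kd_lipl HK) (kd_lipr HK)
    (site_profile01 N) _ _ (fun k => @site_profile_lip N k N0) (exchange_rate_le N0 HK beta01)
    (exchange_rate_expansion N0 HK beta01) (fun k => @site_profile_expansion N k N0)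
    rhom01 rhop01 l0 lN muinv _ beta_small).
  - rewrite site_profileE// xpos0//; exact: (profile_left HK rhom01 rhop01 beta0 beta_small).
  - rewrite site_profileE// xpos_max//; exact: (profile_right HK rhom01 rhop01 beta0 beta_small).
  - exact: (dirichlet_bound rhom01 rhop01 N0 muinv K10 (exchange_rate_le N0 HK beta01)).
have b1 := kd_ge1 HK; have bp := B0; have be := beta01.
have th := normr_ge0 (logit rhop - logit rhom); have cc := normr_ge0 c0.
have e0 := expR_ge0 `|logit rhop - logit rhom|; have e1 := expR_ge0 (4 * B).
have Cf0 : 0 <= Cf by rewrite /Cf !(addr_ge0, mulr_ge0).
have K30 : 0 <= K3 by rewrite /K3 !(addr_ge0, mulr_ge0).
by rewrite !(addr_ge0, mulr_ge0, exprn_ge0).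
Qed.

Lemma bmeas_empirical N (eta : config N) : bmeas (empirical (R := R) eta).
Proof.
pose F (k : site N) u : R := (if (0 < k < N.*2)%N then (eta k)%:R else 0) *
  \1_`[macro R k - (2 * N%:R)^-1, macro R k + (2 * N%:R)^-1[%classic u.
have bF k : bmeas (F k) by apply: bmeasZ; exact: bmeas_indic.
have [_ H] := prim_sum (index_enum (site N)) 0 bF.
congr bmeas: H; apply/funext => u; rewrite /empirical [RHS]big_mkcond/=.
by apply: eq_bigr => k _; rewrite /F; case: ifP => _ //; rewrite mul0r.
Qed.

(** Both pairings become lattice sums up to O(1/N), and in their difference G varies slowly enough
    for block averages to replace the fluctuations. All errors fit under l/N since l >= 1. *)
Lemma empirical_close (G : R -> R) : C2_0 G -> exists2 C, 0 <= C &
  forall (N l : nat) (eta : config N), (0 < N)%N -> (0 < l)%N -> (l <= N)%N ->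
    `|inner (empirical eta) G - inner rho G| <=
    C * (N%:R^-1 * \sum_(k < N.*2.+1) `|block_avg l (fluct (site_profile N) eta) k| + l%:R / N%:R).
Proof.
move=> [dG [d2G [cG cd _ dGd _ _ _]]].
have [L L0 GL] := lipschitz_of_C1 cG cd dGd.
have [M GM] := clampi_bounded cG.
have M0 : 0 <= M by exact: le_trans (GM 0).
pose Gc u := G (clampi u).
have bG : bmeas Gc by apply: bmeas_lipschitz GL _; exists M.
have B2 : 0 <= M * (1 + 2 * B) by rewrite mulr_ge0// addr_ge0// mulr_ge0.
pose C := (3 * L + 2 * M) + (2 * (L + M * (1 + 2 * B)) + M) + 3 * (M + L) + M.
exists C; first by rewrite /C; lra.
move=> N l eta N0 l0 lN; have NR0 : 0 < N%:R :> R by rewrite ltr0n.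
set r := site_profile N.
pose q : R := N%:R^-1; have q0 : 0 < q by rewrite invr_gt0.
have brho : bmeas rho.
  rewrite (_ : rho = picard K beta rhom rhop rho); last first.
    by apply/funext => u; rewrite rho_fixed.
  exact: (bmeas_picard HK rhom01 rhop01 beta0 beta_small rho_meas).
have e1 := empirical_integral N0 eta bG GL GM.
rewrite -(inner_clampi (bmeas_empirical eta) bG) in e1.
have e2 : `|inner rho G - N%:R^-1 * \sum_(b < N.*2.+1) r b * Gc (xpos N b)| <=
    (2 * (L + M * (1 + 2 * B)) + M) / N%:R.
  rewrite (inner_clampi brho bG).
  rewrite (eq_bigr (fun b : 'I_(N.*2.+1) => rho (xpos N b) * Gc (xpos N b))); last first.
    by move=> b _; rewrite /r site_profileE// -ltnS.
  apply: (@riemann_sum _ _ N0 (fun u => rho u * Gc u)); first exact: bmeasM.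
    move=> u v /rho01/andP[u1 u2] vI.
    have -> : rho u * Gc u - rho v * Gc v = rho u * (Gc u - Gc v) + (rho u - rho v) * Gc v by ring.
    have -> : (L + M * (1 + 2 * B)) * `|u - v| = 1 * (L * `|u - v|) + (1 + 2 * B) * `|u - v| * M by ring.
    apply: (le_trans (ler_normD _ _)); apply: lerD; rewrite normrM; apply: ler_pM => //.
      by rewrite ger0_norm.
    - exact: GL.
    - exact: GM.
  move=> u /rho01/andP[u1 u2]; rewrite normrM -[leRHS]mul1r ler_pM//.
    by rewrite ger0_norm.
  exact: GM.
have r01 := site_profile01 N.
have e3 := @sum_block_avg_le R N N0 l l0 (fun k => Gc (xpos N k)) (fluct r eta) (M + L).
have {}e3 : `|\sum_(i < N.*2.+1) Gc (xpos N i) * fluct r eta i -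
   \sum_(i < N.*2.+1) Gc (xpos N i) * block_avg l (fluct r eta) i| <= 3 * (M + L) * l%:R.
  apply: e3 => k.
  - by move=> _; apply: (le_trans (GM _)); rewrite lerDl.
  - move=> _; apply: (le_trans (GL _ _)); rewrite xposS_sub// ger0_norm ?(ltW q0)//.
    by rewrite ler_wpM2r ?(ltW q0)// lerDr.
  - exact: fluct_le1.
  - exact: fluct_out.
set A := \sum_(k < N.*2.+1) `|_|.
have e4 : `|\sum_(i < N.*2.+1) Gc (xpos N i) * block_avg l (fluct r eta) i| <= M * A.
  apply: (le_trans (ler_norm_sum _ _ _)); rewrite mulr_sumr; apply: ler_sum => k _.
  by rewrite normrM ler_wpM2r// GM.
have e5 : \sum_(k < N.*2.+1) occ R eta k * Gc (xpos N k) - \sum_(b < N.*2.+1) r b * Gc (xpos N b) =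
   \sum_(i < N.*2.+1) Gc (xpos N i) * fluct r eta i.
  rewrite -sumrB; apply: eq_bigr => k _.
  by rewrite /fluct -ltnS ltn_ord; ring.
move: e1 e2 e3 e4; rewrite -/q.
set a := inner (empirical eta) G; set b := inner rho G.
set X := \sum_(k < N.*2.+1) occ R eta k * _ in e5 *.
set Y := \sum_(k < N.*2.+1) r k * _ in e5 *.
set Z := \sum_(i < N.*2.+1) Gc (xpos N i) * fluct r eta i in e5 *.
set W := \sum_(i < N.*2.+1) Gc (xpos N i) * _ => e1 e2 e3 e4.
have ql : q <= l%:R * q by rewrite ler_peMl ?(ltW q0)// ler1n.
have A0 : 0 <= A by apply: sumr_ge0.
have -> : a - b = (a - q * X) - (b - q * Y) + q * ((Z - W) + W) by rewrite -e5; ring.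
apply: (le_trans (ler_normD _ _)).
have h1 : `|(a - q * X) - (b - q * Y)| <= ((3 * L + 2 * M) + (2 * (L + M * (1 + 2 * B)) + M)) * (l%:R * q).
  apply: (@le_trans _ _ (((3 * L + 2 * M) + (2 * (L + M * (1 + 2 * B)) + M)) * q)).
    by rewrite mulrDl; apply: (le_trans (ler_normB _ _)); exact: lerD.
  by apply: ler_wpM2l => //; lra.
have h2 : `|q * ((Z - W) + W)| <= q * (3 * (M + L) * l%:R + M * A).
  rewrite normrM gtr0_norm// ler_wpM2l ?(ltW q0)//.
  by apply: (le_trans (ler_normD _ _)); exact: lerD.
apply: (le_trans (lerD h1 h2)).
have qA : 0 <= q * A by rewrite mulr_ge0// ltW.
have lq0 : 0 <= l%:R * q by rewrite mulr_ge0// ltW.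
rewrite -/q /C.
set c1 := 3 * L + 2 * M; set c2 := 2 * _ + M; set c3 := 3 * (M + L).
have c10 : 0 <= c1 by rewrite /c1; lra.
have c20 : 0 <= c2 by rewrite /c2; lra.
have c30 : 0 <= c3 by rewrite /c3; lra.
have p1 : 0 <= (c1 + c2 + c3) * (q * A) by apply: mulr_ge0 => //; move: c10 c20 c30; lra.
have p2 : 0 <= M * (l%:R * q) by rewrite mulr_ge0.
lra.
Qed.

(** Chebyshev's inequality: on the event, delta^2 is at most a multiple of the block energy plus
    l/N, by [empirical_close] and [block_sum_sqr_le]; then the expectation is taken. *)
Lemma hydrostatic_bound (G : R -> R) (delta : R) : C2_0 G -> 0 < delta ->
  exists2 C, 0 <= C &
  forall (N l : nat) (mu : config N -> R), (0 < N)%N -> (0 < l)%N -> (l <= N)%N ->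
    invariant_prob (@generator R J beta rhom rhop N) mu ->
    prob_of mu (fun eta => delta <= `|inner (empirical eta) G - inner rho G|) <=
    C * (l%:R / N%:R + l%:R^-1).
Proof.
move=> HG d0.
have [C1 C10 H1] := block_energy_bound; have [C2 C20 H2] := empirical_close HG.
exists (2 * C2 ^+ 2 * (3 * C1 + 1) / delta ^+ 2).
  by rewrite divr_ge0 ?exprn_ge0 ?(ltW d0)// !mulr_ge0 ?addr_ge0 ?mulr_ge0 ?sqr_ge0.
move=> N l mu N0 l0 lN muinv; have muP : is_prob mu by case: muinv.
have NR0 : 0 < N%:R :> R by rewrite ltr0n.
have lR0 : 0 < l%:R :> R by rewrite ltr0n.
have {}H1 := H1 N l mu N0 l0 lN muinv.
set t := l%:R / N%:R in H1 *.
have t0 : 0 <= t by rewrite divr_ge0 ?ltW.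
have t1 : t <= 1 by rewrite ler_pdivrMr// mul1r ler_nat.
set Y := block_energy (site_profile N) l in H1.
have point eta : delta <= `|inner (empirical eta) G - inner rho G| ->
    delta ^+ 2 <= 2 * C2 ^+ 2 * (3 * Y eta + t).
  move=> de; have := H2 N l eta N0 l0 lN.
  have := block_sum_sqr_le N0 (site_profile N) l eta; rewrite -/(Y eta) /=.
  set A := N%:R^-1 * _ => A2 h.
  have A0 : 0 <= A by rewrite mulr_ge0 ?invr_ge0 ?(ltW NR0)// sumr_ge0.
  have d1 : delta ^+ 2 <= (C2 * (A + t)) ^+ 2.
    by apply: sqr_le_norm; rewrite gtr0_norm//; exact: le_trans h.
  apply: (le_trans d1); rewrite exprMn.
  have -> : 2 * C2 ^+ 2 * (3 * Y eta + t) = C2 ^+ 2 * (2 * (3 * Y eta + t)).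
    by move: (Y eta) => y; ring.
  apply: ler_wpM2l; first exact: sqr_ge0.
  have tt : t ^+ 2 <= t by rewrite expr2 ler_piMl.
  have := sqr_ge0 (A - t); lra.
have dd : 0 < delta ^+ 2 by rewrite exprn_gt0.
rewrite mulrAC ler_pdivlMr//.
rewrite /prob_of mulr_suml.
apply: (@le_trans _ _ (expect mu (fun eta => 2 * C2 ^+ 2 * (3 * Y eta + t)))).
  rewrite /expect big_mkcond/=; apply: ler_sum => eta _.
  have Y0 : 0 <= Y eta.
    by rewrite mulr_ge0 ?invr_ge0 ?(ltW NR0)// sumr_ge0// => k _; exact: sqr_ge0.
  case: ifP => [/point h|_]; first by rewrite ler_wpM2l// muP.1.
  by rewrite mulr_ge0 ?muP.1// !mulr_ge0 ?sqr_ge0// addr_ge0// mulr_ge0.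
rewrite (expectZ mu (2 * C2 ^+ 2)) expectD (expectZ mu 3) expect_cst//.
rewrite -[leRHS]mulrA; apply: ler_wpM2l; first by rewrite mulr_ge0// sqr_ge0.
have i0 : 0 <= l%:R^-1 :> R by rewrite invr_ge0 ltW.
lra.
Qed.

End Hydrostatics.

Theorem theorem2p3 (R : realType) (J : R -> R -> R) (HJ : is_kernel J) :
  exists2 beta0 : R, 0 < beta0 &
  forall (rhom rhop beta : R),
    0 < rhom < 1 -> 0 < rhop < 1 -> 0 <= beta < beta0 ->
  exists rhobar : R -> R,
    [/\ weak_solution J beta rhom rhop rhobar,
        (forall rho : R -> R, weak_solution J beta rhom rhop rho ->
           {ae lebesgue_measure, forall u, Lambda R u -> rho u = rhobar u}) &
        forall mu_stat : (forall N : nat, config N -> R),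
          (forall N : nat, (0 < N)%N ->
             invariant_prob (@generator R J beta rhom rhop N) (mu_stat N)) ->
        forall (G : R -> R) (delta : R), C2_0 G -> 0 < delta ->
          (fun N : nat => prob_of (mu_stat N)
             (fun eta => delta <= `|inner (empirical eta) G - inner rhobar G|))
            @ \oo --> (0 : R)].
Proof.
have [K [B HK]] := kernel_data_exists HJ.
have B90 : 0 < 90 * B by have := kd_ge1 HK; lra.
(* [B] depends on the kernel alone, so the threshold is uniform in the reservoir densities. *)
exists (90 * B)^-1; first by rewrite invr_gt0.
move=> rhom rhop beta rm rp /andP[b0 b1].
have bs : beta * (90 * B) <= 1 by rewrite -ler_pdivlMr// div1r ltW.
exists (stationary_profile K beta rhom rhop); split.
- exact: (profile_weak_solution HK rm rp b0 bs).
- exact: (weak_solution_unique HK rm rp b0 bs).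
move=> mu muinv G delta HG d0.
have [C C0 H] := hydrostatic_bound HK rm rp b0 bs HG d0.
apply/cvgrPdist_le => /= e e0.
(* The block length depends on e only and makes C/l at most e/2; afterwards N is taken large enough
   for C * l / N to be at most e/2. *)
pose l := (Num.bound (2 * C / e)).+1.
have l0 : (0 < l)%N by [].
have lR0 : 0 < l%:R :> R by rewrite ltr0n.
have hl : C * l%:R^-1 <= e / 2.
  have : 2 * C / e < l%:R.
    apply: (lt_trans (archi_boundP _)); last by rewrite ltr_nat.
    by rewrite divr_ge0 ?mulr_ge0// ltW.
  by rewrite ltr_pdivrMr// => h; rewrite ler_pdivrMr//; lra.
near=> N.
have N0 : (0 < N)%N by near: N; exact: nbhs_infty_gt.
have lN : (l <= N)%N by near: N; exact: nbhs_infty_ge.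
have NR0 : 0 < N%:R :> R by rewrite ltr0n.
have hN : C * (l%:R / N%:R) <= e / 2.
  rewrite mulrA ler_pdivrMr//.
  have : 2 * (C * l%:R) / e <= N%:R.
    near: N; exact: nbhs_infty_ger.
  by rewrite ler_pdivrMr//; lra.
have P0 : 0 <= prob_of (mu N) (fun eta => delta <= `|inner (empirical eta) G -
    inner (stationary_profile K beta rhom rhop) G|).
  by apply: sumr_ge0 => eta _; case: (muinv N N0) => -[].
rewrite sub0r normrN ger0_norm//.
apply: (le_trans (H N l (mu N) N0 l0 lN (muinv N N0))); rewrite mulrDr; lra.
Unshelve. all: by end_near.
Qed.
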